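(* Let $(T,A)$ be a locally constant integral uniform cocycle on $(\Delta,\mu)$, and let $\Theta\subset\mathbb{P}^{p-1}$ be adapted to $(T,A)$. Assume that for every line $J\in\mathcal{J}(\Theta)$, $J\cap E^{cs}(x)=\emptyset$ for $\mu$-almost every $x\in\Delta$. Then if $L$ is a line contained in $\mathbb{R}^p$ parallel to some element of $\Theta$, we have $L\cap W^s(x)\subset\mathbb{Z}^p$ for $\mu$-almost every $x\in\Delta$.
   Context: Cocycle: a pair $(T,A)$, $T:\Delta\to\Delta$, $A:\Delta\to\mathrm{GL}(p,\mathbb{R})$, with $A_n(x)=A(T^{n-1}(x))\cdots A(x)$. For $B\in\mathrm{GL}(p,\mathbb{R})$, $\|B\|_0=\max\{\|B\|,\|B^{-1}\|\}$. Uniform: $(\Delta,\mu)$ is a probability space, $\mu$ is $T$-invariant and ergodic, and $\int\ln\|A\|_0\,d\mu<\infty$. Integral: $A(x)\in\mathrm{GL}(p,\mathbb{Z})$ for a.e. $x$. Strongly expanding: there is a partition mod $0$ $\{\Delta^{(l)},l\in\mathbb{Z}\}$ of $\Delta$ into sets of positive measure such that $T$ maps each $\Delta^{(l)}$ onto $\Delta$, $T|\Delta^{(l)}$ is invertible and $(T|\Delta^{(l)})_*\mu$ is equivalent to $\mu|\Delta^{(l)}$; moreover, writing for a finite integer word $\underline l=(l_1,\dots,l_n)$, $\Delta^{\underline l}=\{x:T^{k-1}x\in\Delta^{(l_k)},1\le k\le n\}$, $T^{\underline l}=T^n|\Delta^{\underline l}$, $\mu^{\underline l}=\mu(\Delta^{\underline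 l})^{-1}T^{\underline l}_*\mu$, there is $K>0$ with $K^{-1}\le d\mu^{\underline l}/d\mu\le K$ for all words $\underline l$. Locally constant: $T$ is strongly expanding and $A$ is constant, equal to some $A^{(l)}$, on each $\Delta^{(l)}$. Central stable space: $E^{cs}(x)=\{w\in\mathbb{R}^p:\limsup_n\|A_n(x)w\|^{1/n}\le1\}$. Weak-stable space: $W^s(x)=\{w\in\mathbb{R}^p:\|A_n(x)w\|_{\mathbb{R}^p/\mathbb{Z}^p}\to0\}$, where $\|\cdot\|_{\mathbb{R}^p/\mathbb{Z}^p}$ is the Euclidean distance to $\mathbb{Z}^p$. A compact set $\Theta\subset\mathbb{P}^{p-1}$ is adapted to $(T,A)$ if $A^{(l)}\cdot\Theta\subset\Theta$ for all $l$ and, for $\mu$-a.e. $x$, every $w\in\mathbb{R}^p\setminus\{0\}$ whose projectivization lies in $\Theta$ satisfies $\|A(x)w\|\ge\|w\|$ and $\|A_n(x)w\|\to\infty$. $\mathcal{J}(\Theta)$ is the set of (affine) lines in $\mathbb{R}^p$ parallel to some element of $\Theta$ and not passing through $0$. *)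

(* Defs.v *)
From HB Require Import structures.
From mathcomp Require Import all_boot all_order all_algebra.
From mathcomp Require Import all_classical all_reals all_analysis.
Set Implicit Arguments. Unset Strict Implicit. Unset Printing Implicit Defensive.
Import Order.TTheory GRing.Theory Num.Theory.
Import numFieldNormedType.Exports.
Local Open Scope classical_set_scope.
Local Open Scope ring_scope.

Section Defs.
Context {R : realType} {p : nat}.

Definition eucl (v : 'cV[R]_p) : R := Num.sqrt (\sum_i (v i 0) ^+ 2).

Definition opnorm (B : 'M[R]_p) : R :=
  sup [set eucl (B *m v) | v in [set v : 'cV[R]_p | eucl v <= 1]].

Definition norm0 (B : 'M[R]_p) : R := Num.max (opnorm B) (opnorm (invmx B)).

Definition intvec (v : 'cV[R]_p) : Prop := forall i, v i 0 \is a Num.int.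

Definition GLZ (B : 'M[R]_p) : Prop :=
  [/\ forall i j, B i j \is a Num.int, B \in unitmx &
      forall i j, invmx B i j \is a Num.int].

Definition distZ (v : 'cV[R]_p) : R :=
  inf [set eucl (v - z) | z in [set z : 'cV[R]_p | intvec z]].

Fixpoint cocycle {X : Type} (T : X -> X) (A : X -> 'M[R]_p) (n : nat) (x : X)
  : 'M[R]_p :=
  match n with
  | 0 => 1%:M
  | n'.+1 => A (iter n' T x) *m cocycle T A n' x
  end.

Definition Ecs {X : Type} (T : X -> X) (A : X -> 'M[R]_p) (x : X)
  : set 'cV[R]_p :=
  [set w | (limn_esup (fun n : nat =>
              ((eucl (cocycle T A n x *m w)) `^ (n%:R^-1))%:E) <= 1)%E].

Definition Ws {X : Type} (T : X -> X) (A : X -> 'M[R]_p) (x : X)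
  : set 'cV[R]_p :=
  [set w | (fun n : nat => distZ (cocycle T A n x *m w)) @ \oo --> 0].

Definition line (v th : 'cV[R]_p) : set 'cV[R]_p :=
  [set v + t *: th | t in [set: R]].

(* A compact subset of P^{p-1}, represented by the cone C of its nonzero
   representatives in R^p: C consists of nonzero vectors, is invariant under
   nonzero scaling, and its trace on the unit sphere is compact. *)
Definition proj_compact (C : set 'cV[R]_p) : Prop :=
  [/\ forall w, C w -> w != 0,
      forall w (c : R), C w -> c != 0 -> C (c *: w) &
      compact (C `&` [set w | eucl w = 1])].
End Defs.

Section Cocycles.
Context {R : realType} {d : measure_display} {Delta : measurableType d}.
Local Open Scope ereal_scope.

Definition uniform_cocycle {p : nat} (mu : probability Delta R)
  (T : Delta -> Delta) (A : Delta -> 'M[R]_p) : Prop :=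
  [/\ measurable_fun setT T,
      (forall B, measurable B -> mu (T @^-1` B) = mu B),
      (forall B, measurable B -> T @^-1` B = B -> mu B = 0 \/ mu B = 1) &
      \int[mu]_x (ln (norm0 (A x)))%:E < +oo].

Definition integral_cocycle {p : nat} (mu : probability Delta R)
  (A : Delta -> 'M[R]_p) : Prop :=
  {ae mu, forall x, GLZ (A x)}.

Definition cylinder (D : int -> set Delta) (T : Delta -> Delta) (s : seq int)
  : set Delta :=
  [set x | forall k, (k < size s)%N -> D (nth 0%R s k) (iter k T x)].

Definition strongly_expanding (mu : probability Delta R) (T : Delta -> Delta)
  (D : int -> set Delta) : Prop :=
  measurable_fun setT T /\
      (forall l, measurable (D l) /\ 0 < mu (D l)) /\
      (forall l l', l != l' -> mu (D l `&` D l') = 0) /\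
      mu (~` \bigcup_l D l) = 0 /\
      (forall l, T @` D l = setT /\ set_inj (D l) T /\
         forall B, measurable B -> measurable (T @` (D l `&` B))) /\
      (forall l B, measurable B -> (mu (D l `&` T @^-1` B) = 0 <-> mu B = 0)) /\
      (* bounded distortion: K^{-1} <= d mu^{l}/d mu <= K for every word l,
         where mu^{l} = mu(Delta^{l})^{-1} (T^n|Delta^{l})_* mu *)
      (exists K : R, (0 < K)%R /\
        forall (s : seq int) B, measurable B ->
          let c := cylinder D T s in
          (K^-1)%:E * mu B * mu c <= mu (c `&` (iter (size s) T) @^-1` B) /\
          mu (c `&` (iter (size s) T) @^-1` B) <= K%:E * mu B * mu c).

Definition locally_constant {p : nat} (mu : probability Delta R)
  (T : Delta -> Delta) (A : Delta -> 'M[R]_p)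
  (D : int -> set Delta) (Al : int -> 'M[R]_p) : Prop :=
  strongly_expanding mu T D /\
  {ae mu, forall x, forall l, D l x -> A x = Al l}.

Definition adapted {p : nat} (mu : probability Delta R) (T : Delta -> Delta)
  (A : Delta -> 'M[R]_p) (Al : int -> 'M[R]_p) (C : set 'cV[R]_p) : Prop :=
  [/\ proj_compact C,
      (forall l w, C w -> C (Al l *m w)) &
      {ae mu, forall x, forall w, C w ->
         (eucl w <= eucl (A x *m w))%R /\
         (fun n : nat => eucl (cocycle T A n x *m w)) @ \oo --> +oo%R}].
End Cocycles.

(* Main.v *)
Require Import Defs.
From HB Require Import structures.
From mathcomp Require Import all_boot all_order all_algebra.
From mathcomp Require Import all_classical all_reals all_analysis.
From mathcomp Require Import measurable_realfun ring lra zify.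
Import Order.TTheory GRing.Theory Num.Theory.
Import numFieldNormedType.Exports.
Local Open Scope classical_set_scope.
Local Open Scope ring_scope.
Set Implicit Arguments.
Unset Strict Implicit.
Unset Printing Implicit Defensive.

(** Write d(J) for the distance from a line J to the origin and A_n(x) for the
    cocycle. If d(A_n(x) J) grew at most at a small exponential rate, then the
    points of A_n(x) J closest to 0 would shadow the orbit of a single point of J,
    because the direction of J is expanded exponentially; since the vectors of small
    growth rate form a decreasing family of linear spaces, ergodicity gives a
    positive rate below which this would produce a point of J in E^cs(x). Hence
    every J in J(Theta) grows at a uniform rate at some time, uniformly in J up to a
    set of small measure, and bounded distortion turns this into a positive
    conditional drift of ln d(A_N J) for a large block length N.

    Suppose that a point of J stays close to Z^p at all block times. Following it,
    one replaces J by A_N J - e with e an integer vector. The expansion of the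
    direction shows that d(A_N J - e) is at least d(J) divided by the norm of the
    block, and e = 0 unless this norm is very large. The drift makes the average of
    d^(-rho) contract, where blocks of large norm are damped by weights which pay
    for the choice of e; so the survival probability decays exponentially on the
    points where the total weight is small infinitely often. Almost every orbit
    visits this set infinitely often, so for almost every x each line A_n L - e that
    approximates a point w of L in W^s(x) at such a time passes through 0. Then L
    contains integer points arbitrarily close to w, by expansion of the direction. *)

(** * Euclidean geometry of lines *)

(** Only ln ||A||_0 is integrable, so no positive power of a block norm need have a finite mean:
    both the contraction of d^(-rho) and the count of possible e, of order norm^p, can fail on rare
    blocks. Hence two thresholds on the log norm of a block: beyond [b] the drift is given up,
    beyond some [b' >= b] a nonzero e is allowed. The exponent rho depends on [b]; [b'] is chosen
    after rho, because the cost of branching has to be small compared with rho. The mean weight of a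
    block is then at most rho/8, against a gain of rho/2, so that by Markov the total weight of n
    blocks is at most n rho/4 with probability at least 1/2. The point w of L in W^s(x) depends on
    x, so survival must be estimated for all points of a line at once. This is an uncountable union,
    whence the outer measure. The lines A_n L - e, on the contrary, are indexed by words and integer
    vectors, a countable family, and their null sets can be united. Conditioning on the past is
    expressed by sums over words, where bounded distortion reads P(st) <= K P(s) P(t). *)

Section Euclidean.
Context {R : realType} {p : nat}.
Implicit Types u v w th : 'cV[R]_p.

Definition dot u v : R := \sum_i u i 0 * v i 0.

Lemma dotC u v : dot u v = dot v u.
Proof. by apply: eq_bigr => i _; rewrite mulrC. Qed.

Lemma dotDl u v w : dot (u + v) w = dot u w + dot v w.
Proof. by rewrite -big_split; apply: eq_bigr => i _; rewrite !mxE mulrDl. Qed.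

Lemma dotZl (c : R) u v : dot (c *: u) v = c * dot u v.
Proof. by rewrite mulr_sumr; apply: eq_bigr => i _; rewrite !mxE mulrA. Qed.

Lemma dotNl u v : dot (- u) v = - dot u v.
Proof. by rewrite -scaleN1r dotZl mulN1r. Qed.

Lemma dotDr u v w : dot w (u + v) = dot w u + dot w v.
Proof. by rewrite dotC dotDl !(dotC w). Qed.

Lemma dotZr (c : R) u v : dot v (c *: u) = c * dot v u.
Proof. by rewrite dotC dotZl (dotC v). Qed.

Lemma dotNr u v : dot v (- u) = - dot v u.
Proof. by rewrite dotC dotNl (dotC v). Qed.

Lemma dot_ge0 u : 0 <= dot u u.
Proof. by apply: sumr_ge0 => i _; rewrite -expr2 sqr_ge0. Qed.

Lemma euclE u : eucl u = Num.sqrt (dot u u).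
Proof. by congr Num.sqrt; apply: eq_bigr => i _; rewrite expr2. Qed.

Lemma eucl_ge0 u : 0 <= eucl u.
Proof. exact: sqrtr_ge0. Qed.

Lemma eucl_sqr u : eucl u ^+ 2 = dot u u.
Proof. by rewrite euclE sqr_sqrtr ?dot_ge0. Qed.

Lemma dot_eq0 u : (dot u u == 0) = (u == 0).
Proof.
apply/eqP/eqP => [u0|->]; last by rewrite /dot big1 // => i _; rewrite mxE mul0r.
apply/colP => i; rewrite mxE; apply/eqP; rewrite -sqrf_eq0 expr2.
move/eqP: u0; rewrite /dot psumr_eq0; last by move=> j _; rewrite -expr2 sqr_ge0.
by move/allP => /(_ i); rewrite mem_index_enum => /(_ isT).
Qed.

Lemma dot_gt0 u : u != 0 -> 0 < dot u u.
Proof. by move=> u0; rewrite lt_neqAle eq_sym dot_eq0 u0 dot_ge0. Qed.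

Lemma eucl_eq0 u : (eucl u == 0) = (u == 0).
Proof. by rewrite -dot_eq0 -eucl_sqr sqrf_eq0. Qed.

Lemma eucl_gt0 u : u != 0 -> 0 < eucl u.
Proof. by move=> u0; rewrite lt_neqAle eq_sym eucl_eq0 u0 eucl_ge0. Qed.

Lemma eucl0 : eucl (0 : 'cV[R]_p) = 0.
Proof. by apply/eqP; rewrite eucl_eq0. Qed.

Lemma euclZ (c : R) u : eucl (c *: u) = `|c| * eucl u.
Proof. by rewrite !euclE dotZl dotZr mulrA -expr2 sqrtrM ?sqr_ge0 // sqrtr_sqr. Qed.

Lemma euclN u : eucl (- u) = eucl u.
Proof. by rewrite -scaleN1r euclZ normrN1 mul1r. Qed.

Lemma eucl_unit_scale u : u != 0 -> eucl ((eucl u)^-1 *: u) = 1.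
Proof.
by move=> u0; rewrite euclZ ger0_norm ?invr_ge0 ?eucl_ge0 // mulVf // eucl_eq0.
Qed.

Lemma cauchy_schwarz u v : dot u v <= eucl u * eucl v.
Proof.
have [->|v0] := eqVneq v 0; first by rewrite -(scale0r 0) dotZr mul0r mulr_ge0 ?eucl_ge0.
have e0 := eucl_gt0 v0.
have := dot_ge0 (eucl v *: u - eucl u *: v).
rewrite dotDl !dotDr !dotNl !dotNr !dotZl !dotZr -!eucl_sqr (dotC v u) => h.
have [u0|/eucl_gt0 eu0] := eqVneq u 0.
  by rewrite u0 -(scale0r 0) dotZl mul0r mulr_ge0 ?eucl_ge0.
by rewrite -subr_ge0 -(pmulr_rge0 _ (mulr_gt0 eu0 e0)); nra.
Qed.

Lemma euclD u v : eucl (u + v) <= eucl u + eucl v.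
Proof.
rewrite -(@ler_pXn2r _ 2%N) ?nnegrE ?addr_ge0 ?eucl_ge0 //.
rewrite eucl_sqr dotDl !dotDr (dotC v u) -!eucl_sqr.
have := cauchy_schwarz u v; nra.
Qed.

Lemma coord_le_eucl u i : `|u i 0| <= eucl u.
Proof.
rewrite -(@ler_pXn2r _ 2%N) ?nnegrE ?eucl_ge0 // eucl_sqr real_normK ?num_real //.
rewrite /dot (bigD1 i) //= -expr2 lerDl sumr_ge0 // => j _.
by rewrite -expr2 sqr_ge0.
Qed.

Lemma eucl_le_coord u : eucl u <= \sum_i `|u i 0|.
Proof.
have s0 : 0 <= \sum_i `|u i 0| by apply: sumr_ge0.
rewrite -(@ler_pXn2r _ 2%N) ?nnegrE ?eucl_ge0 // eucl_sqr expr2 mulr_suml.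
apply: ler_sum => i _; rewrite -expr2 -real_normK ?num_real // expr2.
apply: ler_wpM2l => //; rewrite (bigD1 i) //= lerDl; exact: sumr_ge0.
Qed.

Lemma opnorm_set_bounded (B : 'M[R]_p) :
  has_ubound [set eucl (B *m v) | v in [set v : 'cV[R]_p | eucl v <= 1]].
Proof.
exists (\sum_i \sum_j `|B i j|) => _ [v /= v1 <-].
apply: le_trans (eucl_le_coord _) _; apply: ler_sum => i _.
rewrite mxE; apply: le_trans (ler_norm_sum _ _ _) _; apply: ler_sum => j _.
by rewrite normrM ler_piMr //; apply: le_trans (coord_le_eucl _ _) v1.
Qed.

Lemma opnormP (B : 'M[R]_p) v : eucl (B *m v) <= opnorm B * eucl v.
Proof.
have [->|v0] := eqVneq v 0; first by rewrite mulmx0 eucl0 mulr0.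
have e0 := eucl_gt0 v0.
rewrite -ler_pdivrMr //; apply: ub_le_sup; first exact: opnorm_set_bounded.
exists ((eucl v)^-1 *: v); first by rewrite /= eucl_unit_scale.
by rewrite -scalemxAr euclZ ger0_norm ?invr_ge0 ?eucl_ge0 // mulrC.
Qed.

Lemma norm0P (B : 'M[R]_p) v : eucl (B *m v) <= norm0 B * eucl v.
Proof.
apply: le_trans (opnormP _ _) _; apply: ler_wpM2r; rewrite ?eucl_ge0 //.
by rewrite le_max lexx.
Qed.

Lemma norm0VP (B : 'M[R]_p) v : eucl (invmx B *m v) <= norm0 B * eucl v.
Proof.
apply: le_trans (opnormP _ _) _; apply: ler_wpM2r; rewrite ?eucl_ge0 //.
by rewrite le_max lexx orbT.
Qed.

(** Going through [B] and back bounds a nonzero vector by [norm0 B ^+ 2] times itself. In dimension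
    0 both norms vanish, hence the nonzero vector. *)
Lemma norm0_ge1 (B : 'M[R]_p) : (exists v : 'cV[R]_p, v != 0) -> B \in unitmx ->
  1 <= norm0 B.
Proof.
move=> [v v0] uB; have e0 := eucl_gt0 v0.
have h1 := norm0P B v; have h2 := norm0VP B (B *m v).
rewrite mulKmx // in h2.
have n0 : 0 <= norm0 B by rewrite -(pmulr_lge0 _ e0) (le_trans _ h1) ?eucl_ge0.
have h3 : eucl v <= norm0 B * (norm0 B * eucl v) by apply: le_trans h2 (ler_wpM2l n0 h1).
rewrite leNgt; apply/negP => l1.
have : norm0 B * (norm0 B * eucl v) < eucl v by rewrite mulrA gtr_pMl // mulr_ilt1.
by rewrite ltNge h3.
Qed.

(* The distance from 0 to the line [v + R th], attained at the foot of the
   perpendicular. *)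
Definition ldist v th : R := eucl (v - (dot v th / dot th th) *: th).

Lemma ldist_ge0 v th : 0 <= ldist v th. Proof. exact: eucl_ge0. Qed.

Lemma ldist_attained v th : exists t : R, ldist v th = eucl (v + t *: th).
Proof. by exists (- (dot v th / dot th th)); rewrite scaleNr. Qed.

Lemma ldist_le v th (t : R) : ldist v th <= eucl (v + t *: th).
Proof.
have [->|th0] := eqVneq th 0; first by rewrite /ldist !scaler0 subr0 addr0.
have d0 := dot_gt0 th0.
rewrite -(@ler_pXn2r _ 2%N) ?nnegrE ?eucl_ge0 // !eucl_sqr.
rewrite !dotDl !dotDr !dotNl !dotNr !dotZl !dotZr (dotC th v).
set a := dot v v; set b := dot v th; set c := dot th th.
rewrite -subr_ge0.
have -> : a + t * b + (t * b + t * (t * c)) -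
  (a - b / c * b + (- (b / c * b) - - (b / c * (b / c * c)))) = (t * c + b) ^+ 2 / c.
  by field; rewrite gt_eqF.
by rewrite divr_ge0 ?sqr_ge0 // ltW.
Qed.

Lemma ldist_addl v th (t : R) : ldist (v + t *: th) th = ldist v th.
Proof.
apply/eqP; rewrite eq_le; apply/andP; split.
  have [s ->] := ldist_attained v th.
  by have := ldist_le (v + t *: th) th (s - t); rewrite -addrA -scalerDl addrCA subrr addr0.
have [s ->] := ldist_attained (v + t *: th) th.
by rewrite -addrA -scalerDl ldist_le.
Qed.

Lemma ldist_scaler v th (c : R) : c != 0 -> ldist v (c *: th) = ldist v th.
Proof.
move=> c0; apply/eqP; rewrite eq_le; apply/andP; split.
  have [s ->] := ldist_attained v th.
  by have := ldist_le v (c *: th) (s / c); rewrite scalerA mulfVK.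
have [s ->] := ldist_attained v (c *: th).
by rewrite scalerA ldist_le.
Qed.

Lemma ldist_scalel v th (c : R) : ldist (c *: v) th = `|c| * ldist v th.
Proof.
by rewrite /ldist dotZl -euclZ scalerBr scalerA !mulrA.
Qed.

Lemma ldist_gt0P v th : (0 < ldist v th) <-> ~ line v th 0.
Proof.
split=> [h [t _ /= e]|h].
  by have := ldist_le v th t; rewrite e eucl0 leNgt h.
rewrite lt_neqAle ldist_ge0 andbT eq_sym; apply/negP => /eqP h0.
have [t e] := ldist_attained v th; apply: h; exists t => //.
by apply/eqP; rewrite -eucl_eq0 -e h0.
Qed.

(** The point of the image line nearest to 0 pulls back to a point of the original line. *)
Lemma ldist_expand (B : 'M[R]_p) (a : R) v th :
  (forall w, eucl w <= a * eucl (B *m w)) ->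
  ldist v th <= a * ldist (B *m v) (B *m th).
Proof.
move=> h; have [t ->] := ldist_attained (B *m v) (B *m th).
by rewrite scalemxAr -mulmxDr; apply: le_trans (ldist_le v th t) (h _).
Qed.

Lemma ldist_orth v th : dot v th = 0 -> ldist v th = eucl v.
Proof. by move=> h; rewrite /ldist h mul0r scale0r subr0. Qed.

Lemma dot_foot v th : th != 0 -> dot (v - (dot v th / dot th th) *: th) th = 0.
Proof.
move=> th0; rewrite dotDl dotNl dotZl mulfVK ?subrr //.
by rewrite gt_eqF // dot_gt0.
Qed.

Lemma intvecP_eucl_ge1 v : intvec v -> v != 0 -> 1 <= eucl v.
Proof.
move=> iv v0.
have [i vi] : exists i, v i 0 != 0.
  apply/existsP; apply: contraNT v0; rewrite negb_exists => /forallP h.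
  by apply/eqP/colP => i; rewrite mxE; apply/eqP; have := h i; rewrite negbK.
by apply: le_trans (coord_le_eucl v i); rewrite norm_intr_ge1.
Qed.

Lemma intvecB u v : intvec u -> intvec v -> intvec (u - v).
Proof. by move=> hu hv i; rewrite !mxE rpredB. Qed.

Lemma intvec_mulmx (B : 'M[R]_p) v : (forall i j, B i j \is a Num.int) ->
  intvec v -> intvec (B *m v).
Proof. by move=> hB hv i; rewrite mxE rpred_sum // => j _; rewrite rpredM. Qed.

(* The expansion of [th] forbids the new line to pass near the origin unless
   the old one did: otherwise the old line would meet both a small ball around 0
   and one around the nonzero integer point [invmx B *m e]. *)
Lemma ldist_jump (B : 'M[R]_p) (a delta : R) v th u (e : 'cV[R]_p) :
  (forall w, eucl w <= a * eucl (B *m w)) -> 1 <= a ->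
  (forall t : R, eucl (t *: th) <= eucl (B *m (t *: th))) -> GLZ B ->
  delta <= 8^-1 -> line v th u -> eucl u < delta -> intvec e ->
  eucl (B *m u - e) < delta ->
  ldist v th <= a * ldist (B *m v - e) (B *m th).
Proof.
move=> hB a1 hth [_ uB iB] d8 [s _ us] ud ie bd.
have [->|e0] := eqVneq e 0; first by rewrite subr0; exact: ldist_expand.
have lu : ldist v th <= eucl u by rewrite -us; exact: ldist_le.
have [t ->] := ldist_attained (B *m v - e) (B *m th).
set d := eucl _; rewrite leNgt; apply/negP => ad.
pose c := invmx B *m e; pose y := v + t *: th.
have Bc : B *m c = e by rewrite /c mulKVmx.
have yc : B *m (y - c) = B *m v - e + t *: (B *m th).
  by rewrite mulmxBr Bc /y mulmxDr -scalemxAr addrAC.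
have c1 : 1 <= eucl c.
  apply: intvecP_eucl_ge1; first exact: intvec_mulmx.
  by apply: contraNneq e0 => c0; rewrite -Bc c0 mulmx0.
have h1 : eucl (y - c) <= a * d by have := hB (y - c); rewrite yc.
have h2 : eucl (B *m (y - u)) <= d + delta.
  have -> : B *m (y - u) = (B *m v - e + t *: (B *m th)) - (B *m u - e).
    by rewrite -yc !mulmxBr Bc opprB addrA subrK.
  by apply: le_trans (euclD _ _) _; rewrite euclN; apply: lerD => //; exact: ltW.
have h3 : eucl (y - u) <= eucl (B *m (y - u)).
  have -> : y - u = (t - s) *: th.
    by rewrite -us /y scalerBl opprD addrACA subrr add0r.
  exact: hth.
(* The path from 0 to [c] runs through [u] and [y]. Since d <= a d < delta, its three pieces are
   below delta, 2 delta and delta, so that 1 < 4 delta <= 1/2, a contradiction. *)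
have h4 : 1 <= eucl (y - c) + eucl (y - u) + eucl u.
  have := euclD (y - u) u; have := euclD y (- (y - c)).
  rewrite euclN subrK subKr; lra.
have d0 : 0 <= d := eucl_ge0 _.
nra.
Qed.

End Euclidean.

Lemma fst_continuous (X Y : topologicalType) : continuous (@fst X Y).
Proof. by move=> x; exact: cvg_fst. Qed.

Lemma snd_continuous (X Y : topologicalType) : continuous (@snd X Y).
Proof. by move=> x; exact: cvg_snd. Qed.

(** * Continuity of the distance and compactness of the space of normalised lines *)

Section EuclideanTopology.
Context {R : realType} {p : nat}.
Implicit Types u v w th : 'cV[R]_p.

Lemma continuous_dot_mulmx (B : 'M[R]_p) (X : topologicalType)
  (f g : X -> 'cV[R]_p) : continuous f -> continuous g ->
  continuous (fun x => dot (B *m f x) (B *m g x)).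
Proof.
have coord (h : X -> 'cV[R]_p) i : continuous h -> continuous (fun x => (B *m h x) i 0).
  move=> hc x; under eq_fun do rewrite mxE.
  apply: cvg_big => [|j _]; first exact: add_continuous.
  apply: cvgM; first exact: cvg_cst.
  exact: (continuous_comp (hc x) (@coord_continuous _ _ _ j 0 _)).
move=> fc gc x; rewrite /dot; apply: cvg_big => [|j _]; first exact: add_continuous.
by apply: cvgM; apply: coord.
Qed.

Lemma ldist_sqrtE v th : th != 0 ->
  ldist v th = Num.sqrt (dot v v - dot v th * dot v th / dot th th).
Proof.
move=> /dot_gt0 d0; rewrite /ldist euclE; congr Num.sqrt.
rewrite !dotDl !dotDr !dotNl !dotNr !dotZl !dotZr (dotC th v).
by field; rewrite gt_eqF.
Qed.

Lemma continuous_eucl_mulmx (B : 'M[R]_p) : continuous (fun v => eucl (B *m v)).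
Proof.
have h : continuous (fun v => dot (B *m v) (B *m v)).
  by apply: (continuous_dot_mulmx (f := id) (g := id)) => x; exact: cvg_id.
rewrite (_ : (fun v => _) = Num.sqrt \o (fun v => dot (B *m v) (B *m v))); last first.
  by apply/funext => v; rewrite euclE.
by move=> v; apply: (continuous_comp (h v)); exact: sqrt_continuous.
Qed.

Lemma continuous_eucl : continuous (@eucl R p).
Proof.
move=> v; have := @continuous_eucl_mulmx 1%:M v.
by under eq_fun do rewrite mul1mx.
Qed.

Lemma continuous_dot : continuous (fun x : 'cV[R]_p * 'cV[R]_p => dot x.1 x.2).
Proof.
move=> x; have := @continuous_dot_mulmx 1%:M _ fst snd
  (@fst_continuous _ _) (@snd_continuous _ _) x.
by under eq_fun do rewrite !mul1mx.
Qed.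

Lemma near_ldist_gt (B : 'M[R]_p) (q : R) (x : 'cV[R]_p * 'cV[R]_p) :
  B *m x.2 != 0 -> q < ldist (B *m x.1) (B *m x.2) ->
  \forall y \near x, q < ldist (B *m y.1) (B *m y.2).
Proof.
move=> x0 qx.
have c11 := @continuous_dot_mulmx B _ fst fst (@fst_continuous _ _) (@fst_continuous _ _) x.
have c12 := @continuous_dot_mulmx B _ fst snd (@fst_continuous _ _) (@snd_continuous _ _) x.
have c22 := @continuous_dot_mulmx B _ snd snd (@snd_continuous _ _) (@snd_continuous _ _) x.
pose g (y : 'cV[R]_p * 'cV[R]_p) := Num.sqrt (dot (B *m y.1) (B *m y.1) -
   dot (B *m y.1) (B *m y.2) * dot (B *m y.1) (B *m y.2) / dot (B *m y.2) (B *m y.2)).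
have gc : {for x, continuous g}.
  apply: (@continuous_comp _ _ _ (fun y : 'cV[R]_p * 'cV[R]_p =>
    dot (B *m y.1) (B *m y.1) - dot (B *m y.1) (B *m y.2) * dot (B *m y.1) (B *m y.2)
      / dot (B *m y.2) (B *m y.2))); last exact: sqrt_continuous.
  apply: cvgB; first exact: c11.
  apply: cvgM; first exact: (cvgM c12 c12).
  by apply: cvgV; [rewrite dot_eq0|exact: c22].
have d0 := dot_gt0 x0.
have n1 : \forall y \near x, 0 < dot (B *m y.2) (B *m y.2) by exact: (cvgr_gt _ c22).
have n2 : \forall y \near x, q < g y.
  by apply: (cvgr_gt _ gc); rewrite /g -ldist_sqrtE.
near=> y; rewrite ldist_sqrtE; last by rewrite -dot_eq0 gt_eqF //; near: y.
by near: y.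
Unshelve. all: by end_near. Qed.

Lemma compact_sphere : compact [set v : 'cV[R]_p | eucl v = 1].
Proof.
have tc : continuous (fun M : 'rV[R]_p => M^T : 'cV[R]_p).
  move=> M s /= /nbhs_ballP[e e0 es]; apply/nbhs_ballP; exists e => //= N [_ MN].
  by apply: es; split => // i j; rewrite !mxE; exact: MN.
pose I1 : set R := `[-1, 1]%classic.
have boxc : compact [set v : 'cV[R]_p | forall i, I1 (v i 0)].
  have -> : [set v : 'cV[R]_p | forall i, I1 (v i 0)] =
    (fun M : 'rV[R]_p => M^T) @` [set v : 'rV[R]_p | forall i, I1 (v ord0 i)].
    apply/seteqP; split => [v hv|_ [u hu <-] i].
      by exists v^T; [move=> i; rewrite mxE; exact: hv|rewrite trmxK].
    by rewrite mxE; exact: hu.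
  apply: continuous_compact; first exact: continuous_subspaceT.
  by have := @rV_compact R p (fun=> I1); apply=> _; exact: segment_compact.
apply: (subclosed_compact _ boxc).
  apply: (@preimage_closed _ _ (@eucl R p) [set x | x = 1]); last exact: closed_eq.
  by move=> v _; exact: continuous_eucl.
move=> v /= v1 i; rewrite /I1 /= in_itv /= -ler_norml -v1; exact: coord_le_eucl.
Qed.

(** A line off the origin, rescaled to distance 1, is given by its foot point, a unit vector, and a
    unit direction orthogonal to it. Uniformity over all lines comes from the compactness of this
    set of pairs. *)
Lemma compact_normal_frames (S : set 'cV[R]_p) : compact S ->
  compact [set x : 'cV[R]_p * 'cV[R]_p | [/\ eucl x.1 = 1, S x.2 & dot x.1 x.2 = 0]].
Proof.
move=> cS.
have -> : [set x : 'cV[R]_p * 'cV[R]_p | [/\ eucl x.1 = 1, S x.2 & dot x.1 x.2 = 0]] =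
  ([set v | eucl v = 1] `*` S) `&` [set x | dot x.1 x.2 = 0].
  by apply/seteqP; split => x /= [] // [].
apply: compact_closedI.
  by apply: compact_setX => //; exact: compact_sphere.
apply: (@preimage_closed _ _ (fun x : 'cV[R]_p * 'cV[R]_p => dot x.1 x.2) [set x | x = 0]).
  by move=> v _; exact: continuous_dot.
exact: closed_eq.
Qed.

End EuclideanTopology.

(** * Outer measure and recurrence *)

Section OuterMeasure.
Context {R : realType} {d : measure_display} {X : measurableType d}.
Variable mu : probability X R.
Local Open Scope ereal_scope.
Implicit Types (S : set X).

Lemma outer_measurable S : measurable S -> mu_ext mu S = mu S.
Proof. exact: measurable_mu_extE. Qed.

Lemma outer_le S S' : S `<=` S' -> mu_ext mu S <= mu_ext mu S'.
Proof. exact: le_mu_ext. Qed.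

Lemma outer_ge0 S : 0 <= mu_ext mu S.
Proof. exact: mu_ext_ge0. Qed.

Lemma outer_set0 : mu_ext mu set0 = 0.
Proof. exact: mu_ext0. Qed.

Lemma outer_cover S (r : \bar R) : mu_ext mu S < r ->
  exists B, [/\ measurable B, S `<=` B & mu B < r].
Proof.
move=> /ereal_inf_lt[_ [B [mB SB] <-] Br]; exists (\bigcup_k B k); split => //.
  by apply: bigcup_measurable => k _; exact: mB.
by apply: le_lt_trans Br; apply: measure_sigma_subadditive => //; exact: bigcup_measurable.
Qed.

Lemma outer_bigcup (I : countType) (W : set I) (B : I -> set X) :
  mu_ext mu (\bigcup_(i in W) B i) <= \esum_(i in W) mu_ext mu (B i).
Proof.
pose B' n := if (unpickle n : option I) is Some i then
  (if (i \in W) && (pickle i == n) then B i else set0) else set0.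
pose b n := mu_ext mu (B' n).
have b0 n : 0 <= b n by exact: outer_ge0.
apply: (@le_trans _ _ (mu_ext mu (\bigcup_n B' n))).
  apply: outer_le => x [i Wi Bix]; exists (pickle i) => //.
  by rewrite /B' pickleK eqxx mem_set.
apply: (le_trans (@mu_ext_sigma_subadditive _ _ _ mu (@measure_ge0 _ _ _ mu) B')).
rewrite nneseries_esumT //.
apply: (@le_trans _ _ (\esum_(n in pickle @` W) b n)).
  rewrite [leRHS]esum_mkcond; apply: le_esum => n _.
  case: ifPn => // /negP nW; rewrite /b /B'; case: unpickle => [i|]; last first.
    by rewrite outer_set0.
  case: ifPn => [/andP[iW /eqP ni]|_]; last by rewrite outer_set0.
  by exfalso; apply: nW; rewrite inE; exists i => //; rewrite inE in iW.
rewrite esum_image; last by move=> i j _ _; exact: (pcan_inj pickleK).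
apply: le_esum => i Wi; rewrite /b /B' pickleK eqxx mem_set //.
Qed.

Lemma outer_bigcup_seq (I : countType) (r : seq I) (B : I -> set X) : uniq r ->
  mu_ext mu (\bigcup_(i in [set` r]) B i) <= \sum_(i <- r) mu_ext mu (B i).
Proof.
move=> ur; apply: le_trans (outer_bigcup _ _) _.
rewrite esum_fset; last 2 first.
- exact: finite_seq.
- by move=> i _; exact: outer_ge0.
by rewrite (fsbig_seq _ _ ur).
Qed.

Lemma negligible_outer S : mu.-negligible S -> mu_ext mu S = 0.
Proof.
move=> [B [mB B0 SB]]; apply/eqP; rewrite eq_le outer_ge0 andbT.
by rewrite -B0 -(outer_measurable mB); exact: outer_le.
Qed.

(** Covers of measure below 1/(n+1) intersect in a measurable null hull. *)
Lemma outer_negligible S :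
  (forall e : R, (0 < e)%R -> mu_ext mu S <= e%:E) -> mu.-negligible S.
Proof.
move=> h.
have /choice[B hB] : forall n : nat, exists B, [/\ measurable B, S `<=` B & mu B < (n.+1%:R^-1)%:E].
  move=> n; apply: outer_cover.
  have p2 : (0 < (n.+1%:R^-1 : R) / 2)%R by rewrite divr_gt0 ?invr_gt0.
  by apply: le_lt_trans (h _ p2) _; rewrite lte_fin ltr_pdivrMr // ltr_pMr ?invr_gt0 // ltr1n.
exists (\bigcap_n B n); split.
- by apply: bigcap_measurable => // n _; case: (hB n).
- apply/eqP; rewrite eq_le measure_ge0 andbT; apply/lee_addgt0Pr => e e0.
  rewrite add0e; have [n ne] : exists n : nat, (n.+1%:R^-1 <= e)%R.
    exists (Num.trunc e^-1); rewrite invf_ple ?posrE //.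
    by rewrite ltW // truncnS_gt.
  apply: (@le_trans _ _ (mu (B n))).
    apply: le_measure; rewrite ?inE; [|by case: (hB n)|exact: bigcap_inf].
    by apply: bigcap_measurable => // k _; case: (hB k).
  by case: (hB n) => _ _ /ltW /le_trans; apply; rewrite lee_fin.
- by move=> x Sx n _; case: (hB n) => _ /(_ x Sx).
Qed.

Lemma negligible_bigcup_count (I : countType) (B : I -> set X) :
  (forall i, mu.-negligible (B i)) -> mu.-negligible (\bigcup_i B i).
Proof.
move=> h; apply: outer_negligible => e e0; apply: le_trans (outer_bigcup _ _) _.
by rewrite esum1 ?lee_fin ?ltW // => i _; exact: negligible_outer.
Qed.

Lemma lim_sup_set_measurable (F : (set X)^nat) : (forall n, measurable (F n)) ->
  measurable (lim_sup_set F).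
Proof.
by move=> mF; apply: bigcap_measurable => // k _; exact: bigcup_measurable.
Qed.

(** Reverse Fatou for indicator functions: the unions of tails decrease to the limsup, and the total
    mass is finite. *)
Lemma lim_sup_set_ge (F : (set X)^nat) (b : \bar R) : (forall n, measurable (F n)) ->
  (forall n, b <= mu (F n)) -> b <= mu (lim_sup_set F).
Proof.
move=> mF h; have c : mu (\bigcup_(k >= n) F k) @[n --> \oo] --> mu (lim_sup_set F).
  apply: lim_sup_set_cvg => //; apply: le_lt_trans (ltry 1).
  by apply: probability_le1; exact: bigcup_measurable.
rewrite -(cvg_lim _ c) //; apply: lime_ge; first by apply/cvg_ex; eexists; exact: c.
apply: nearW => n; apply: le_trans (h n) _; apply: le_measure; rewrite ?inE //.
  exact: bigcup_measurable.
by move=> x Fx; exists n => /=.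
Qed.

Variable T : X -> X.
Hypothesis mT : measurable_fun setT T.
Hypothesis iT : forall B, measurable B -> mu (T @^-1` B) = mu B.

Lemma measurable_iter_preimage n B : measurable B -> measurable (iter n T @^-1` B).
Proof.
move=> mB; elim: n => [|n IH]; first exact: mB.
have -> : iter n.+1 T @^-1` B = T @^-1` (iter n T @^-1` B).
  by apply/seteqP; split => x /=; rewrite -iterSr.
by rewrite -[T @^-1` _]setTI; exact: mT.
Qed.

Lemma measure_iter_preimage n B : measurable B -> mu (iter n T @^-1` B) = mu B.
Proof.
move=> mB; elim: n => [//|n IH].
have -> : iter n.+1 T @^-1` B = T @^-1` (iter n T @^-1` B).
  by apply/seteqP; split => x /=; rewrite -iterSr.
by rewrite iT //; exact: measurable_iter_preimage.
Qed.

Lemma negligible_iter_preimage n S : mu.-negligible S -> mu.-negligible (iter n T @^-1` S).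
Proof.
move=> [B [mB B0 SB]]; exists (iter n T @^-1` B); split.
- exact: measurable_iter_preimage.
- by rewrite measure_iter_preimage.
- by move=> x /SB.
Qed.

Hypothesis eT : forall B, measurable B -> T @^-1` B = B -> mu B = 0 \/ mu B = 1.

(** The set of points visiting [Z] infinitely often equals its preimage and, by reverse Fatou, has
    measure at least that of [Z]; ergodicity makes it full. *)
Lemma ergodic_recurrence Z : measurable Z -> 0 < mu Z ->
  mu.-negligible [set x | ~ forall m, exists2 n, (m <= n)%N & Z (iter n T x)].
Proof.
move=> mZ Z0; pose F n := iter n T @^-1` Z; pose H := lim_sup_set F.
have mF n : measurable (F n) by exact: measurable_iter_preimage.
have mH : measurable H by exact: lim_sup_set_measurable.
have TH : T @^-1` H = H.
  apply/seteqP; split => x /= hx m _.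
    by have [n /= mn Fx] := hx m I; exists n.+1 => /=; [exact: leqW|rewrite /F /= -iterS iterSr].
  (* A visit at time at least m + 1 is requested, so that one step of [T] can be removed from it. *)
  have [[|n] //= mn Fx] := hx m.+1 I; exists n => //=.
  by move: Fx; rewrite /F /= -iterS iterSr.
have H0 : mu Z <= mu H.
  by apply: lim_sup_set_ge => // n; rewrite measure_iter_preimage.
have H1 : mu H = 1.
  by case: (eT mH TH) => // h; move: H0; rewrite h leNgt Z0.
exists (~` H); split; first exact: measurableC.
- by have := probability_setC mu mH; rewrite H1 subee.
- move=> x /= nx hx; apply: nx => m.
  by have [n /= mn Fx] := hx m I; exists n.
Qed.
End OuterMeasure.

(** * Words and cylinders *)

Section Words.
Context {X : Type}.
Variables (T : X -> X) (iota : X -> int).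

Fixpoint wd (n : nat) (x : X) : seq int :=
  if n is n'.+1 then iota x :: wd n' (T x) else [::].

Lemma size_wd n x : size (wd n x) = n.
Proof. by elim: n x => //= n IH x; rewrite IH. Qed.

Lemma wd_cat n m x : wd (n + m) x = wd n x ++ wd m (iter n T x).
Proof. by elim: n x => //= n IH x; rewrite IH -iterSr. Qed.

Lemma take_wd k n x : (k <= n)%N -> take k (wd n x) = wd k x.
Proof. by move=> /subnKC <-; rewrite wd_cat take_size_cat // size_wd. Qed.

Lemma nth_wd n x k : (k < n)%N -> nth 0 (wd n x) k = iota (iter k T x).
Proof. by elim: n x k => // n IH x [|k] //= kn; rewrite IH // -iterSr. Qed.

End Words.

Definition words n : set (seq int) := [set s | size s = n].

Section ESum.
Context {R : realType} {I : choiceType}.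
Local Open Scope ereal_scope.

Lemma esumZ_le (W : set I) (a : I -> \bar R) (c : R) : (0 <= c)%R ->
  (forall i, W i -> 0 <= a i) ->
  \esum_(i in W) (c%:E * a i) <= c%:E * \esum_(i in W) a i.
Proof.
move=> c0 a0; apply: ge_ereal_sup => _ [F [fF FW] <-].
rewrite (eq_fsbigr (fun i => c%:E * (if i \in W then a i else 0))); last first.
  by move=> i; rewrite inE => /FW Wi; rewrite mem_set.
rewrite -ge0_mule_fsumr; last by move=> i; case: ifPn => //; rewrite inE => /a0.
apply: lee_wpmul2l; first by rewrite lee_fin.
rewrite (eq_fsbigr a); last by move=> i; rewrite inE => /FW Wi; rewrite mem_set.
by apply: esum_ge; exists F.
Qed.

Lemma esum_subset (W W' : set I) (a : I -> \bar R) : W `<=` W' ->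
  \esum_(i in W) a i <= \esum_(i in W') a i.
Proof.
move=> WW; apply: ge_ereal_sup => _ [F [fF FW] <-]; apply: ereal_sup_ubound.
by exists F => //; split => //; exact: subset_trans WW.
Qed.

(** A finite set of indices carries the sum up to [e], and [b] bounds [q] on it, so no index with
    [b < q i] belongs to it. This is the truncation device for log norms. *)
Lemma esum_tail (W : set I) (a : I -> R) (q : I -> R) (e : R) :
  (forall i, W i -> 0 <= a i)%R -> \esum_(i in W) (a i)%:E < +oo -> (0 < e)%R ->
  exists b : R, (0 <= b)%R /\ \esum_(i in W `&` [set i | (b < q i)%R]) (a i)%:E <= e%:E.
Proof.
move=> a0 fin e0.
have s0 : 0 <= \esum_(i in W) (a i)%:E by apply: esum_ge0 => i /a0; rewrite lee_fin.
have sfin : \esum_(i in W) (a i)%:E \is a fin_num by rewrite ge0_fin_numE.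
have [_ [F [fF FW] <-] hF] := ub_ereal_sup_adherent e0 sfin.
pose b := (\sum_(i \in F) `|q i|)%R.
have qb i : F i -> (q i <= b)%R.
  move=> Fi; apply: le_trans (ler_norm _) _; rewrite /b (fsbigD1 i) //=.
  by rewrite lerDl; apply: fsumr_ge0.
exists b; split; first by apply: fsumr_ge0.
apply: ge_ereal_sup => _ [G [fG GW] <-].
have FG : F `&` G = set0.
  by apply/seteqP; split => // i [/qb + /GW[_ /=]]; rewrite leNgt => /negP.
have : \sum_(i \in F `|` G) (a i)%:E <= \esum_(i in W) (a i)%:E.
  by apply: esum_ge; exists (F `|` G) => //; split; [rewrite finite_setU|move=> i [/FW|/GW[]]].
rewrite fsbigU //; last by rewrite FG => i [].
rewrite !fsumEFin // in hF *.
move: sfin hF; rewrite /esum; case: (ereal_sup _) => // s _.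
rewrite /=; by rewrite -EFinB -!EFinD !lee_fin lte_fin; lra.
Qed.

End ESum.

(** * Probabilities of words and conditional sums *)

Section CodedSystem.
Context {R : realType} {d : measure_display} {X : measurableType d}.
Variables (mu : probability X R) (T : X -> X) (iota : X -> int) (Om : set X).

Definition cyl s : set X := Om `&` [set x | wd T iota (size s) x = s].

Definition wprob s : R := fine (mu (cyl s)).

(* [Om] is a forward invariant set of full measure on which [iota] reads off the
   letter of a point; [coded_dist] is the upper half of bounded distortion. *)
Record coded (K : R) : Prop := Coded {
  coded_mT : measurable_fun setT T;
  coded_inv : forall B, measurable B -> mu (T @^-1` B) = mu B;
  coded_erg : forall B, measurable B -> T @^-1` B = B -> mu B = 0%E \/ mu B = 1%E;
  coded_mOm : measurable Om;
  coded_Om1 : mu Om = 1%E;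
  coded_TOm : forall x, Om x -> Om (T x);
  coded_letter : forall l, measurable (Om `&` [set x | iota x = l]);
  coded_dist : forall s t, wprob (s ++ t) <= K * wprob s * wprob t }.

Variable K : R.
Hypothesis cd : coded K.
Local Notation P := wprob.

Lemma iter_Om n x : Om x -> Om (iter n T x).
Proof. by move=> Ox; elim: n => //= n; exact: (coded_TOm cd). Qed.

Lemma cyl_cat r s :
  cyl (r ++ s) = cyl r `&` [set x | wd T iota (size s) (iter (size r) T x) = s].
Proof.
apply/seteqP; split => x; rewrite /cyl /= size_cat wd_cat.
  move=> [Ox /eqP]; rewrite eqseq_cat ?size_wd // => /andP[/eqP e1 /eqP e2].
  by rewrite e1.
by move=> [[Ox ->] ->].
Qed.

Lemma cyl_measurable s : measurable (cyl s).
Proof.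
elim: s => [|l s IH].
  have -> : cyl [::] = Om by apply/seteqP; split => x //= [].
  exact: coded_mOm cd.
have -> : cyl (l :: s) = (Om `&` [set x | iota x = l]) `&` (T @^-1` cyl s).
  apply/seteqP; split => x; rewrite /cyl /=.
    by move=> [Ox [-> ->]]; split => //; split => //; exact: (coded_TOm cd).
  by move=> [[Ox ->] [_ ->]].
apply: measurableI; first exact: coded_letter cd _.
by rewrite -[T @^-1` _]setTI; exact: (coded_mT cd).
Qed.

(** Words are countable, so an arbitrary predicate on the itinerary defines a countable union of
    cylinders. *)
Lemma word_event_measurable n (E : set (seq int)) :
  measurable (Om `&` [set x | E (wd T iota n x)]).
Proof.
have -> : Om `&` [set x | E (wd T iota n x)] =
  \bigcup_s (if `[< E s /\ size s = n >] then cyl s else set0).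
  apply/seteqP; split => x.
    by move=> [Ox Ex]; exists (wd T iota n x) => //; rewrite asboolT ?size_wd //; split => //=; rewrite size_wd.
  by move=> [s _]; case: asboolP => // -[Es ns] [Ox /=]; rewrite ns => ws; rewrite ws.
apply: countable_bigcupT_measurable => // s; case: ifP => // _; exact: cyl_measurable.
Qed.

Lemma mu_cyl s : mu (cyl s) = (P s)%:E.
Proof. by rewrite /P fineK // fin_num_measure //; exact: cyl_measurable. Qed.

Lemma wprob_ge0 s : 0 <= P s.
Proof. by rewrite fine_ge0. Qed.

Lemma wprob_nil : P [::] = 1.
Proof.
have -> : P [::] = fine (mu Om).
  by congr (fine (mu _)); apply/seteqP; split => x //= [].
by rewrite (coded_Om1 cd).
Qed.

Lemma coded_K_ge1 : 1 <= K.
Proof. by have := coded_dist cd [::] [::]; rewrite wprob_nil !mulr1. Qed.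

Local Open Scope ereal_scope.

Lemma outer_cyl r n (S : set X) :
  mu_ext mu (cyl r `&` S) <= \esum_(s in words n) mu_ext mu (cyl (r ++ s) `&` S).
Proof.
apply: le_trans (outer_bigcup mu _ _); apply: outer_le => x [cx Sx].
exists (wd T iota n (iter (size r) T x)); first by rewrite /words /= size_wd.
by split => //; rewrite cyl_cat; split => //=; rewrite size_wd.
Qed.

Lemma esum_wprob_le r n (E : set (seq int)) (Y : set X) : measurable Y ->
  (forall s, words n s -> E s -> cyl (r ++ s) `<=` Y) ->
  \esum_(s in words n `&` E) (P (r ++ s))%:E <= mu Y.
Proof.
move=> mY h; apply: ge_ereal_sup => _ [F [fF FW] <-].
under eq_fsbigr do rewrite -mu_cyl.
rewrite -measure_fin_bigcup //; last 2 first.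
- move=> s t /FW[Ws _] /FW[Wt _] [x []]; rewrite !cyl_cat => -[_ /=] + [_ /=].
  by rewrite Ws Wt => -> .
- by move=> s _; exact: cyl_measurable.
apply: le_measure; rewrite ?inE //.
  by apply: fin_bigcup_measurable => // s _; exact: cyl_measurable.
by move=> x [s Fs cx]; have [Ws Es] := FW _ Fs; exact: (h s).
Qed.

Lemma measure_word_event_le n (E : set (seq int)) :
  mu (Om `&` [set x | E (wd T iota n x)]) <= \esum_(s in words n `&` E) (P s)%:E.
Proof.
rewrite -outer_measurable; last exact: word_event_measurable.
under eq_esum do rewrite -mu_cyl -(outer_measurable mu (cyl_measurable _)).
apply: le_trans (outer_bigcup mu _ _); apply: outer_le => x [Ox Ex].
by exists (wd T iota n x); [split => //=; rewrite /words /= size_wd|split => //=; rewrite size_wd].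
Qed.

(** The integral over the cylinder of the past [r] of a function [g] of the next [n] letters: a
    conditional expectation not divided by [P r]. *)
Definition wsum r n (g : seq int -> R) : \bar R :=
  \esum_(s in words n) (P (r ++ s) * g s)%:E.

Lemma wsum_le r n g h : (forall s, words n s -> (g s <= h s)%R) -> wsum r n g <= wsum r n h.
Proof.
by move=> gh; apply: le_esum => s Ws; rewrite lee_fin ler_wpM2l ?wprob_ge0 ?gh.
Qed.

Lemma wsum_ge0 r n g : (forall s, words n s -> (0 <= g s)%R) -> 0 <= wsum r n g.
Proof. by move=> g0; apply: esum_ge0 => s Ws; rewrite lee_fin mulr_ge0 ?wprob_ge0 ?g0. Qed.

Lemma wsumD r n g h : (forall s, words n s -> (0 <= g s)%R) ->
  (forall s, words n s -> (0 <= h s)%R) ->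
  wsum r n (fun s => g s + h s)%R = wsum r n g + wsum r n h.
Proof.
move=> g0 h0; rewrite /wsum -esumD.
- by apply: eq_esum => s _; rewrite -EFinD mulrDr.
- by move=> s Ws; rewrite lee_fin mulr_ge0 ?wprob_ge0 ?g0.
- by move=> s Ws; rewrite lee_fin mulr_ge0 ?wprob_ge0 ?h0.
Qed.

Lemma wsumZ r n c g : (0 <= c)%R -> (forall s, words n s -> (0 <= g s)%R) ->
  wsum r n (fun s => c * g s)%R <= c%:E * wsum r n g.
Proof.
move=> c0 g0; rewrite /wsum.
under eq_esum do rewrite mulrCA EFinM.
by apply: esumZ_le => // s Ws; rewrite lee_fin mulr_ge0 ?wprob_ge0 ?g0.
Qed.

Lemma wsum_cst r n c : (0 <= c)%R -> wsum r n (fun=> c) <= (P r * c)%:E.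
Proof.
move=> c0; apply: (@le_trans _ _ (wsum r n (fun=> c * 1)%R)).
  by apply: wsum_le => s _; rewrite mulr1.
apply: (le_trans (@wsumZ r n c (fun=> 1%R) c0 _)); first by [].
rewrite mulrC EFinM; apply: lee_wpmul2l; first by rewrite lee_fin.
rewrite /wsum -mu_cyl; under eq_esum do rewrite mulr1.
have := @esum_wprob_le r n setT (cyl r) (cyl_measurable r); rewrite setIT; apply.
by move=> s _ _ x; rewrite cyl_cat => -[].
Qed.

(** Bounded distortion: forgetting the past costs at most the factor [K]. *)
Lemma wsum_dist r n g : (forall s, words n s -> (0 <= g s)%R) ->
  wsum r n g <= (K * P r)%:E * wsum [::] n g.
Proof.
move=> g0.
have K0 : (0 <= K)%R by apply: le_trans coded_K_ge1.
apply: le_trans (esumZ_le _ _); last 2 first.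
- by rewrite mulr_ge0 ?wprob_ge0.
- by move=> s Ws; rewrite lee_fin mulr_ge0 ?wprob_ge0 ?g0.
apply: le_esum => s Ws; rewrite -EFinM lee_fin mulrA ler_wpM2r ?g0 //.
exact: coded_dist.
Qed.

(** The tower property, every word of length [n + m] splitting uniquely. *)
Lemma wsum_peel r n m g : (forall s, words (n + m) s -> (0 <= g s)%R) ->
  wsum r (n + m) g = \esum_(s in words n) wsum (r ++ s) m (fun u => g (s ++ u)).
Proof.
move=> g0; rewrite /wsum esum_esum; last first.
  move=> s u; rewrite /words /= => Ws Wu.
  by rewrite lee_fin mulr_ge0 ?wprob_ge0 ?g0 // /words /= size_cat Ws Wu.
rewrite (reindex_esum (words n `*`` (fun=> words m)) _ (fun k => k.1 ++ k.2)).
  by apply: eq_esum => k _; rewrite catA.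
split.
- by move=> [s u] [/= Ws Wu]; rewrite /words /= size_cat Ws Wu.
- move=> [s u] [s' u']; rewrite !inE => -[/= Ws Wu] [/= Ws' Wu'] /eqP.
  by rewrite eqseq_cat ?Ws ?Ws' // => /andP[/eqP -> /eqP ->].
- move=> s; rewrite /words /= => Ws; exists (take n s, drop n s); last exact: cat_take_drop.
  by split; rewrite /= ?size_take ?size_drop Ws; [case: ltnP => //; lia|lia].
Qed.

End CodedSystem.

(** * A uniform version, over a compact set, of almost sure events *)

Section Dini.
Context {R : realType} {d : measure_display} {X : measurableType d}.
Variables (mu : probability X R) (T : X -> X) (iota : X -> int) (Om : set X) (K : R).
Hypothesis cd : coded mu T iota Om K.
Local Notation P := (wprob mu T iota Om).
Local Notation wd := (wd T iota).
Local Open Scope ereal_scope.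

(** A Dini theorem: [G s y] is open in [y], persists when the word is extended, and happens sooner
    or later along almost every itinerary; then one length serves all [y]. Locally in [y], finitely
    many words already carry mass more than 1 - e, and each of them stays good for nearby parameters
    and for all longer words. *)
Lemma dini_words (Y : topologicalType) (C : set Y) (G : seq int -> Y -> Prop) (e : R) :
  compact C -> (0 < e)%R ->
  (forall s y, C y -> G s y -> \forall y' \near y, G s y') ->
  (forall s t y, G s y -> G (s ++ t) y) ->
  (forall y, C y -> mu.-negligible [set x | Om x /\ forall n, ~ G (wd n x) y]) ->
  exists m, forall y, C y -> \esum_(s in words m `&` [set s | ~ G s y]) (P s)%:E <= e%:E.
Proof.
move=> /compact_near_coveringP cC e0 Gopen Gmono Gnull.
pose Q m y := \esum_(s in words m `&` [set s | ~ G s y]) (P s)%:E <= e%:E.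
suff : \forall m \near \oo, C `<=` Q m by move=> [m _ h]; exists m; apply: h => /=.
apply: cC => y Cy.
have e2 : (0 < e / 2)%R by rewrite divr_gt0.
have mE n : measurable (Om `&` [set x | G (wd n x) y]) by exact: word_event_measurable cd _ [set s | G s y].
have mB n : measurable (Om `&` [set x | ~ G (wd n x) y]) by exact: word_event_measurable cd _ [set s | ~ G s y].
have [n hn] : exists n, mu (Om `&` [set x | ~ G (wd n x) y]) < (e / 2)%:E.
  (* By persistence a point that fails for infinitely many n fails for every n, so the limsup of the
     failure events is null. *)
  apply: contrapT => /forallNP hn.
  have := @lim_sup_set_ge _ _ _ mu _ (e / 2)%:E mB.
  have -> : mu (lim_sup_set (fun n => Om `&` [set x | ~ G (wd n x) y])) = 0.
    apply/negligibleP; first exact: lim_sup_set_measurable.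
    apply: negligibleS (Gnull y Cy) => x hx; split; first by have [? _ []] := hx 0%N I.
    move=> n Gx; have [m /= nm [Ox]] := hx n I; apply.
    by move: nm => /subnKC <-; rewrite wd_cat; exact: Gmono.
  move=> h; suff : (e / 2 <= 0)%R by rewrite leNgt e2.
  rewrite -lee_fin; apply: h => n.
  by rewrite leNgt; apply/negP; exact: hn.
have hsum : (1 - e / 2)%:E <= \esum_(s in words n `&` [set s | G s y]) (P s)%:E.
  have h1 : mu (Om `&` [set x | G (wd n x) y]) + mu (Om `&` [set x | ~ G (wd n x) y]) = 1.
    rewrite -(coded_Om1 cd) -measureU //.
      by congr (mu _); apply/seteqP; split => x /=; [move=> [[]|[]]|case: (pselect (G (wd n x) y)); [left|right]].
    by apply/seteqP; split => // x /= [[_ ?] [_ ?]].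
  have h2 : (1 - e / 2)%:E <= mu (Om `&` [set x | G (wd n x) y]).
    move: h1 hn; rewrite -(fineK (fin_num_measure mu _ (mE n))) -(fineK (fin_num_measure mu _ (mB n))).
    by rewrite -EFinD lte_fin lee_fin => -[]; lra.
  by apply: le_trans h2 _; exact: measure_word_event_le cd _ [set s | G s y].
(* The alphabet is infinite; openness survives only finite intersections, so the mass is first
   reduced to finitely many words. *)
have [F [fF FW] hF] : exists2 F, fsets (words n `&` [set s | G s y]) F &
    (1 - e)%:E < \sum_(s \in F) (P s)%:E.
  have : (1 - e)%:E < \esum_(s in words n `&` [set s | G s y]) (P s)%:E.
    by apply: lt_le_trans hsum; rewrite lte_fin; lra.
  by move=> /ereal_sup_gt [_ [F hF <-] h]; exists F.
have nearF : \forall y' \near y, forall s, F s -> G s y'.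
  have [q Fq] : exists q : seq (seq int), F = [set` q] by exact/finite_seqP.
  suff : \forall y' \near y, forall s, s \in q -> G s y'.
    by apply: filterS => y' h s; rewrite Fq; exact: h.
  have : forall s, s \in q -> F s by rewrite Fq.
  elim: q {Fq} => [_|s q IH h]; first by apply: nearW.
  have h1 := Gopen s y Cy (proj2 (FW s (h s (mem_head _ _)))).
  have h2 : \forall y' \near y, forall t, t \in q -> G t y'.
    by apply: IH => t tq; apply: h; rewrite inE tq orbT.
  by apply: filterS2 h1 h2 => y' a b t /=; rewrite inE => /orP[/eqP->|/b].
have : \forall m \near \oo, (n <= m)%N by exact: nbhs_infty_ge.
move=> nearm; exists ([set y' | forall s, F s -> G s y'], [set m | (n <= m)%N]) => //=.
move=> [y' m] [/= hy' nm]; rewrite /Q.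
have mU : measurable (\bigcup_(s in F) cyl T iota Om s).
  by apply: fin_bigcup_measurable => // s _; exact: cyl_measurable cd _.
pose Z := Om `\` \bigcup_(s in F) cyl T iota Om s.
have mZ : measurable Z by apply: measurableD => //; exact: coded_mOm cd.
apply: (@le_trans _ _ (mu Z)).
  apply: (esum_wprob_le cd (r := [::])) => // s Ws nG x [Ox /= wx]; split => // -[t Ft [_ /= tx]].
  apply: nG; have [Wt _] := FW _ Ft.
  move: tx; rewrite Wt -(take_wd T iota x nm) -[m]Ws wx => tx.
  by rewrite -(cat_take_drop n s) tx; apply: Gmono; exact: hy'.
have : mu Z + mu (\bigcup_(s in F) cyl T iota Om s) <= 1.
  rewrite -measureU //; first by apply: probability_le1; exact: measurableU.
  by apply/seteqP; split => // x [[_ nx] /nx].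
have -> : mu (\bigcup_(s in F) cyl T iota Om s) = \sum_(s \in F) (P s)%:E.
  rewrite measure_fin_bigcup //.
  - by apply: eq_fsbigr => s _; exact: mu_cyl cd _.
  - move=> s t /FW[Ws _] /FW[Wt _] [x [[_ /=] + [_ /=]]].
    by rewrite Ws Wt => -> .
  - by move=> s _; exact: cyl_measurable cd _.
move: hF; rewrite fsumEFin // -(fineK (fin_num_measure mu _ mZ)) -EFinD !lee_fin lte_fin.
lra.
Qed.

End Dini.

(** * Products of letters and expansion along the cone *)

Section MatrixWords.
Context {R : realType} {p : nat}.
Variables (Al : int -> 'M[R]_p) (C : set 'cV[R]_p).

(* The first letter of the word acts first. *)
Fixpoint mw (s : seq int) : 'M[R]_p := if s is l :: s' then mw s' *m Al l else 1%:M.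

Lemma mw_cat s t : mw (s ++ t) = mw t *m mw s.
Proof. by elim: s => [|l s IH] /=; rewrite ?mulmx1 // IH mulmxA. Qed.

Lemma mw_cat_mul s t (v : 'cV[R]_p) : mw (s ++ t) *m v = mw t *m (mw s *m v).
Proof. by rewrite mw_cat mulmxA. Qed.

(** Additive under concatenation, unlike the log of [norm0] of the product; its exponential bounds
    both the product and its inverse. *)
Definition lognorm (s : seq int) : R := \sum_(l <- s) ln (norm0 (Al l)).

(** The almost everywhere hypotheses turned into statements on every letter, which is legitimate
    because every letter has positive probability. *)
Record adapted_letters : Prop := AdaptedLetters {
  al_GLZ : forall l, GLZ (Al l);
  al_C : forall l w, C w -> C (Al l *m w);
  al_neq0 : forall w, C w -> w != 0;
  al_scale : forall w (c : R), C w -> c != 0 -> C (c *: w);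
  al_compact : compact (C `&` [set w | eucl w = 1]);
  al_expand : forall l w, C w -> eucl w <= eucl (Al l *m w);
  al_nonempty : exists w, C w }.

Hypothesis al : adapted_letters.

Lemma mw_GLZ s : GLZ (mw s).
Proof.
elim: s => [|l s [h1 h2 h3]] /=.
  have h i j : (1%:M : 'M[R]_p) i j \is a Num.int by rewrite mxE rpred_nat.
  by split; rewrite ?unitmx1 ?invmx1.
have [g1 g2 g3] := al_GLZ al l.
split; first by move=> i j; rewrite mxE rpred_sum // => k _; rewrite rpredM.
  by rewrite unitmx_mul h2 g2.
have uB : mw s *m Al l \in unitmx by rewrite unitmx_mul h2 g2.
have -> : invmx (mw s *m Al l) = invmx (Al l) *m invmx (mw s).
  by apply: (can_inj (mulmxK uB)); rewrite mulVmx // mulmxA mulmxKV // mulVmx.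
by move=> i j; rewrite mxE rpred_sum // => k _; rewrite rpredM.
Qed.

Lemma mw_unit s : mw s \in unitmx.
Proof. by case: (mw_GLZ s). Qed.

Lemma mw_C s w : C w -> C (mw s *m w).
Proof.
elim: s w => [|l s IH] w Cw /=; first by rewrite mul1mx.
by rewrite -mulmxA; apply: IH; exact: al_C.
Qed.

Lemma mw_expand s w : C w -> eucl w <= eucl (mw s *m w).
Proof.
elim: s w => [|l s IH] w Cw /=; first by rewrite mul1mx.
rewrite -mulmxA; apply: le_trans (al_expand al l Cw) _; apply: IH; exact: al_C.
Qed.

Lemma mw_expand_cat s t w : C w -> eucl (mw s *m w) <= eucl (mw (s ++ t) *m w).
Proof. by move=> Cw; rewrite mw_cat_mul; apply: mw_expand; exact: mw_C. Qed.

Lemma letter_norm_ge1 l : 1 <= norm0 (Al l).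
Proof.
apply: norm0_ge1; last by case: (al_GLZ al l).
by have [w /(al_neq0 al) w0] := al_nonempty al; exists w.
Qed.

Lemma expR_letter l : expR (ln (norm0 (Al l))) = norm0 (Al l).
Proof. by rewrite lnK // posrE (lt_le_trans _ (letter_norm_ge1 l)). Qed.

Lemma ln_letter_ge0 l : 0 <= ln (norm0 (Al l)).
Proof. by rewrite ln_ge0 // letter_norm_ge1. Qed.

Lemma lognorm_ge0 s : 0 <= lognorm s.
Proof. by apply: sumr_ge0 => l _; exact: ln_letter_ge0. Qed.

Lemma lognorm_cons l s : lognorm (l :: s) = ln (norm0 (Al l)) + lognorm s.
Proof. by rewrite /lognorm big_cons. Qed.

Lemma eucl_mw_le s w : eucl (mw s *m w) <= expR (lognorm s) * eucl w.
Proof.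
elim: s w => [|l s IH] w; first by rewrite /lognorm big_nil expR0 mul1r mul1mx.
rewrite lognorm_cons /= -mulmxA; apply: le_trans (IH _) _.
rewrite expRD -mulrA mulrCA; apply: ler_wpM2l; first exact: expR_ge0.
by rewrite expR_letter; exact: norm0P.
Qed.

Lemma eucl_le_mw s w : eucl w <= expR (lognorm s) * eucl (mw s *m w).
Proof.
elim: s w => [|l s IH] w; first by rewrite /lognorm big_nil expR0 mul1r mul1mx.
rewrite lognorm_cons /= -mulmxA expRD -mulrA expR_letter.
have [_ u _] := al_GLZ al l.
rewrite -{1}(mulKmx u w); apply: le_trans (norm0VP _ _) _.
by apply: ler_wpM2l (IH _); rewrite (le_trans _ (letter_norm_ge1 l)).
Qed.

Lemma ldist_mw s v th : ldist v th <= expR (lognorm s) * ldist (mw s *m v) (mw s *m th).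
Proof. by apply: ldist_expand => w; exact: eucl_le_mw. Qed.

Lemma ldist_mw_gt0 s v th : 0 < ldist v th -> 0 < ldist (mw s *m v) (mw s *m th).
Proof.
move=> h; rewrite -(pmulr_rgt0 _ (expR_gt0 (lognorm s))).
exact: lt_le_trans h (ldist_mw _ _ _).
Qed.

End MatrixWords.

Lemma esum_geometric_le (R : realType) (z : R) : 0 <= z -> z < 1 ->
  (\esum_(i in [set: nat]) (z ^+ i)%:E <= ((1 - z)^-1)%:E)%E.
Proof.
move=> z0 z1; rewrite -nneseries_esumT; last by move=> n; rewrite lee_fin exprn_ge0.
apply: lime_le; first by apply: is_cvg_nneseries => n _ _; rewrite lee_fin exprn_ge0.
apply: nearW => n; rewrite sumEFin lee_fin big_mkord.
have d0 : 0 < 1 - z by rewrite subr_gt0.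
rewrite -div1r ler_pdivlMr //.
by have := subrX1 z n; have := exprn_ge0 n z0; lra.
Qed.

Section Expansion.
Context {R : realType} {d : measure_display} {X : measurableType d} {p : nat}.
Variables (mu : probability X R) (T : X -> X) (iota : X -> int) (Om : set X) (K : R).
Hypothesis cd : coded mu T iota Om K.
Variables (Al : int -> 'M[R]_p) (C : set 'cV[R]_p).
Hypothesis al : adapted_letters Al C.
Hypothesis unbounded : forall x th (B : R), Om x -> C th ->
  exists n, B < eucl (mw Al (wd T iota n x) *m th).
Local Notation P := (wprob mu T iota Om).
Local Notation wd := (wd T iota).
Local Notation wsum := (wsum mu T iota Om).
Local Notation cyl := (cyl T iota Om).
Local Notation mw := (mw Al).

Lemma eucl_mw_gt0 s th : C th -> 0 < eucl (mw s *m th).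
Proof. by move=> Cth; apply: eucl_gt0; apply: (al_neq0 al); exact: (mw_C al). Qed.

(** The ratio never exceeds 1, and by compactness of the unit directions it is below 1/(4K) for a
    common block length, except with probability 1/(4K). Its mean is thus at most 1/(2K), and
    conditioning on the past multiplies this by [K]. *)
Lemma expansion_block : exists m, forall r th, C th ->
  (wsum r m (fun s => eucl th / eucl (mw s *m th))%R <= (P r * 2^-1)%:E)%E.
Proof.
have K1 : 1 <= K := coded_K_ge1 cd.
have K0 : 0 < K by apply: lt_le_trans K1.
pose B : R := 4 * K; have B0 : 0 < B by rewrite mulr_gt0.
(* Asking for some prefix makes [G] persistent for every vector; on the cone, norms do not decrease,
   so the bound passes from the prefix to the whole word. *)
pose G s (y : 'cV[R]_p) := exists2 k, (k <= size s)%N & B < eucl (mw (take k s) *m y).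
have Bi : 0 < (4 * K)^-1 by rewrite invr_gt0.
have [|||m hm] := @dini_words _ _ _ mu T iota Om K cd _ _ G _ (al_compact al) Bi.
- move=> s y _ [k ks By]; have := @continuous_eucl_mulmx _ _ (mw (take k s)) y.
  move=> /cvgr_gt /(_ _ By); apply: filterS => y' hy'; by exists k.
- move=> s t y [k ks By]; exists k; first by rewrite size_cat (leq_trans ks) ?leq_addr.
  by rewrite takel_cat.
- move=> y [Cy _]; rewrite (_ : mkset _ = set0); first exact: negligible_set0.
  apply/seteqP; split => // x [Ox h]; have [n hn] := unbounded B Ox Cy.
  by apply: (h n); exists n; rewrite ?size_wd // take_wd.
exists m => r th Cth.
have th0 : eucl th != 0 by rewrite gt_eqF // eucl_gt0 // (al_neq0 al).
pose y := (eucl th)^-1 *: th.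
have Cy : (C `&` [set w | eucl w = 1]) y.
  split; first by apply: (al_scale al) => //; rewrite invr_eq0.
  by rewrite /= eucl_unit_scale // (al_neq0 al).
pose g s := eucl th / eucl (mw s *m th).
pose h s : R := (`[< ~ G s y >])%:R + B^-1.
have g0 s : 0 <= g s by rewrite divr_ge0 ?eucl_ge0.
have gh s : g s <= h s.
  have t0 := eucl_mw_gt0 s Cth.
  rewrite /h; case: asboolP => [_|/contrapT[k ks Bk]] /=.
    apply: (@le_trans _ _ 1); last by rewrite lerDl invr_ge0 ltW.
    by rewrite /g ler_pdivrMr // mul1r; exact: (mw_expand al).
  rewrite add0r /g ler_pdivrMr // mulrC ler_pdivlMr //.
  have : B < eucl (mw s *m y).
    apply: lt_le_trans Bk _; rewrite -{2}(cat_take_drop k s).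
    by apply: (mw_expand_cat al); case: Cy.
  rewrite /y -scalemxAr euclZ ger0_norm ?invr_ge0 ?eucl_ge0 //.
  by rewrite mulrC ltr_pdivlMr ?eucl_gt0 ?(al_neq0 al) // mulrC => /ltW.
apply: (le_trans (@wsum_le _ _ _ mu T iota Om r m g h _)); first by move=> s _; exact: gh.
apply: (le_trans (wsum_dist cd r (n := m) (g := h) _)).
  by move=> s _; rewrite addr_ge0 ?ler0n // invr_ge0 ltW.
have hs : (wsum [::] m h <= (B^-1 + B^-1)%:E)%E.
  rewrite wsumD; last 2 first.
  - by move=> s _; rewrite ler0n.
  - by move=> s _; rewrite invr_ge0 ltW.
  rewrite EFinD; apply: leeD.
    apply: le_trans (hm y Cy); rewrite /wsum esum_mkcondr; apply: le_esum => s _ /=.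
    case: asboolP => nG; first by rewrite mem_set // mulr1.
    by rewrite mulr0; case: ifPn; rewrite ?inE // lee_fin wprob_ge0.
  apply: le_trans (wsum_cst cd _ _ _) _; first by rewrite invr_ge0 ltW.
  by rewrite (wprob_nil cd) mul1r.
apply: (le_trans (lee_wpmul2l _ hs)); first by rewrite lee_fin mulr_ge0 ?wprob_ge0 // ltW.
rewrite -EFinM lee_fin /B (_ : K * P r * _ = P r * 2^-1) //.
by field; rewrite gt_eqF.
Qed.

End Expansion.

Section Regularity.
Context {R : realType} {d : measure_display} {X : measurableType d} {p : nat}.
Variables (mu : probability X R) (T : X -> X) (iota : X -> int) (Om : set X) (K : R).
Hypothesis cd : coded mu T iota Om K.
Variables (Al : int -> 'M[R]_p) (C : set 'cV[R]_p).
Hypothesis al : adapted_letters Al C.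
Hypothesis unbounded : forall x th (B : R), Om x -> C th ->
  exists n, B < eucl (mw Al (wd T iota n x) *m th).
Local Notation P := (wprob mu T iota Om).
Local Notation wd := (wd T iota).
Local Notation wsum := (wsum mu T iota Om).
Local Notation cyl := (cyl T iota Om).
Local Notation mw := (mw Al).

Lemma iter_size_cat (s r : seq int) x :
  iter (size (r ++ s)) T x = iter (size s) T (iter (size r) T x).
Proof. by rewrite size_cat addnC iterD. Qed.

(** Markov's inequality for the inverse growth, iterated over blocks: the first block [s] replaces
    [q] by [q * eucl th / eucl (mw s *m th)], whose conditional mean is at most q/2. *)
Lemma expansion_tail m : (forall r th, C th ->
    (wsum r m (fun s => eucl th / eucl (mw s *m th))%R <= (P r * 2^-1)%:E)%E) ->
  forall n r th q, C th -> 0 <= q ->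
  (mu_ext mu (cyl r `&` [set x |
     (eucl (mw (wd (n * m) (iter (size r) T x)) *m th) <= q * eucl th)%R])
   <= (P r * (q * 2^-1 ^+ n))%:E)%E.
Proof.
move=> hm; elim=> [|n IH] r th q Cth q0.
  rewrite expr0 mulr1; have th0 : 0 < eucl th by rewrite eucl_gt0 // (al_neq0 al).
  have [q1|q1] := leP 1 q.
    apply: (@le_trans _ _ (P r)%:E); last by rewrite lee_fin ler_peMr ?wprob_ge0.
    rewrite -(mu_cyl cd) -(outer_measurable mu (cyl_measurable cd r)).
    by apply: outer_le => x [].
  rewrite (_ : _ `&` _ = set0) ?outer_set0 ?lee_fin ?mulr_ge0 ?wprob_ge0 //.
  apply/seteqP; split => // x [_ /=]; rewrite mul1mx.
  by rewrite leNgt gtr_pMl // q1.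
set S := [set x | _].
apply: le_trans (outer_cyl mu T iota Om r m S) _.
have th0 : 0 < eucl th by rewrite eucl_gt0 // (al_neq0 al).
pose c := q * 2^-1 ^+ n.
have c0 : 0 <= c by rewrite mulr_ge0 // exprn_ge0 // invr_ge0.
apply: (@le_trans _ _ (wsum r m (fun s => c * (eucl th / eucl (mw s *m th))))).
  apply: le_esum => s Ws.
  have ts0 := eucl_mw_gt0 al s Cth.
  have q0' : 0 <= q * eucl th / eucl (mw s *m th) by rewrite divr_ge0 ?mulr_ge0 ?eucl_ge0.
  apply: le_trans (outer_le _ _) (le_trans (IH (r ++ s) _ _ (mw_C al s Cth) q0') _); last first.
    by rewrite lee_fin ler_wpM2l ?wprob_ge0 // /c le_eqVlt; apply/orP; left; apply/eqP; ring.
  move=> x [cx]; rewrite /S /= => hx; split => //=.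
  move: cx hx; rewrite cyl_cat => -[_ /=]; rewrite Ws => ws.
  rewrite mulSn wd_cat ws mw_cat_mul iter_size_cat Ws mulfVK ?gt_eqF //.
apply: (le_trans (@wsumZ _ _ _ mu T iota Om r m c
  (fun s => eucl th / eucl (mw s *m th)) c0 _)); first by move=> s _; rewrite divr_ge0 ?eucl_ge0.
apply: (le_trans (lee_wpmul2l _ (hm r th Cth))); first by rewrite lee_fin.
by rewrite -EFinM lee_fin /c exprS le_eqVlt; apply/orP; left; apply/eqP; ring.
Qed.

(** Exponential expansion from every starting time n, up to a loss [b ^+ n] with [b] as close to 1
    as desired. The inequality fails at (n, i) with probability at most 2 b^(-n) z^i / A, which is
    summable over both indices with a sum tending to 0 as A grows. *)
Lemma expansion_regular : exists2 z : R, 0 < z < 1 & forall th (b : R), C th -> 1 < b ->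
  mu.-negligible [set x | Om x /\ ~ exists A : R, forall n i,
    eucl (mw (wd n x) *m th) <= A * b ^+ n * z ^+ i * eucl (mw (wd (n + i) x) *m th)].
Proof.
have [m hm] := expansion_block cd al unbounded.
have m0 : (0 < m)%N.
  case: m hm => // hm; have [th Cth] := al_nonempty al.
  have := hm [::] th Cth; rewrite leNgt => /negP[].
  apply: (@lt_le_trans _ _ (\esum_(s in [set [::]]) (P ([::] ++ s) *
      (eucl th / eucl (mw s *m th)))%:E)%E).
    rewrite esum_set1 /= mul1mx divff ?(gt_eqF (eucl_gt0 _)) ?(al_neq0 al) //.
      by rewrite mulr1 (wprob_nil cd) lte_fin; lra.
    by rewrite mulr1 lee_fin wprob_ge0.
  by apply: esum_subset => s /= ->.
(* Bernoulli gives z^(2m) >= 1/2, so the tail 2^(-j) after j = i/m full blocks is at most 2 z^(2i).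
   One factor z^i is the claimed rate, the other makes the probabilities summable, and the 2 pays
   for the incomplete block. *)
pose z : R := 1 - (4 * m%:R)^-1.
have m4 : 0 < (4 * m%:R)^-1 :> R by rewrite invr_gt0 mulr_gt0 ?ltr0n.
have m41 : (4 * m%:R)^-1 <= 4^-1 :> R.
  by rewrite lef_pV2 ?posrE ?mulr_gt0 ?ltr0n // ler_peMr // ler1n.
have z0 : 0 < z by rewrite /z; lra.
have z1 : z < 1 by rewrite /z; lra.
have zm : 2^-1 <= z ^+ (2 * m).
  have h : forall k : nat, 1 - k%:R * (4 * m%:R)^-1 <= z ^+ k.
    elim=> [|k IH]; first by rewrite expr0 mul0r subr0.
    rewrite exprS -natr1; apply: le_trans (ler_wpM2l (ltW z0) IH).
    rewrite /z; have := mulr_ge0 (ler0n R k) (mulr_ge0 (ltW m4) (ltW m4)); lra.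
  apply: le_trans (h _); rewrite natrM invfM mulrACA divff ?pnatr_eq0 -?lt0n //; lra.
exists z; first by rewrite z0 z1.
move=> th b Cth b1; have b0 : 0 < b by lra.
have bi1 : b^-1 < 1 by rewrite invf_lt1.
pose bad (A : R) (k : nat * nat) := Om `&` [set x |
  A * b ^+ k.1 * z ^+ k.2 * eucl (mw (wd (k.1 + k.2) x) *m th) <
    eucl (mw (wd k.1 x) *m th)].
have hbad A n i : 0 < A ->
    (mu_ext mu (bad A (n, i)) <= (2 * A^-1 * ((b^-1) ^+ n * z ^+ i))%:E)%E.
  move=> A0; pose q := (A * b ^+ n * z ^+ i)^-1.
  have D0 : 0 < A * b ^+ n * z ^+ i by rewrite !mulr_gt0 ?exprn_gt0.
  have q0 : 0 <= q by rewrite invr_ge0 ltW.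
  pose j := (i %/ m)%N.
  have jm : (j * m <= i)%N by rewrite leq_trunc_div.
  pose S := [set x | A * b ^+ n * z ^+ i * eucl (mw (wd (n + i) x) *m th) <
    eucl (mw (wd n x) *m th)].
  apply: (@le_trans _ _ (mu_ext mu (cyl [::] `&` S))).
    by apply: outer_le => x [Ox hx].
  apply: (le_trans (outer_cyl mu T iota Om [::] n S)).
  pose c := q * 2^-1 ^+ j.
  have c0 : 0 <= c by rewrite mulr_ge0 // exprn_ge0 // invr_ge0.
  apply: (@le_trans _ _ (wsum [::] n (fun=> c))).
    apply: le_esum => s Ws /=.
    apply: le_trans (outer_le _ _) (expansion_tail hm j s (mw_C al s Cth) q0).
    move=> x [[Ox /=]]; rewrite Ws => ws; rewrite /S /= wd_cat ws mw_cat_mul => hx.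
    split => /=; first by split => //=; rewrite Ws.
    rewrite mulrC /q ler_pdivlMr // mulrC.
    apply: le_trans (ltW hx); apply: ler_wpM2l; first exact: ltW.
    rewrite -(subnKC jm) wd_cat; apply: (mw_expand_cat al); exact: mw_C al _ _ Cth.
  apply: le_trans (wsum_cst cd _ _ c0) _.
  rewrite (wprob_nil cd) mul1r lee_fin /c /q !invfM (exprVn b n).
  have -> : 2 * A^-1 * ((b ^+ n)^-1 * z ^+ i) = A^-1 * (b ^+ n)^-1 * (2 * z ^+ i) by ring.
  rewrite -!mulrA !ler_wpM2l ?invr_ge0 ?exprn_ge0 ?(ltW A0) ?(ltW b0) //.
  have zi : 0 < z ^+ i by rewrite exprn_gt0.
  rewrite ler_pdivrMl // mulrCA -exprD addnn.
  have h1 : 2^-1 ^+ j <= z ^+ (2 * m * j).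
    by rewrite exprM; apply: lerXn2r; rewrite ?nnegrE ?invr_ge0 ?exprn_ge0 ?(ltW z0).
  have h2 : z ^+ (2 * m * j + 2 * m) <= z ^+ (i.*2).
    apply: ler_wiXn2l; rewrite ?ltW // -muln2 -mulnA -mulnDr -mulnSr mulnC.
    by rewrite leq_mul2l /= mulnC ltnW // ltn_ceil.
  have h3 : z ^+ (2 * m * j) <= 2 * z ^+ (2 * m * j + 2 * m).
    have := exprn_ge0 (2 * m * j) (ltW z0); rewrite exprD; nra.
  by apply: le_trans h1 (le_trans h3 _); rewrite ler_pM2l.
apply: outer_negligible => e e0.
pose S1 : R := (1 - b^-1)^-1; pose S2 : R := (1 - z)^-1.
have S10 : 0 < S1 by rewrite invr_gt0; lra.
have S20 : 0 < S2 by rewrite invr_gt0; lra.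
pose A := 2 * S1 * S2 / e.
have A0 : 0 < A by rewrite divr_gt0 ?mulr_gt0.
apply: (@le_trans _ _ (mu_ext mu (\bigcup_(k in [set: nat] `*`` (fun=> [set: nat])) bad A k))).
  apply: outer_le => x [Ox hx]; apply: contrapT => nx; apply: hx; exists A => n i.
  by rewrite leNgt; apply/negP => h; apply: nx; exists (n, i).
apply: le_trans (outer_bigcup mu _ _) _.
apply: (@le_trans _ _ (\esum_(k in [set: nat] `*`` (fun=> [set: nat]))
   (2 * A^-1 * ((b^-1) ^+ k.1 * z ^+ k.2))%:E)%E).
  by apply: le_esum => -[n i] _; exact: hbad.
rewrite -(esum_esum (I := [set: nat]) (J := fun=> [set: nat])
  (a := fun n i => (2 * A^-1 * ((b^-1) ^+ n * z ^+ i))%:E)); last first.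
  by move=> n i _ _; rewrite lee_fin !mulr_ge0 ?exprn_ge0 ?invr_ge0 ?ltW.
apply: (@le_trans _ _ (\esum_(n in [set: nat]) ((2 * A^-1 * S2)%:E * ((b^-1) ^+ n)%:E))%E).
  apply: le_esum => n _.
  apply: (@le_trans _ _ (\esum_(i in [set: nat]) ((2 * A^-1 * (b^-1) ^+ n)%:E * (z ^+ i)%:E))%E).
    by apply: le_esum => i _; rewrite -EFinM lee_fin mulrA.
  apply: (le_trans (esumZ_le _ _)).
  - by rewrite !mulr_ge0 ?exprn_ge0 ?invr_ge0 ?ltW.
  - by move=> i _; rewrite lee_fin exprn_ge0 // ltW.
  apply: (le_trans (lee_wpmul2l _ (esum_geometric_le (ltW z0) z1))).
    by rewrite lee_fin !mulr_ge0 ?exprn_ge0 ?invr_ge0 ?ltW.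
  by rewrite -!EFinM -/S2 lee_fin [leLHS]mulrAC.
apply: (le_trans (esumZ_le _ _)).
- by rewrite mulr_ge0 ?(ltW S20) // mulr_ge0 // invr_ge0 ltW.
- by move=> i _; rewrite lee_fin exprn_ge0 // invr_ge0 ltW.
apply: (le_trans (lee_wpmul2l _ (esum_geometric_le _ bi1))).
- by rewrite lee_fin mulr_ge0 ?(ltW S20) // mulr_ge0 // invr_ge0 ltW.
- by rewrite invr_ge0 ltW.
rewrite -EFinM lee_fin -/S1 /A invf_div.
rewrite (_ : 2 * (e / (2 * S1 * S2)) * S2 * S1 = e) //.
by field; rewrite !gt_eqF.
Qed.

End Regularity.

(** * Shadowing and uniform growth of lines *)

Section LetterGrowth.
Context {R : realType} {d : measure_display} {X : measurableType d} {p : nat}.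
Variables (mu : probability X R) (T : X -> X) (iota : X -> int) (Om : set X) (K : R).
Hypothesis cd : coded mu T iota Om K.
Variables (Al : int -> 'M[R]_p) (C : set 'cV[R]_p).
Hypothesis al : adapted_letters Al C.
Local Notation P := (wprob mu T iota Om).
Local Notation wsum := (wsum mu T iota Om).
Hypothesis fin : (wsum [::] 1 (lognorm Al) < +oo)%E.

(** Pointwise form of the tail-sum formula for the mean of L/c. *)
Lemma count_multiples_lt (L c : R) N : 0 <= L -> 0 < c ->
  \sum_(k < N) ((k%:R * c < L)%R)%:R <= L / c + 1.
Proof.
move=> L0 c0.
(* The trivial bound N is carried along: when the last term is 1, it gives that the earlier sum is
   at most N < L/c. *)
suff : \sum_(k < N) ((k%:R * c < L)%R)%:R <= Num.min N%:R (L / c + 1).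
  by rewrite le_min => /andP[].
elim: N => [|N]; first by rewrite big_ord0 le_min lexx /= addr_ge0 // divr_ge0 // ltW.
rewrite big_ord_recr /= !le_min => /andP[h1 h2]; case: ltP => h /=.
  rewrite -[N.+1%:R]natr1 !lerD2r h1 /=.
  by apply: le_trans h1 _; rewrite ler_pdivlMr // ltW.
by rewrite addr0 h2 (le_trans h1) // ler_nat.
Qed.

(** Borel-Cantelli: by invariance the events that the letter of time k has log norm above k ln b
    have summable probabilities, since the log norm is integrable. The finitely many exceptional
    letters go into the constant. *)
Lemma letter_subexponential (b : R) : 1 < b ->
  mu.-negligible [set x | Om x /\ ~ exists A : R, forall k,
    norm0 (Al (iota (iter k T x))) <= A * b ^+ k].
Proof.
move=> b1; have b0 : 0 < b by lra.
pose c := ln b; have c0 : 0 < c by rewrite ln_gt0.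
pose F k := Om `&` [set x | k%:R * c < lognorm Al (wd T iota 1 x)].
have mF k : measurable (F k).
  exact: (word_event_measurable cd 1 [set s | k%:R * c < lognorm Al s]).
pose E k := iter k T @^-1` F k.
have mE k : measurable (E k) by apply: (measurable_iter_preimage (coded_mT cd)).
have sumE : (\sum_(k <oo) mu (E k) < +oo)%E.
  pose g s := lognorm Al s / c + 1.
  have g0 s : 0 <= lognorm Al s / c by rewrite divr_ge0 ?(lognorm_ge0 al) // ltW.
  apply: (@le_lt_trans _ _ (wsum [::] 1 g)); last first.
    rewrite wsumD //; apply: lte_add_pinfty.
      apply: (@le_lt_trans _ _ (c^-1%:E * wsum [::] 1 (lognorm Al))%E).
        apply: le_trans (@wsumZ _ _ _ mu T iota Om [::] 1 c^-1 (lognorm Al) _ _).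
        - by apply: wsum_le => s _; rewrite mulrC.
        - by rewrite invr_ge0 ltW.
        - by move=> s _; exact: lognorm_ge0 al _.
      by rewrite lte_mul_pinfty // lee_fin invr_ge0 ltW.
    by apply: le_lt_trans (wsum_cst cd _ _ _) (ltry _).
  apply: lime_le; first exact: is_cvg_nneseries.
  apply: nearW => N; rewrite big_mkord.
  apply: (@le_trans _ _ (\sum_(k < N) \esum_(s in words 1)
      (P s * ((k%:R * c < lognorm Al s)%R)%:R)%:E)%E).
    apply: lee_sum => k _.
    have -> : mu (E k) = mu (F k) by exact: measure_iter_preimage (coded_mT cd) (coded_inv cd) _ _ (mF k).
    apply: le_trans (measure_word_event_le cd 1 [set s | k%:R * c < lognorm Al s]) _.
    rewrite esum_mkcondr; apply: le_esum => s _; case: ifPn => [|_].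
      by rewrite inE /= => h; rewrite h mulr1.
    by rewrite lee_fin mulr_ge0 ?wprob_ge0 ?ler0n.
  rewrite -(@esum_sum _ _ _ _ _ _ (fun s (k : 'I_N) => (P s * ((k%:R * c < lognorm Al s)%R)%:R)%:E)).
    apply: le_esum => s _; rewrite sumEFin lee_fin -mulr_sumr /=.
    apply: ler_wpM2l; first exact: wprob_ge0.
    exact: count_multiples_lt (lognorm_ge0 al _) c0.
  by move=> s k _ _; rewrite lee_fin mulr_ge0 ?wprob_ge0 ?ler0n.
have L0 : mu (lim_sup_set E) = 0%E by exact: lim_sup_set_cvg0.
exists (lim_sup_set E); split => //; first exact: lim_sup_set_measurable.
move=> x [Ox nx]; apply: contrapT => nE; apply: nx.
have [k0 hk0] : exists k0, forall k, (k0 <= k)%N -> ~ E k x.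
  apply: contrapT => h; apply: nE => k _; apply: contrapT => h2; apply: h; exists k => j kj Ej.
  by apply: h2; exists j.
pose a k := norm0 (Al (iota (iter k T x))).
have a1 k : 1 <= a k := letter_norm_ge1 al _.
exists (1 + \sum_(k < k0) a k) => k; rewrite -/(a k).
have s0 : 0 <= \sum_(k < k0) a k by apply: sumr_ge0 => i _; rewrite (le_trans _ (a1 i)).
have [kk|kk] := leqP k0 k.
  apply: (@le_trans _ _ (b ^+ k)); last by rewrite ler_peMl ?lerDl // exprn_ge0 // ltW.
  have : ~ E k x := hk0 k kk.
  move=> /not_andP[]; first by move=> []; exact: iter_Om cd _ _ Ox.
  move=> /negP; rewrite -leNgt /lognorm /= big_seq1 -/(a k) => h.
  have ak : 0 < a k by rewrite (lt_le_trans _ (a1 k)).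
  by rewrite -ler_ln ?posrE ?exprn_gt0 // lnXn // -mulr_natl.
apply: (@le_trans _ _ (1 + \sum_(k < k0) a k)); last by rewrite ler_peMr ?addr_ge0 // exprn_ege1 // ltW.
rewrite (bigD1 (Ordinal kk)) //= addrCA lerDl addr_ge0 // sumr_ge0 // => i _.
by rewrite (le_trans _ (a1 i)).
Qed.

End LetterGrowth.

Section Shadowing.
Context {R : realType} {p : nat}.
Variables (M B : nat -> 'M[R]_p) (a : nat -> R) (v th : 'cV[R]_p).
Variables (A A' D b z : R).
Hypothesis M0 : M 0%N = 1%:M.
Hypothesis MS : forall n, M n.+1 = B n *m M n.
Hypothesis aB : forall n w, eucl w <= a n * eucl (B n *m w).
Hypothesis th0 : th != 0.
Hypotheses (A0 : 0 <= A) (A'0 : 0 <= A') (D0 : 0 <= D) (b1 : 1 < b) (z0 : 0 < z) (bz : b ^+ 2 * z < 1).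
Hypothesis Mth : forall n i, eucl (M n *m th) <= A * b ^+ n * z ^+ i * eucl (M (n + i)%N *m th).
Hypothesis ab : forall n, a n <= A' * b ^+ n.
Hypothesis Md : forall n, ldist (M n *m v) (M n *m th) <= D * b ^+ n.

(* The minimisers [v + t_k th] of the norm at time k cluster at the shadowing
   point, because the expansion of [th] makes the successive corrections summable. *)
Lemma shadowing : exists2 w, line v th w & exists E : R, forall n,
  eucl (M n *m w) <= E * (b ^+ 3) ^+ n.
Proof.
have b0 : 0 < b by exact: lt_trans ltr01 b1.
have /choice[t ht] : forall k, exists t : R, eucl (M k *m (v + t *: th)) <= D * b ^+ k.
  move=> k; have [t e] := ldist_attained (M k *m v) (M k *m th).
  by exists t; rewrite mulmxDr -scalemxAr -e.
pose D' := A * (D * (1 + A' * b)).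
have D'0 : 0 <= D' by rewrite !mulr_ge0 // addr_ge0 // mulr_ge0 // ltW.
(* The minimisers of times i and i + 1, compared at time i = n + j, differ by a multiple of b^(2i);
   returning to time n by the expansion of [th] costs b^n z^j. Hence the exponent 3 in the
   conclusion and the condition b^2 z < 1. *)
have step n j : `|t (n + j).+1 - t (n + j)%N| * eucl (M n *m th) <=
    D' * (b ^+ 3) ^+ n * (b ^+ 2 * z) ^+ j.
  set i := (n + j)%N; set dt := `|_|.
  have h1 : dt * eucl (M i *m th) <= D * (1 + A' * b) * (b ^+ 2) ^+ i.
    have -> : dt * eucl (M i *m th) =
        eucl (M i *m (v + t i.+1 *: th) - M i *m (v + t i *: th)).
      rewrite -mulmxBr opprD addrACA subrr add0r -scalerBl -scalemxAr euclZ //.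
    apply: le_trans (euclD _ _) _; rewrite euclN.
    have g1 : eucl (M i *m (v + t i.+1 *: th)) <= A' * b ^+ i * (D * b ^+ i.+1).
      apply: le_trans (aB i _) _; rewrite mulmxA -MS.
      apply: le_trans (ler_wpM2r (eucl_ge0 _) (ab i)) _.
      by apply: ler_wpM2l (ht _); rewrite mulr_ge0 // exprn_ge0 // ltW.
    have g2 : D * b ^+ i <= D * (b ^+ i * b ^+ i).
      by rewrite ler_wpM2l // ler_peMr ?exprn_ege1 ?exprn_ge0 // ltW.
    have := ht i; rewrite -exprM mulnC exprM expr2 in g1 *.
    move=> h; apply: le_trans (lerD g1 (le_trans h g2)) _.
    by rewrite exprS le_eqVlt; apply/orP; left; apply/eqP; ring.
  apply: le_trans (ler_wpM2l (normr_ge0 _) (Mth n j)) _; rewrite -/i -/dt.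
  have -> : dt * (A * b ^+ n * z ^+ j * eucl (M i *m th)) =
    A * b ^+ n * z ^+ j * (dt * eucl (M i *m th)) by ring.
  apply: le_trans (ler_wpM2l _ h1) _.
    by rewrite !mulr_ge0 ?exprn_ge0 ?(ltW b0) ?(ltW z0).
  have -> : (b ^+ 2) ^+ i = (b ^+ 2) ^+ n * (b ^+ 2) ^+ j by rewrite exprD.
  have -> : (b ^+ 3) ^+ n = (b ^+ 2) ^+ n * b ^+ n by rewrite -exprMn -exprSr.
  rewrite [(b ^+ 2 * z) ^+ j]exprMn /D' le_eqVlt; apply/orP; left; apply/eqP.
  by move: ((b ^+ 2) ^+ n) ((b ^+ 2) ^+ j) (b ^+ n) (z ^+ j) => *; ring.
pose q := b ^+ 2 * z; have q0 : 0 <= q by rewrite mulr_ge0 ?exprn_ge0 ?ltW.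
pose E := D + D' / (1 - q).
have q1 : 0 < 1 - q by rewrite subr_gt0.
have bn3 n : b ^+ n <= (b ^+ 3) ^+ n.
  by rewrite -exprM ler_eXn2l //; lia.
have bound n j : eucl (M n *m (v + t (n + j)%N *: th)) <=
    D * b ^+ n + D' * (b ^+ 3) ^+ n * \sum_(i < j) q ^+ i.
  elim: j => [|j IH]; first by rewrite big_ord0 mulr0 addr0 addn0.
  have -> : v + t (n + j.+1)%N *: th =
      v + t (n + j)%N *: th + (t (n + j).+1 - t (n + j)%N) *: th.
    by rewrite addnS -addrA -scalerDl addrCA subrr addr0.
  rewrite mulmxDr; apply: le_trans (euclD _ _) _.
  rewrite big_ord_recr /= mulrDr addrA; apply: lerD => //.
  by rewrite -scalemxAr euclZ; exact: step.
have boundE n k : (n <= k)%N -> eucl (M n *m (v + t k *: th)) <= E * (b ^+ 3) ^+ n.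
  move=> /subnKC <-; apply: le_trans (bound _ _) _; rewrite /E mulrDl.
  apply: lerD; first by rewrite ler_wpM2l.
  rewrite [leLHS]mulrAC; apply: ler_wpM2r; first by rewrite exprn_ge0 // exprn_ge0 // ltW.
  apply: ler_wpM2l => //; rewrite -[(1 - q)^-1]mul1r ler_pdivlMr //.
  have := subrX1 q (k - n); have := exprn_ge0 (k - n) q0; lra.
have e0 := eucl_gt0 th0.
pose bd := (E + eucl v) / eucl th.
have tb k : `[- bd, bd]%classic (t k).
  rewrite /= in_itv /= -ler_norml ler_pdivlMr // -euclZ.
  have := boundE 0%N k isT; rewrite M0 mul1mx expr0 mulr1 => h.
  have := euclD (v + t k *: th) (- v); rewrite euclN addrAC subrr add0r; lra.
have [|s [_ cs]] := @segment_compact R (- bd) bd (t @ \oo) _.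
  by exists 0%N => // k _; exact: tb.
exists (v + s *: th); first by exists s.
exists E => n; apply/ler_addgt0Pr => e ep.
pose rad := e / (1 + eucl (M n *m th)).
have r0 : 0 < rad by rewrite divr_gt0 // ltr_wpDr ?eucl_ge0.
have [_ [[k /= nk <-] sk]] := cs [set t k | k in [set k | (n <= k)%N]] (ball s rad)
  (ltac:(by exists n => // k /= nk; exists k)) (ltac:(by apply: nbhsx_ballx)).
have -> : v + s *: th = v + t k *: th + (s - t k) *: th.
  by rewrite -addrA -scalerDl addrCA subrr addr0.
rewrite mulmxDr; apply: le_trans (euclD _ _) _; apply: lerD; first exact: boundE.
rewrite -scalemxAr euclZ; move: sk; rewrite /ball /= => /ltW sk.
apply: le_trans (ler_wpM2r (eucl_ge0 _) sk) _; rewrite /rad mulrAC ler_pdivrMr ?ltr_wpDr ?eucl_ge0 //.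
by rewrite ler_wpM2l ?(ltW ep) // lerDr.
Qed.

End Shadowing.

Section Stabilisation.
Context {R : realType} {p : nat}.

Definition linear_set (V : set 'cV[R]_p) :=
  V 0 /\ forall (c : R) u v, V u -> V v -> V (c *: u + v).

(** A subspace of maximal dimension among those inside [V] exhausts [V], otherwise a missing vector
    could be adjoined. *)
Lemma linear_set_vspace (V : set 'cV[R]_p) : linear_set V ->
  exists U : {vspace 'cV[R]_p}, forall w, w \in U <-> V w.
Proof.
move=> [V0 VL].
pose good n := `[< exists U : {vspace 'cV[R]_p}, \dim U = n /\ forall w, w \in U -> V w >].
have g0 : exists n, good n.
  exists 0%N; apply/asboolP; exists 0%VS; rewrite dimv0; split => // w.
  by rewrite memv0 => /eqP ->.
have gle n : good n -> (n <= \dim {:'cV[R]_p})%N.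
  by move=> /asboolP[U [<- _]]; exact: dimvS (subvf _).
have [n /asboolP[U [Un UV]] nmax] := ex_maxnP g0 gle.
exists U => w; split; first exact: UV.
move=> Vw; apply: contrapT => /negP wU.
have : good (\dim (U + <[w]>)%VS).
  apply/asboolP; exists (U + <[w]>)%VS; split => // y /memv_addP[u uU [y' /vlineP[c ->] ->]].
  by rewrite addrC; apply: VL => //; exact: UV.
move=> /nmax; rewrite -Un => h.
have : (U + <[w]> == U)%VS by rewrite eq_sym eqEdim addvSl.
by move=> /eqP e; move: wU; rewrite -e => /negP[]; apply: (subvP (addvSr U _)); exact: memv_line.
Qed.

(** [j0] is an index of least dimension; later spaces are contained in this one and have no smaller
    dimension. *)
Lemma decreasing_linear_sets (V : nat -> set 'cV[R]_p) :
  (forall j, linear_set (V j)) -> (forall i j, (i <= j)%N -> V j `<=` V i) ->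
  exists j0, forall i, V j0 `<=` V i.
Proof.
move=> VL Vd; have /choice[U hU] := fun j => linear_set_vspace (VL j).
pose good n := `[< exists j, \dim (U j) = n >].
have g0 : exists n, good n by exists (\dim (U 0%N)); apply/asboolP; exists 0%N.
have [n /asboolP[j0 jn] nmin] := ex_minnP g0.
exists j0 => i w; have [ij|ji] := leqP i j0; first exact: Vd.
move=> /hU wU; apply/hU.
have sub : (U i <= U j0)%VS.
  by apply/subvP => y /hU Vy; apply/hU; exact: Vd (ltnW ji) _ Vy.
have : (U i == U j0)%VS.
  by rewrite eqEdim sub jn; apply: nmin; apply/asboolP; exists i.
by move=> /eqP ->.
Qed.

End Stabilisation.

Section UniformGrowth.
Context {R : realType} {d : measure_display} {X : measurableType d} {p : nat}.
Variables (mu : probability X R) (T : X -> X) (iota : X -> int) (Om : set X) (K : R).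
Hypothesis cd : coded mu T iota Om K.
Variables (Al : int -> 'M[R]_p) (C : set 'cV[R]_p).
Hypothesis al : adapted_letters Al C.
Hypothesis unbounded : forall x th (B : R), Om x -> C th ->
  exists n, B < eucl (mw Al (wd T iota n x) *m th).
Hypothesis fin : (wsum mu T iota Om [::] 1 (lognorm Al) < +oo)%E.
Local Notation wd := (wd T iota).
Local Notation mw := (mw Al).

Definition growth_le (b : R) x (w : 'cV[R]_p) :=
  exists E : R, forall n, eucl (mw (wd n x) *m w) <= E * b ^+ n.

Definition subexponential x (w : 'cV[R]_p) := forall b, 1 < b -> growth_le b x w.

Hypothesis lines_avoid : forall v th, C th -> 0 < ldist v th ->
  mu.-negligible [set x | Om x /\ exists2 w, line v th w & subexponential x w].

Lemma growth_le_linear b x : linear_set (growth_le b x).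
Proof.
split; first by exists 0 => n; rewrite mulmx0 eucl0 mul0r.
move=> c u v [E hE] [F hF]; exists (`|c| * E + F) => n.
rewrite mulmxDr -scalemxAr mulrDl; apply: le_trans (euclD _ _) _; apply: lerD => //.
by rewrite euclZ -mulrA ler_wpM2l.
Qed.

Lemma growth_le_mono b b' x : 1 < b -> b <= b' -> growth_le b x `<=` growth_le b' x.
Proof.
move=> b1 bb w [E hE]; exists E => n; apply: le_trans (hE n) _.
have b0 : 0 < b by exact: lt_trans b1.
have E0 : 0 <= E.
  by have := hE 0%N; rewrite expr0 mulr1; apply: le_trans; exact: eucl_ge0.
by rewrite ler_wpM2l // lerXn2r // nnegrE ltW // (lt_le_trans b0).
Qed.

Lemma growth_le_shift b x n w : 1 < b ->
  growth_le b x w <-> growth_le b (iter n T x) (mw (wd n x) *m w).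
Proof.
move=> b1; have b0 : 0 < b by exact: lt_trans b1.
have e k : mw (wd k (iter n T x)) *m (mw (wd n x) *m w) = mw (wd (n + k) x) *m w.
  by rewrite wd_cat mw_cat_mul.
split=> [[E hE]|[E hE]].
  by exists (E * b ^+ n) => k; rewrite e -mulrA -exprD; exact: hE.
pose F := \sum_(i < n) eucl (mw (wd i x) *m w).
have F0 : 0 <= F by apply: sumr_ge0 => i _; exact: eucl_ge0.
have E0 : 0 <= E.
  by have := hE 0%N; rewrite expr0 mulr1; apply: le_trans; exact: eucl_ge0.
exists (E + F) => k; have bk : 1 <= b ^+ k by rewrite exprn_ege1 // ltW.
have [nk|kn] := leqP n k.
  have := hE (k - n)%N; rewrite e subnKC // => h; apply: le_trans h _.
  apply: (@le_trans _ _ (E * b ^+ k)); last by rewrite ler_wpM2r ?lerDl // (le_trans _ bk).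
  by rewrite ler_wpM2l // ler_eXn2l // leq_subr.
apply: (@le_trans _ _ (E + F)); last by rewrite ler_peMr // addr_ge0.
rewrite /F (bigD1 (Ordinal kn)) //= addrCA lerDl addr_ge0 // sumr_ge0 // => i _.
exact: eucl_ge0.
Qed.

Lemma wdS_step n x : mw (wd n.+1 x) = Al (iota (iter n T x)) *m mw (wd n x).
Proof. by rewrite -addn1 wd_cat mw_cat /= mul1mx. Qed.

(** The rate to feed into [shadowing], whose point grows like g^3 and whose corrections decay like
    g^2 z. *)
Lemma small_base (z b : R) : 0 < z < 1 -> 1 < b ->
  exists g : R, [/\ 1 < g, g ^+ 3 <= b & g ^+ 2 * z < 1].
Proof.
move=> /andP[z0 z1] b1.
(* For e <= 1 one has (1+e)^3 <= 1+7e and (1+e)^2 <= 1+3e, whence the denominators 7 and 4. *)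
pose e := Num.min 1 (Num.min ((b - 1) / 7) ((1 - z) / 4)).
have e0 : 0 < e by rewrite !lt_min; apply/and3P; split; [lra|rewrite divr_gt0; lra|rewrite divr_gt0; lra].
have [e1 e2 e3] : [/\ e <= 1, e <= (b - 1) / 7 & e <= (1 - z) / 4].
  by split; rewrite /e !ge_min lexx ?orbT.
exists (1 + e); split; first lra.
- have : (1 + e) ^+ 3 = 1 + e * (3 + 3 * e + e * e) by ring.
  have : 3 + 3 * e + e * e <= 7 by nra.
  nra.
- have -> : (1 + e) ^+ 2 * z = z + z * (e * (2 + e)) by ring.
  have : e * (2 + e) <= 3 * e by nra.
  nra.
Qed.

(* If no rate [g] worked, ergodicity would give one point whose orbit visits, for
   every j, a set where some vector grows at rate at most [beta j] without being
   subexponential; but the spaces of vectors of growth rate at most [beta j]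
   stabilise as j grows, by finite dimension. *)
Lemma uniform_growth : exists2 g : R, 1 < g & forall v th, C th -> 0 < ldist v th ->
  mu.-negligible [set x | Om x /\ forall n,
    ldist (mw (wd n x) *m v) (mw (wd n x) *m th) <= g ^+ n * ldist v th].
Proof.
have [z z01 reg] := expansion_regular cd al unbounded.
apply: contrapT => nG.
pose beta j : R := 1 + j.+1%:R^-1.
have beta1 j : 1 < beta j by rewrite ltrDl invr_gt0 ltr0n.
have beta_mono i j : (i <= j)%N -> beta j <= beta i.
  by move=> ij; rewrite lerD2l lef_pV2 ?posrE ?ltr0n // ler_nat ltnS.
(* [Z] consists of the points where a chosen line stays below rate [b], minus the null sets where
   that line meets a subexponential vector or a hypothesis of [shadowing] fails. The shadowing point
   then grows at rate at most b^3 <= [beta j] without being subexponential. *)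
have step j : exists Z, [/\ measurable Z, (0 < mu Z)%E & forall y, Z y -> Om y /\
    exists2 w, growth_le (beta j) y w & ~ subexponential y w].
  have [b [b1 b3 b2]] := small_base z01 (beta1 j).
  have b0 : 0 < b by exact: lt_trans b1.
  have [v [th [Cth l0 nneg]]] : exists v th, [/\ C th, 0 < ldist v th &
      ~ mu.-negligible [set x | Om x /\ forall n,
        ldist (mw (wd n x) *m v) (mw (wd n x) *m th) <= b ^+ n * ldist v th]].
    apply: contrapT => h; apply: nG; exists b => // v th Cth l0; apply: contrapT => h2.
    by apply: h; exists v, th.
  have [N1 [mN1 N10 hN1]] := lines_avoid Cth l0.
  have [N2 [mN2 N20 hN2]] := reg th b Cth b1.
  have [N3 [mN3 N30 hN3]] := letter_subexponential cd al fin b1.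
  pose Z0 := [set x | Om x /\ forall n,
        ldist (mw (wd n x) *m v) (mw (wd n x) *m th) <= b ^+ n * ldist v th].
  have mZ0 : measurable Z0.
    have -> : Z0 = \bigcap_n (Om `&` [set x | ldist (mw (wd n x) *m v) (mw (wd n x) *m th) <= b ^+ n * ldist v th]).
      apply/seteqP; split => [x [Ox h] n _|x h]; first by split => //=; exact: h.
      by split=> [|n]; [case: (h 0%N I)|case: (h n I)].
    apply: bigcap_measurable => // n _.
    exact: (word_event_measurable cd n [set s | ldist (mw s *m v) (mw s *m th) <= b ^+ n * ldist v th]).
  pose N := N1 `|` N2 `|` N3.
  have mN : measurable N by do 2?apply: measurableU.
  have negN : mu.-negligible N.
    by apply: negligibleU; [apply: negligibleU|]; apply/negligibleP.
  exists (Z0 `\` N); split; first exact: measurableD.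
    rewrite lt_neqAle measure_ge0 andbT eq_sym; apply/negP => /eqP Zn; apply: nneg.
    apply: (negligibleS _ (negligibleU (A := N) (B := Z0 `\` N) negN _)).
      by move=> x Zx; case: (pselect (N x)) => Nx; [left|right].
    by apply/negligibleP => //; exact: measurableD.
  move=> y [[Oy hy] nN]; split => //.
  have [A2 hA2] : exists A : R, forall n i, eucl (mw (wd n y) *m th) <=
      A * b ^+ n * z ^+ i * eucl (mw (wd (n + i) y) *m th).
    apply: contrapT => h; apply: nN; left; right; apply: hN2; split => //.
  have [A3 hA3] : exists A : R, forall k, norm0 (Al (iota (iter k T y))) <= A * b ^+ k.
    by apply: contrapT => h; apply: nN; right; apply: hN3.
  have th0 : th != 0 by exact: al_neq0 al _ Cth.
  have [z0 z1] := andP z01.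
  have [w Lw [E hE]] := @shadowing R p (fun n => mw (wd n y)) (fun n => Al (iota (iter n T y)))
    (fun n => norm0 (Al (iota (iter n T y)))) v th A2 A3 (ldist v th) b z erefl
    (fun n => wdS_step n y)
    (ltac:(by move=> n u; have [_ un _] := al_GLZ al (iota (iter n T y));
           rewrite -{1}(mulKmx un u); exact: norm0VP)) th0
    (ltac:(have := hA2 0%N 0%N; rewrite addn0 !expr0 !mulr1 -[leLHS]mul1r => h;
           have := eucl_mw_gt0 al (wd 0 y) Cth => h0; rewrite ler_pM2r // in h; lra))
    (ltac:(have := hA3 0%N; rewrite expr0 mulr1;
           apply: le_trans; apply: le_trans (letter_norm_ge1 al _) => //))
    (ltW l0) b1 z0 b2 hA2 hA3 (ltac:(by move=> n; rewrite mulrC; exact: hy)).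
  exists w; last first.
    move=> sw; apply: nN; left; left; apply: hN1; split => //; by exists w.
  by apply: (growth_le_mono _ b3); [rewrite exprn_egt1|exists E].
have /choice[Z hZ] := step.
have [x [Ox hx]] : exists x, Om x /\ forall j, exists n, Z j (iter n T x).
  apply: contrapT => h.
  have : mu.-negligible Om.
    apply: (negligibleS _ (negligible_bigcup_count (fun j : nat =>
      ergodic_recurrence (coded_mT cd) (coded_inv cd) (coded_erg cd)
        (let: And3 a _ _ := hZ j in a) (let: And3 _ a _ := hZ j in a)))).
    move=> x Ox; apply: contrapT => hx; apply: h; exists x; split => // j.
    apply: contrapT => hj; apply: hx; exists j => //= hm.
    by have [n _ Zn] := hm 0%N; apply: hj; exists n.
  move=> nO; have : mu Om = 0%E by apply/negligibleP => //; exact: coded_mOm cd.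
  by rewrite (coded_Om1 cd) => /eqP; rewrite onee_eq0.
have [j0 hj0] := decreasing_linear_sets (fun j => growth_le_linear (beta j) x)
  (fun i j ij => growth_le_mono (beta1 j) (beta_mono i j ij)).
have [n Zn] := hx j0.
have [_ _ /(_ _ Zn)[_ [w gw nw]]] := hZ j0.
apply: nw => b b1.
(* The index [j0] belongs to the fibre over [x], so the vector found over the n-th iterate is pulled
   back there. Growth rates do not change under this, and stabilisation makes the vector
   subexponential. *)
pose w' := invmx (mw (wd n x)) *m w.
have ww : w = mw (wd n x) *m w' by rewrite mulKVmx // (mw_unit al).
have [i ib] : exists i, beta i <= b.
  exists (Num.trunc (b - 1)^-1); rewrite /beta -lerBrDl invf_ple ?posrE ?subr_gt0 //.
  by rewrite ltW // truncnS_gt.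
apply: (growth_le_mono (beta1 i) ib); rewrite ww.
apply: (proj1 (growth_le_shift x n w' (beta1 i))); apply: hj0.
by apply: (proj2 (growth_le_shift x n w' (beta1 j0))); rewrite -ww.
Qed.

End UniformGrowth.

(** * Drift of the distance of a line to the origin *)

Section Drift.
Context {R : realType} {d : measure_display} {X : measurableType d} {p : nat}.
Variables (mu : probability X R) (T : X -> X) (iota : X -> int) (Om : set X) (K : R).
Hypothesis cd : coded mu T iota Om K.
Variables (Al : int -> 'M[R]_p) (C : set 'cV[R]_p).
Hypothesis al : adapted_letters Al C.
Local Notation P := (wprob mu T iota Om).
Local Notation wd := (wd T iota).
Local Notation wsum := (wsum mu T iota Om).
Local Notation mw := (mw Al).
Local Notation lognorm := (lognorm Al).
Hypothesis fin : (wsum [::] 1 lognorm < +oo)%E.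
Variable g : R.
Hypothesis g1 : 1 < g.
Hypothesis growth : forall v th, C th -> 0 < ldist v th ->
  mu.-negligible [set x | Om x /\ forall n,
    ldist (mw (wd n x) *m v) (mw (wd n x) *m th) <= g ^+ n * ldist v th].

Lemma wsum_take r m q f : (forall s, 0 <= f s) ->
  (wsum r (m + q) (fun s => f (take m s)) <= wsum r m f)%E.
Proof.
move=> f0; rewrite wsum_peel //; apply: le_esum => s Ws.
apply: le_trans (wsum_cst cd _ _ (f0 s)).
by apply: wsum_le => u Wu; rewrite take_size_cat.
Qed.

Definition slow (v th : 'cV[R]_p) (s : seq int) := forall k, (k <= size s)%N ->
  ldist (mw (take k s) *m v) (mw (take k s) *m th) <= g ^+ k * ldist v th.

(** By [growth] a fixed line is almost surely not slow forever; compactness of the normalised lines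
    gives a common length. Slowness is unaffected by rescaling the line, sliding [v] along [th] or
    rescaling [th]. *)
Lemma slow_rare (e : R) : 0 < e -> exists m, forall v th, C th -> 0 < ldist v th ->
  (\esum_(s in words m `&` [set s | slow v th s]) (P s)%:E <= e%:E)%E.
Proof.
move=> e0.
pose G s (y : 'cV[R]_p * 'cV[R]_p) := exists2 k, (k <= size s)%N &
  g ^+ k < ldist (mw (take k s) *m y.1) (mw (take k s) *m y.2).
have [|||m hm] := @dini_words _ _ _ mu T iota Om K cd _ _ G _
  (compact_normal_frames (al_compact al)) e0.
- move=> s y [_ [Cy _] _] [k ks hk].
  have n0 : mw (take k s) *m y.2 != 0 by apply: (al_neq0 al); exact: mw_C al _ _ Cy.
  by have := near_ldist_gt n0 hk; apply: filterS => y' hy'; exists k.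
- move=> s t y [k ks hk]; exists k; first by rewrite size_cat (leq_trans ks) ?leq_addr.
  by rewrite takel_cat.
- move=> y [y1 [Cy _] o]; have ly : ldist y.1 y.2 = 1 by rewrite ldist_orth.
  apply: negligibleS (growth (v := y.1) Cy _); last by rewrite ly.
  move=> x [Ox h]; split => // n; rewrite ly mulr1 leNgt; apply/negP => hn.
  by apply: (h n); exists n; rewrite ?size_wd // take_wd.
exists m => v th Cth l0.
have th0 := al_neq0 al Cth.
have e1 : (eucl th)^-1 != 0 by rewrite invr_eq0 eucl_eq0.
pose c := - (dot v th / dot th th).
pose y := ((ldist v th)^-1 *: (v + c *: th), (eucl th)^-1 *: th).
have yl : eucl (v + c *: th) = ldist v th by rewrite /c scaleNr.
have hy B : ldist (B *m y.1) (B *m y.2) = (ldist v th)^-1 * ldist (B *m v) (B *m th).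
  rewrite -!scalemxAr ldist_scaler // ldist_scalel mulmxDr -scalemxAr ldist_addl.
  by rewrite ger0_norm // invr_ge0 ldist_ge0.
apply: le_trans (hm y _); last first.
  split => /=.
  - by rewrite euclZ yl ger0_norm ?invr_ge0 ?ldist_ge0 // mulVf // gt_eqF.
  - by split; [exact: (al_scale al)|rewrite /= eucl_unit_scale].
  - by rewrite dotZl dotZr /c scaleNr dot_foot // !mulr0.
apply: esum_subset => s [Ws sl]; split => // -[k ks]; rewrite hy.
by rewrite ltr_pdivlMl // mulrC ltNge => /negP; apply; exact: sl.
Qed.

Let c := ln g.
Let c0 : 0 < c. Proof. by rewrite ln_gt0. Qed.

(** The shortfall of ln [ldist] from a gain of [c] per letter. A letter is charged only if the line
    is slow on the window of [m] letters starting there: [c] for the gain that is missed and the log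
    norm for the worst loss. Near the end of the word the window is cut short. *)
Fixpoint cost (m : nat) (v th : 'cV[R]_p) (s : seq int) : R :=
  if s is l :: s' then
    (c + ln (norm0 (Al l))) * (`[< slow v th (take m s) >])%:R
    + cost m (Al l *m v) (Al l *m th) s'
  else 0.

Lemma cost_ge0 m v th s : 0 <= cost m v th s.
Proof.
elim: s v th => //= l s IH v th; rewrite addr_ge0 // mulr_ge0 ?ler0n //.
by rewrite addr_ge0 ?(ltW c0) // (ln_letter_ge0 al).
Qed.

Lemma cost_le m v th s : cost m v th s <= c * (size s)%:R + lognorm s.
Proof.
elim: s v th => [|l s IH] v th; first by rewrite /= mulr0 add0r (lognorm_ge0 al).
rewrite lognorm_cons [size _]/= -natr1 mulrDr mulr1.
have h := IH (Al l *m v) (Al l *m th).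
have a0 : 0 <= c + ln (norm0 (Al l)) by rewrite addr_ge0 ?(ltW c0) // (ln_letter_ge0 al).
have : (c + ln (norm0 (Al l))) * (`[< slow v th (take m (l :: s)) >])%:R <= c + ln (norm0 (Al l)).
  by rewrite ler_piMr // lern1 leq_b1.
rewrite [cost _ _ _ _]/=; lra.
Qed.

Lemma cost_drop m v th s k :
  cost m (mw (take k s) *m v) (mw (take k s) *m th) (drop k s) <= cost m v th s.
Proof.
elim: s v th k => [|l s IH] v th k; first by [].
case: k => [|k]; first by rewrite drop0 take0 !mul1mx.
rewrite /= -!mulmxA; apply: le_trans (IH _ _ k) _.
by rewrite lerDr mulr_ge0 ?ler0n // addr_ge0 ?(ltW c0) // (ln_letter_ge0 al).
Qed.

(* At a time that is not slow the line gains [c] per letter up to the next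
   fast time; at a slow time it loses at most the log norm of one letter. *)
Lemma ln_ldist_cost m v th s : C th -> 0 < ldist v th ->
  ln (ldist v th) + c * (size s)%:R - cost m v th s <=
    ln (ldist (mw s *m v) (mw s *m th)).
Proof.
have [n] := ubnP (size s); elim: n s v th => // n IH [|l s] v th sn Cth l0.
  by rewrite /= !mul1mx mulr0 addr0 subr0.
have [sl|nsl] := pselect (slow v th (take m (l :: s))).
  have l0' : 0 < ldist (Al l *m v) (Al l *m th).
    by have := ldist_mw_gt0 al [:: l] l0; rewrite /= mul1mx.
  have := IH s (Al l *m v) (Al l *m th) sn (al_C al l Cth) l0'.
  have : ln (ldist v th) <= ln (norm0 (Al l)) + ln (ldist (Al l *m v) (Al l *m th)).
    have := ldist_mw al [:: l] v th; rewrite /= !mul1mx /lognorm big_seq1 (expR_letter al).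
    have n0 : 0 < norm0 (Al l) by exact: lt_le_trans (letter_norm_ge1 al l).
    by rewrite -lnM ?posrE // ler_ln ?posrE // mulr_gt0.
  rewrite [cost m v th (l :: s)]/= asboolT // mulr1 [size _]/= -natr1 mulrDr mulr1 -!mulmxA; lra.
move: nsl => /existsNP[k /not_implyP[km /negP]]; rewrite -ltNge => hk.
have kl : (k <= size (l :: s))%N by apply: leq_trans km _; rewrite size_take_min geq_minr.
have kt : take k (take m (l :: s)) = take k (l :: s).
  by rewrite take_takel // (leq_trans km) // size_take_min geq_minl.
have k0 : (0 < k)%N.
  by case: k hk {km kl kt} => //; rewrite take0 /= !mul1mx expr0 mul1r ltxx.
rewrite kt in hk.
set u := l :: s in hk kl *.
have lt0 : 0 < ldist (mw (take k u) *m v) (mw (take k u) *m th) by exact: ldist_mw_gt0 al _ _ _ l0.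
have := IH (drop k u) (mw (take k u) *m v) (mw (take k u) *m th) _ (mw_C al _ Cth) lt0.
rewrite -!mw_cat_mul cat_take_drop size_drop natrB // => h.
have {}h := h (ltac:(by rewrite /u /= in sn kl *; lia)).
have h2 : ln (ldist v th) + c * k%:R <= ln (ldist (mw (take k u) *m v) (mw (take k u) *m th)).
  have gk : 0 < g ^+ k by rewrite exprn_gt0 // (lt_trans ltr01).
  have -> : c * k%:R = ln (g ^+ k) by rewrite lnXn ?mulr_natr // (lt_trans ltr01).
  by rewrite addrC -lnM ?posrE // ler_ln ?posrE ?mulr_gt0 // ltW.
have := cost_drop m v th u k; move: h h2; rewrite mulrBr; lra.
Qed.

Lemma wsum_letter_tail (e : R) : 0 < e -> exists b : R, 0 <= b /\
  (wsum [::] 1 (fun s => (c + lognorm s) * ((b < lognorm s)%R)%:R)%R <= e%:E)%E.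
Proof.
move=> e0.
have fin' : (\esum_(s in words 1) (P s * (c + lognorm s))%:E < +oo)%E.
  rewrite -[ltLHS]/(wsum [::] 1 (fun s => c + lognorm s)) wsumD; last 2 first.
  - by move=> s _; exact: ltW.
  - by move=> s _; exact: lognorm_ge0 al _.
  by apply: lte_add_pinfty => //; apply: le_lt_trans (wsum_cst cd _ _ (ltW c0)) (ltry _).
have [|b [b0 hb]] := @esum_tail _ _ _ _ lognorm _ _ fin' e0.
  by move=> s _; rewrite mulr_ge0 ?wprob_ge0 // addr_ge0 ?(ltW c0) // (lognorm_ge0 al).
exists b; split => //; apply: le_trans hb.
rewrite esum_mkcondr; apply: le_esum => s _; case: ifPn => [|nb].
  by rewrite inE /= => h; rewrite h mulr1.
case: ltP => h; last by rewrite /= !mulr0.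
by move: nb; rewrite mem_set.
Qed.

(** A letter with a full window costs at most c/2 on average. Fewer than [m] letters at the end have
    a shorter window, and each costs a bounded amount, so a long block keeps a net gain of at least
    1. *)
Lemma cost_drift : exists m N, (0 < N)%N /\ forall r v th, C th -> 0 < ldist v th ->
  (wsum r N (cost m v th) <= (P r * (c * N%:R - 1))%:E)%E.
Proof.
have K1 := coded_K_ge1 cd.
have K0 : 0 < K by exact: lt_le_trans K1.
(* The mean cost of a letter is at most K (e + e) = c/2: one [e] for letters of log norm above [b],
   the other for slow windows starting with a smaller letter, whose charge is at most c + b and
   whose probability is at most [eta]. *)
pose e := c / (4 * K); have e0 : 0 < e by rewrite divr_gt0 // mulr_gt0.
have [b [b0 hb]] := wsum_letter_tail e0.
have cb : 0 < c + b by rewrite ltr_wpDr.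
pose eta := Num.min 2^-1 (e / (c + b)).
have eta0 : 0 < eta by rewrite lt_min invr_gt0 ltr0n divr_gt0.
have eta2 : eta < 1 by apply: le_lt_trans (_ : 2^-1 < 1); [rewrite /eta ge_min lexx|lra].
have eta1 : eta * (c + b) <= e by rewrite -ler_pdivlMr // /eta ge_min lexx orbT.
have [m hm] := slow_rare eta0.
have ah s : 0 <= c + lognorm (take 1 s) by rewrite addr_ge0 ?(ltW c0) // (lognorm_ge0 al).
pose h v th s : R := (c + lognorm (take 1 s)) * (`[< slow v th (take m s) >])%:R.
have h0 v th s : 0 <= h v th s by rewrite mulr_ge0 ?ler0n.
pose C1 : R := c + fine (wsum [::] 1 lognorm).
have lognormw0 : (0 <= wsum [::] 1 lognorm)%E.
  by apply: wsum_ge0 => s _; exact: lognorm_ge0 al _.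
have C10 : 0 <= C1 by rewrite addr_ge0 ?(ltW c0) // fine_ge0.
have hC1 : (wsum [::] 1 (fun s => c + lognorm s)%R <= C1%:E)%E.
  rewrite wsumD; last 2 first.
  - by move=> s _; exact: ltW.
  - by move=> s _; exact: lognorm_ge0 al _.
  rewrite EFinD fineK; last by rewrite ge0_fin_numE.
  by apply: leeD2r; apply: le_trans (wsum_cst cd _ _ (ltW c0)) _; rewrite (wprob_nil cd) mul1r.
have crude r n v th : (wsum r n.+1 (h v th) <= (P r * (K * C1))%:E)%E.
  apply: (@le_trans _ _ (wsum r (1 + n) (fun s => c + lognorm (take 1 s)))).
    by apply: wsum_le => s _; rewrite ler_piMr // lern1 leq_b1.
  apply: (le_trans (@wsum_take r 1 n (fun s => c + lognorm s) _)).
    by move=> s; rewrite addr_ge0 ?(ltW c0) // (lognorm_ge0 al).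
  apply: (le_trans (@wsum_dist _ _ _ _ _ _ _ _ cd r 1 _ _)).
    by move=> s _; rewrite addr_ge0 ?(ltW c0) // (lognorm_ge0 al).
  apply: (le_trans (lee_wpmul2l _ hC1)); first by rewrite lee_fin mulr_ge0 ?wprob_ge0 ?(ltW K0).
  by rewrite -EFinM lee_fin [K * _]mulrC -mulrA.
have fine_step r n v th : C th -> 0 < ldist v th -> (m <= n.+1)%N ->
    (wsum r n.+1 (h v th) <= (P r * (c / 2))%:E)%E.
  move=> Cth l0 mn.
  have m0 : (0 < m)%N.
    have [m0|//] := posnP m; exfalso.
    have : (1%:E <= eta%:E)%E.
      apply: le_trans (hm v th Cth l0); rewrite m0 -(wprob_nil cd).
      rewrite -(@esum_set1 _ _ [::] (fun s => (P s)%:E)) ?lee_fin ?wprob_ge0 //.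
      apply: esum_subset => s /= ->; split => // k; rewrite leqn0 => /eqP ->.
      by rewrite !mul1mx expr0 mul1r.
    by rewrite lee_fin leNgt eta2.
  pose f u := (c + lognorm (take 1 u)) * (`[< slow v th u >])%:R.
  have f0 u : 0 <= f u by rewrite mulr_ge0 ?ler0n.
  apply: (@le_trans _ _ (wsum r (m + (n.+1 - m)) (fun s => f (take m s)))).
    rewrite subnKC //; apply: wsum_le => s _; rewrite /h /f take_takel //.
  apply: (le_trans (wsum_take _ _ _ f0)).
  apply: (le_trans (@wsum_dist _ _ _ _ _ _ _ _ cd r m f _)) => //.
  have hf : (wsum [::] m f <= (e + e)%:E)%E.
    pose f1 u := (c + lognorm u) * ((b < lognorm u)%R)%:R.
    have f10 u : 0 <= f1 u by rewrite mulr_ge0 ?ler0n // addr_ge0 ?(ltW c0) // (lognorm_ge0 al).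
    apply: (@le_trans _ _ (wsum [::] m (fun u => f1 (take 1 u) + (c + b) * (`[< slow v th u >])%:R))).
      apply: wsum_le => u _; rewrite /f /f1; case: ltP => hb1 /=.
        rewrite mulr1; apply: ler_wpDr; first by rewrite mulr_ge0 ?ler0n // ltW.
        by rewrite ler_piMr // lern1 leq_b1.
      by rewrite mulr0 add0r ler_wpM2r ?ler0n // lerD2l.
    rewrite wsumD //; last by move=> s _; rewrite mulr_ge0 ?ler0n // ltW.
    rewrite EFinD; apply: leeD.
      by rewrite -(subnKC m0); apply: le_trans (wsum_take _ _ _ f10) hb.
    apply: (le_trans (@wsumZ _ _ _ _ _ _ _ _ _ _ _ (ltW cb) _)); first by move=> s _; rewrite ler0n.
    apply: (@le_trans _ _ ((c + b)%:E * eta%:E)%E); last by rewrite -EFinM lee_fin mulrC.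
    apply: lee_wpmul2l; first by rewrite lee_fin ltW.
    apply: le_trans (hm v th Cth l0); rewrite /wsum esum_mkcondr; apply: le_esum => s _ /=.
    case: asboolP => sl; first by rewrite mem_set // mulr1.
    by rewrite mulr0; case: ifPn => // _; rewrite lee_fin wprob_ge0.
  apply: (le_trans (lee_wpmul2l _ hf)); first by rewrite lee_fin mulr_ge0 ?wprob_ge0 ?(ltW K0).
  rewrite -EFinM lee_fin /e (_ : K * P r * _ = P r * (c / 2)) //.
  by field; rewrite gt_eqF.
pose bnd n : R := n%:R * (c / 2) + (minn n m)%:R * (K * C1).
have KC : 0 <= K * C1 by rewrite mulr_ge0 ?(ltW K0).
have bnd0 n : 0 <= bnd n by rewrite addr_ge0 // mulr_ge0 ?ler0n // divr_ge0 // ltW.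
have acc n : forall r v th, C th -> 0 < ldist v th ->
    (wsum r n (cost m v th) <= (P r * bnd n)%:E)%E.
  elim: n => [|n IH] r v th Cth l0.
    apply: (@le_trans _ _ (wsum r 0 (fun=> 0))).
      by apply: wsum_le => -[].
    by apply: le_trans (wsum_cst cd _ _ _) _ => //; rewrite lee_fin ler_wpM2l ?wprob_ge0.
  apply: (@le_trans _ _ (wsum r n.+1 (fun s => h v th s +
     cost m (mw (take 1 s) *m v) (mw (take 1 s) *m th) (drop 1 s)))).
    apply: wsum_le => -[|l s] // _.
    by rewrite /h /= take0 drop0 mul1mx /lognorm big_seq1.
  rewrite wsumD //; last by move=> s _; exact: cost_ge0.
  have : (wsum r (1 + n) (fun s => cost m (mw (take 1 s) *m v) (mw (take 1 s) *m th) (drop 1 s))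
     <= (P r * bnd n)%:E)%E.
    rewrite wsum_peel; last by move=> s _; exact: cost_ge0.
    apply: le_trans (wsum_cst cd r 1 (bnd0 n)); apply: le_esum => u Wu.
    apply: le_trans (IH (r ++ u) _ _ (mw_C al u Cth) (ldist_mw_gt0 al u l0)).
    by apply: wsum_le => s _; rewrite take_size_cat // drop_size_cat.
  move=> h2; have [mn|nm] := leqP m n.+1.
    apply: (le_trans (leeD (fine_step r n v th Cth l0 mn) h2)).
    rewrite -EFinD lee_fin -mulrDr ler_wpM2l ?wprob_ge0 // /bnd -natr1.
    have : (minn n m)%:R * (K * C1) <= (minn n.+1 m)%:R * (K * C1).
      by rewrite ler_wpM2r // ler_nat leq_min geq_minr (leq_trans (geq_minl _ _)).
    lra.
  apply: (le_trans (leeD (crude r n v th) h2)).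
  rewrite -EFinD lee_fin -mulrDr ler_wpM2l ?wprob_ge0 // /bnd.
  have -> : minn n.+1 m = (minn n m).+1 by rewrite !(minn_idPl _) ?(ltnW nm) // ltnW // ltnW.
  rewrite -[n.+1%:R]natr1 -[(minn n m).+1%:R]natr1 !mulrDl !mul1r.
  have := ltW c0; lra.
(* Chosen so that N c/2 exceeds m K C1 + 1. *)
pose N := (Num.trunc ((m%:R * (K * C1) + 1) * 2 / c)).+1.
exists m, N; split => // r v th Cth l0; apply: le_trans (acc N r v th Cth l0) _.
rewrite lee_fin ler_wpM2l ?wprob_ge0 // /bnd.
have : (minn N m)%:R * (K * C1) <= m%:R * (K * C1) by rewrite ler_wpM2r // ler_nat geq_minr.
have : (m%:R * (K * C1) + 1) * 2 / c < N%:R by rewrite truncnS_gt.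
rewrite ltr_pdivrMr // => /ltW; lra.
Qed.

End Drift.

(** * Survival of lines near the lattice *)

Lemma le1_expR (R : realType) (z : R) : 0 <= z -> 1 <= expR z.
Proof. by move=> z0; rewrite -[leLHS](@expR0 R) ler_expR. Qed.

Lemma expR_le_quadratic (R : realType) (z : R) : z <= 2^-1 -> expR z <= 1 + z + 2 * z ^+ 2.
Proof.
move=> z2; have h : 0 < 1 - z by lra.
have : expR z <= (1 - z)^-1.
  rewrite -[expR z]invrK -expRN lef_pV2 ?posrE ?expR_gt0 //.
  exact: expR_ge1Dx.
move=> /le_trans; apply; rewrite -div1r ler_pdivrMr //.
have := sqr_ge0 z; rewrite expr2 => z0; nra.
Qed.

Section Alive.
Context {R : realType} {X : Type} {p : nat}.
Variables (T : X -> X) (iota : X -> int) (Al : int -> 'M[R]_p) (N : nat) (delta : R).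

(** The orbit of [u] stays within [delta] of the lattice at [n] further block times, starting near
    0. The vector recentred at the chosen lattice point is kept, rather than its class modulo the
    lattice, so that the line carrying it can be translated along with it. *)
Fixpoint alive (n : nat) (u : 'cV[R]_p) (y : X) : Prop :=
  eucl u < delta /\
  (if n is n'.+1 then
     exists2 e, intvec e & alive n' (mw Al (wd T iota N y) *m u - e) (iter N T y)
   else True).

Lemma alive_lt n u y : alive n u y -> eucl u < delta.
Proof. by case: n => [|n] []. Qed.

End Alive.

(** Integer vectors with entries bounded by [B], indexed by a finite type of cardinal (2B+1)^p for
    the union bound. *)
Definition box (R : realType) (p B : nat) (phi : {ffun 'I_p -> 'I_(2 * B).+1}) : 'cV[R]_p :=
  \col_i ((phi i)%:R - B%:R).

Lemma box_surj (R : realType) p B (e : 'cV[R]_p) : intvec e ->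
  (forall i, `|e i 0| <= B%:R) -> exists phi, e = @box R p B phi.
Proof.
move=> ie eB.
have /choice[k hk] : forall i, exists k : 'I_(2 * B).+1, e i 0 = k%:R - B%:R.
  move=> i; have /intrP[z ez] := ie i.
  have := eB i; rewrite ez -intr_norm pmulrn ler_int => zB.
  have kl : (absz (z + B%:Z)%R < (2 * B).+1)%N by lia.
  exists (Ordinal kl).
  rewrite [(Ordinal _)%:R]pmulrn [nat_of_ord _]/=; have -> : (absz (z + B%:Z)%R)%:Z = z + B%:Z by lia.
  by rewrite intrD addrK.
exists [ffun i => k i]; apply/colP => i; rewrite mxE ffunE.
by have := hk i.
Qed.

Section Survival.
Context {R : realType} {d : measure_display} {X : measurableType d} {p : nat}.
Variables (mu : probability X R) (T : X -> X) (iota : X -> int) (Om : set X) (K : R).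
Hypothesis cd : coded mu T iota Om K.
Variables (Al : int -> 'M[R]_p) (C : set 'cV[R]_p).
Hypothesis al : adapted_letters Al C.
Local Notation P := (wprob mu T iota Om).
Local Notation wd := (wd T iota).
Local Notation wsum := (wsum mu T iota Om).
Local Notation cyl := (cyl T iota Om).
Local Notation mw := (mw Al).
Local Notation lognorm := (lognorm Al).
Hypothesis fin : (wsum [::] 1 lognorm < +oo)%E.

Lemma lognorm_cat s t : lognorm (s ++ t) = lognorm s + lognorm t.
Proof. by rewrite /lognorm big_cat. Qed.

Lemma wsum_lognorm n r :
  (wsum r n lognorm <= (P r * (n%:R * (K * fine (wsum [::] 1 lognorm))))%:E)%E.
Proof.
have K1 := coded_K_ge1 cd; have K0 : 0 < K by exact: lt_le_trans K1.
have l0 s : 0 <= lognorm s by exact: lognorm_ge0 al _.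
set a := fine _.
have a0 : 0 <= a by rewrite fine_ge0 // wsum_ge0.
have aE : wsum [::] 1 lognorm = a%:E by rewrite fineK // ge0_fin_numE ?wsum_ge0.
elim: n r => [|n IH] r.
  apply: (@le_trans _ _ (wsum r 0 (fun=> 0))).
    by apply: wsum_le => -[|//] _; rewrite /lognorm big_nil.
  by apply: le_trans (wsum_cst cd _ _ _) _ => //; rewrite mul0r.
apply: (@le_trans _ _ (wsum r (1 + n) (fun s => lognorm (take 1 s) + lognorm (drop 1 s)))).
  by apply: wsum_le => s _; rewrite -lognorm_cat cat_take_drop.
rewrite wsumD //.
have h1 : (wsum r (1 + n) (fun s => lognorm (take 1 s)) <= (P r * (K * a))%:E)%E.
  apply: (le_trans (wsum_take cd _ _ _ l0)).
  apply: (le_trans (@wsum_dist _ _ _ _ _ _ _ _ cd r 1 _ _)) => //.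
  by rewrite aE -EFinM lee_fin [K * _]mulrC -mulrA.
have h2 : (wsum r (1 + n) (fun s => lognorm (drop 1 s)) <= (P r * (n%:R * (K * a)))%:E)%E.
  rewrite wsum_peel //.
  have b0 : 0 <= n%:R * (K * a) by rewrite !mulr_ge0 ?ler0n // ltW.
  apply: le_trans (wsum_cst cd r 1 b0); apply: le_esum => u Wu.
  by apply: le_trans (IH (r ++ u)); apply: wsum_le => s _; rewrite drop_size_cat.
apply: (le_trans (leeD h1 h2)).
have -> : n.+1%:R * (K * a) = K * a + n%:R * (K * a) by rewrite -[n.+1%:R]natr1; ring.
by rewrite -EFinD lee_fin -mulrDr.
Qed.

Variables (c : R) (N : nat) (B : 'cV[R]_p -> 'cV[R]_p -> seq int -> R).
Hypothesis c0 : 0 < c.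
Hypothesis N0 : (0 < N)%N.
Hypothesis B_ge0 : forall v th s, 0 <= B v th s.
Hypothesis B_le : forall v th s, words N s -> B v th s <= c * N%:R + lognorm s.
Hypothesis B_ln : forall v th s, words N s -> C th -> 0 < ldist v th ->
  ln (ldist v th) + c * N%:R - B v th s <= ln (ldist (mw s *m v) (mw s *m th)).
Hypothesis B_sum : forall r v th, C th -> 0 < ldist v th ->
  (wsum r N (B v th) <= (P r * (c * N%:R - 1))%:E)%E.

Section Thresholds.
Variables (b b' rho delta : R).
Let b2 := c * N%:R + b.
Hypothesis b_ge0 : 0 <= b.
Hypothesis bb' : b <= b'.
Hypothesis rho0 : 0 < rho.
Hypothesis rho_small : rho * (8 * (1 + b2) ^+ 2) = 1.
Hypothesis delta8 : delta <= 8^-1.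
Hypothesis delta_nojump : (1 + expR b') * delta <= 1.
Hypothesis b_tail : (wsum [::] N (fun s => ((b < lognorm s)%R)%:R)%R <= ((4 * (c * N%:R) * K)^-1)%:E)%E.

(* The weight of a word pays for the branching and for the contraction caused by
   a word of large norm. *)
Definition weight (s : seq int) : R :=
  if b' < lognorm s then rho * lognorm s + p%:R * (ln 5 + lognorm s)
  else if b < lognorm s then rho * lognorm s else 0.

Fixpoint wordweight (n : nat) (s : seq int) : R :=
  if n is n'.+1 then weight (take N s) + wordweight n' (drop N s) else 0.

Lemma weight_ge0 s : 0 <= weight s.
Proof.
have l0 := lognorm_ge0 al s; have r0 := ltW rho0.
rewrite /weight; case: ifP => _; last by case: ifP => _ //; rewrite mulr_ge0.
by rewrite addr_ge0 ?mulr_ge0 ?ler0n // addr_ge0 // ln_ge0 // ler1n.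
Qed.

(** The factor by which a block multiplies the moment of exponent -rho. For blocks of log norm above
    [b] it is set to 1, their possible contraction being charged to [weight]. *)
Let psi v th s : R := if lognorm s <= b then expR (rho * B v th s - rho * (c * N%:R)) else 1.

(** Second order expansion in rho. The drift contributes -rho; the quadratic term is at most 2 rho
    (rho b2^2) <= rho/4 by the choice of rho; the blocks above [b] contribute at most rho/4 by
    [b_tail]. *)
Lemma psi_sum r v th : C th -> 0 < ldist v th ->
  (wsum r N (psi v th) <= (P r * (1 - rho / 2))%:E)%E.
Proof.
move=> Cth l0.
have K1 := coded_K_ge1 cd; have K0 : 0 < K by exact: lt_le_trans K1.
have n0 : 0 < N%:R :> R by rewrite ltr0n.
have cN0 : 0 < c * N%:R by rewrite mulr_gt0.
set q := c * N%:R in cN0 *.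
have b20 : 0 < b2 by rewrite /b2 ltr_wpDr.
have r0 := ltW rho0.
have e1 : rho * b2 <= 8^-1.
  have : rho * (8 * b2) <= rho * (8 * (1 + b2) ^+ 2).
    by rewrite ler_wpM2l // ler_wpM2l // expr2; nra.
  rewrite rho_small; lra.
have e2 : rho * b2 ^+ 2 <= 8^-1.
  have : rho * (8 * b2 ^+ 2) <= rho * (8 * (1 + b2) ^+ 2).
    by rewrite ler_wpM2l // ler_wpM2l // !expr2; nra.
  rewrite rho_small; lra.
have qb : q <= b2 by rewrite /b2 lerDl.
pose k0 := 1 - rho * q + 2 * rho * (rho * b2 ^+ 2).
have k00 : 0 <= k0.
  have : rho * q <= rho * b2 by rewrite ler_wpM2l.
  have := mulr_ge0 (mulr_ge0 (ler0n R 2) r0) (mulr_ge0 r0 (sqr_ge0 b2)).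
  by rewrite /k0; lra.
apply: (@le_trans _ _ (wsum r N (fun s => (k0 + rho * B v th s) +
     rho * q * ((b < lognorm s)%R)%:R))).
  apply: wsum_le => s Ws; rewrite /psi.
  have B0 := B_ge0 v th s; have rB : 0 <= rho * B v th s by rewrite mulr_ge0.
  case: ltP => lb /=; last first.
    rewrite mulr0 addr0.
    have Bb : B v th s <= b2 by apply: le_trans (B_le v th Ws) _; rewrite /b2 lerD2l.
    have z1 : rho * B v th s - rho * q <= 2^-1.
      have : rho * B v th s <= rho * b2 by rewrite ler_wpM2l.
      have := mulr_ge0 r0 (ltW cN0); lra.
    apply: le_trans (expR_le_quadratic z1) _.
    have z2 : (rho * B v th s - rho * q) ^+ 2 <= rho * (rho * b2 ^+ 2).
      rewrite -mulrBr exprMn expr2 -mulrA !ler_wpM2l // !expr2.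
      have : `|B v th s - q| <= b2 by rewrite ler_norml; apply/andP; split; lra.
      by move=> h; rewrite -!expr2 -(real_normK (num_real (_ - _))) lerXn2r ?nnegrE // ltW.
    rewrite /k0; lra.
  have := mulr_ge0 (mulr_ge0 (ler0n R 2) r0) (mulr_ge0 r0 (sqr_ge0 b2)).
  rewrite mulr1 /k0; lra.
have rq0 : 0 <= rho * q by rewrite mulr_ge0 // ltW.
rewrite wsumD; last 2 first.
- by move=> s _; rewrite addr_ge0 // mulr_ge0.
- by move=> s _; rewrite mulr_ge0.
rewrite wsumD; last 2 first.
- by [].
- by move=> s _; rewrite mulr_ge0.
have h1 := wsum_cst cd r N k00.
have h2 : (wsum r N (fun s => rho * B v th s)%R <= (rho * (P r * (q - 1)))%:E)%E.
  apply: (le_trans (@wsumZ _ _ _ _ _ _ _ _ _ _ _ r0 _)) => //.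
  by rewrite EFinM lee_wpmul2l // B_sum.
have h3 : (wsum r N (fun s => rho * q * ((b < lognorm s)%R)%:R)%R <= (P r * (rho / 4))%:E)%E.
  apply: (le_trans (@wsumZ _ _ _ _ _ _ _ _ _ _ _ rq0 _)); first by move=> s _; rewrite ler0n.
  apply: (@le_trans _ _ ((rho * q)%:E * ((K * P r)%:E * ((4 * q * K)^-1)%:E))%E).
    apply: lee_wpmul2l; first by rewrite lee_fin.
    apply: (le_trans (@wsum_dist _ _ _ _ _ _ _ _ cd r N _ _)); first by move=> s _; rewrite ler0n.
    by apply: lee_wpmul2l b_tail; rewrite lee_fin mulr_ge0 ?wprob_ge0 // ltW.
  rewrite -!EFinM lee_fin (_ : rho * q * _ = P r * (rho / 4)) //.
  by field; rewrite !gt_eqF.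
apply: (le_trans (leeD (leeD h1 h2) h3)); rewrite -!EFinD lee_fin.
rewrite [rho * (P r * _)]mulrCA -!mulrDr ler_wpM2l ?wprob_ge0 // /k0.
have : rho * (rho * b2 ^+ 2) <= rho * 8^-1 by rewrite ler_wpM2l.
lra.
Qed.

Local Notation alive := (alive T iota Al N delta).

Fixpoint fsum (n : nat) (y : X) : R :=
  if n is n'.+1 then weight (wd N y) + fsum n' (iter N T y) else 0.

(* Markov's inequality for the negative moment [ldist ^ -rho] over the tree of
   lines obtained by subtracting integer vectors. *)
Lemma survival_bound n : forall r v th q, C th -> 0 < ldist v th ->
  (mu_ext mu (cyl r `&` [set x | (exists2 u, line v th u & alive n u (iter (size r) T x)) /\
     (fsum n (iter (size r) T x) <= q)%R])
  <= (P r * (expR q * (1 - rho / 2) ^+ n * expR (- rho * ln (ldist v th))))%:E)%E.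
Proof.
have r0 := ltW rho0; have d8 := delta8.
have rho1 : rho <= 1.
  have : rho * 1 <= rho * (8 * (1 + b2) ^+ 2).
    rewrite ler_wpM2l //.
    have b20 : 0 <= b2 by rewrite /b2 addr_ge0 // mulr_ge0 // ltW.
    by rewrite expr2; nra.
  by rewrite rho_small; lra.
have lam0 : 0 <= 1 - rho / 2 by lra.
elim: n => [|n IH] r v th q Cth l0.
  set S := _ `&` _.
  have [[x [cx [[u Lu ud] /= q0]]]|S0] := pselect (S !=set0); last first.
    have -> : S = set0 by apply: contrapT => /eqP /set0P.
    by rewrite outer_set0 lee_fin !mulr_ge0 ?wprob_ge0 ?expR_ge0.
  apply: (@le_trans _ _ (P r)%:E).
    rewrite -(mu_cyl cd) -(outer_measurable mu (cyl_measurable cd r)).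
    by apply: outer_le => y [].
  rewrite lee_fin ler_peMr ?wprob_ge0 // expr0 mulr1 -expRD le1_expR //.
  (* A line with an alive point is at distance below delta < 1, so its negative moment is at least
     1; [q] is nonnegative because the empty sum of weights is at most [q]. *)
  rewrite addr_ge0 // mulNr oppr_ge0 pmulr_rle0 // ln_le0 //.
  have [t _ ut] := Lu; have := ldist_le v th t; rewrite ut => /le_trans; apply.
  have := alive_lt ud; lra.
set S := [set x | _]; apply: (le_trans (outer_cyl mu T iota Om r N S)).
set Q := expR q * (1 - rho / 2) ^+ n * expR (- rho * ln (ldist v th)).
have Q0 : 0 <= Q by rewrite !mulr_ge0 ?exprn_ge0 ?expR_ge0.
have psi0 s : 0 <= psi v th s by rewrite /psi; case: ifP => // _; exact: expR_ge0.
apply: (@le_trans _ _ (wsum r N (fun s => Q * psi v th s))); last first.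
  apply: (le_trans (@wsumZ _ _ _ _ _ _ _ _ _ _ _ Q0 _)) => //.
  apply: (le_trans (lee_wpmul2l _ (psi_sum r Cth l0))); first by rewrite lee_fin.
  rewrite -EFinM lee_fin exprS /Q le_eqVlt; apply/orP; left; apply/eqP.
  by move: (_ ^+ n) => ?; ring.
apply: le_esum => s Ws.
have unfold_S x : (cyl (r ++ s) `&` S) x -> cyl (r ++ s) x /\ exists u e,
    [/\ line v th u, intvec e, eucl u < delta,
      alive n (mw s *m u - e) (iter (size (r ++ s)) T x) &
      fsum n (iter (size (r ++ s)) T x) <= q - weight s].
  move=> [cx [[u Lu /= [ud [e ie ae]]] /= fq]]; split => //; exists u, e.
  move: (cx) ae fq; rewrite cyl_cat => -[_ /=]; rewrite Ws => ->.
  by rewrite iter_size_cat Ws => ae fq; split => //; lra.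
have expand w : eucl w <= expR (lognorm s) * eucl (mw s *m w) by exact: eucl_le_mw al _ _.
have l0' := ldist_mw_gt0 al s l0.
have [lb'|lb'] := leP (lognorm s) b'.
  (* For such a word the image of [u] has norm at most e^(b') delta, so an integer vector within
     delta of it has norm below (1 + e^(b')) delta <= 1. *)
  have nojump u e : intvec e -> eucl u < delta -> eucl (mw s *m u - e) < delta -> e = 0.
    move=> ie ud ed; apply/eqP; apply: contraT => e0.
    have := intvecP_eucl_ge1 ie e0; have := eucl_mw_le al s u.
    have : expR (lognorm s) * eucl u <= expR b' * delta.
      by apply: ler_pM; rewrite ?expR_ge0 ?eucl_ge0 ?ler_expR // ltW.
    have := euclD (mw s *m u) (- (mw s *m u - e)); rewrite euclN subKr.
    move: delta_nojump; rewrite mulrDl mul1r; lra.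
  apply: (@le_trans _ _ (P (r ++ s) * (expR (q - weight s) * (1 - rho / 2) ^+ n *
      expR (- rho * ln (ldist (mw s *m v) (mw s *m th)))))%:E).
    apply: le_trans (IH (r ++ s) (mw s *m v) (mw s *m th) (q - weight s) (mw_C al s Cth) l0').
    apply: outer_le => x /unfold_S[cx [u [e [Lu ie ud ae fq]]]]; split => //; split => //.
    have e0 := nojump u e ie ud (alive_lt ae); rewrite e0 subr0 in ae.
    exists (mw s *m u) => //; have [t _ <-] := Lu; exists t => //.
    by rewrite mulmxDr -scalemxAr.
  rewrite lee_fin ler_wpM2l ?wprob_ge0 //.
  have -> : Q * psi v th s = (1 - rho / 2) ^+ n * (expR q * (expR (- rho * ln (ldist v th)) * psi v th s)).
    by rewrite /Q; move: (_ ^+ n) => ?; ring.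
  rewrite [leLHS]mulrAC [leLHS]mulrC ler_wpM2l ?exprn_ge0 // -expRD.
  (* Between [b] and [b'] the worst contraction of the distance is paid by the weight; below [b] the
     weight is 0 and [B_ln] gives the factor [psi]. *)
  rewrite /psi /weight ltNge lb' /=; case: ltP => lb.
    rewrite mulr1 -expRD ler_expR.
    have : ln (ldist v th) <= lognorm s + ln (ldist (mw s *m v) (mw s *m th)).
      rewrite -[lognorm s]expRK -lnM ?posrE ?expR_gt0 // ler_ln ?posrE ?mulr_gt0 ?expR_gt0 //.
      exact: ldist_mw al _ _ _.
    move=> h; have := ler_wpM2l r0 h; lra.
  rewrite -!expRD ler_expR.
  have := ler_wpM2l r0 (B_ln Ws Cth l0); lra.
have lb : b < lognorm s by exact: le_lt_trans lb'.
have -> : psi v th s = 1 by rewrite /psi leNgt lb.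
rewrite mulr1.
(* With M the product along [s], |e| <= |M u| + |M u - e| is at most (e^(lognorm s) + 1)/8, which is
   below [Bx]. *)
pose Bx := (Num.trunc (expR (lognorm s))).+1.
(* Translates that bring the line too close to 0 are discarded; [ldist_jump] shows that they contain
   no alive point arising here. All others obey the same bound [D]. *)
pose E (phi : {ffun 'I_p -> 'I_(2 * Bx).+1}) : set X :=
  if ldist v th <= expR (lognorm s) * ldist (mw s *m v - box R phi) (mw s *m th)
  then cyl (r ++ s) `&` [set x |
    (exists2 u, line (mw s *m v - box R phi) (mw s *m th) u & alive n u (iter (size (r ++ s)) T x)) /\
    fsum n (iter (size (r ++ s)) T x) <= q - weight s]
  else set0.
pose D := expR (q - weight s) * (1 - rho / 2) ^+ n * expR (- rho * (ln (ldist v th) - lognorm s)).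
have D0 : 0 <= D by rewrite !mulr_ge0 ?exprn_ge0 ?expR_ge0.
have EP phi : (mu_ext mu (E phi) <= (P (r ++ s) * D)%:E)%E.
  rewrite /E; case: ifPn => hE; last by rewrite outer_set0 lee_fin mulr_ge0 ?wprob_ge0.
  have l1 : 0 < ldist (mw s *m v - box R phi) (mw s *m th).
    by rewrite -(pmulr_rgt0 _ (expR_gt0 (lognorm s))) (lt_le_trans l0).
  apply: (le_trans (IH (r ++ s) _ _ (q - weight s) (mw_C al s Cth) l1)).
  rewrite lee_fin ler_wpM2l ?wprob_ge0 // ler_wpM2l ?mulr_ge0 ?exprn_ge0 ?expR_ge0 // ler_expR.
  rewrite !mulNr lerN2 ler_wpM2l // lerBlDl -[lognorm s]expRK -lnM ?posrE ?expR_gt0 //.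
  by rewrite ler_ln ?posrE ?mulr_gt0 ?expR_gt0.
apply: (@le_trans _ _ (mu_ext mu (\bigcup_(phi in [set` enum {ffun 'I_p -> 'I_(2 * Bx).+1}]) E phi))).
  apply: outer_le => x /unfold_S[cx [u [e [Lu ie ud ae fq]]]].
  have ad := alive_lt ae.
  have [phi ephi] : exists phi, e = @box R p Bx phi.
    apply: box_surj => // i; apply: le_trans (coord_le_eucl _ _) _.
    have := euclD (mw s *m u) (- (mw s *m u - e)); rewrite euclN subKr.
    have := eucl_mw_le al s u.
    have : expR (lognorm s) * eucl u <= expR (lognorm s) * 8^-1.
      by rewrite ler_wpM2l ?expR_ge0 //; lra.
    have : expR (lognorm s) < Bx%:R by rewrite truncnS_gt.
    have : 1 <= expR (lognorm s) by rewrite le1_expR // (lognorm_ge0 al).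
    lra.
  exists phi; first by rewrite /= mem_enum.
  rewrite /E ifT.
    split => //; split => //; exists (mw s *m u - e) => //.
    have [t _ <-] := Lu; exists t => //.
    by rewrite mulmxDr -scalemxAr -ephi addrAC.
  rewrite -ephi; apply: (@ldist_jump _ _ (mw s) _ delta v th u e) => //.
  - by rewrite le1_expR // (lognorm_ge0 al).
  - move=> t; have [->|t0] := eqVneq t 0; first by rewrite scale0r mulmx0 !eucl0.
    by apply: (mw_expand al); exact: al_scale al _ _ Cth t0.
  - exact: mw_GLZ al _.
apply: (le_trans (outer_bigcup_seq mu E (enum_uniq _))).
apply: (@le_trans _ _ (\sum_(phi <- enum {ffun 'I_p -> 'I_(2 * Bx).+1}) (P (r ++ s) * D)%:E)%E).
  by apply: lee_sum => phi _; exact: EP.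
rewrite sumEFin lee_fin big_const_seq count_predT -cardE iter_addr_0 card_ffun !card_ord.
rewrite -mulr_natr -mulrA ler_wpM2l ?wprob_ge0 // natrX.
(* Origin of ln 5: with x = e^(lognorm s) >= 1, 2 [Bx] + 1 <= 2x + 3 <= 5x. *)
have cnt : ((2 * Bx).+1%:R : R) ^+ p <= expR (p%:R * (ln 5 + lognorm s)).
  rewrite expRM_natl; apply: lerXn2r; rewrite ?nnegrE ?expR_ge0 //.
  rewrite expRD lnK ?posrE // -[(2 * Bx).+1%:R]natr1 natrM -[Bx%:R]natr1.
  have : (Num.trunc (expR (lognorm s)))%:R <= expR (lognorm s) by rewrite truncn_le expR_ge0.
  have : 1 <= expR (lognorm s) by rewrite le1_expR // (lognorm_ge0 al).
  lra.
apply: (le_trans (ler_wpM2l D0 cnt)).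
rewrite /D /Q /weight lb'.
have -> : - rho * (ln (ldist v th) - lognorm s) = rho * lognorm s + - rho * ln (ldist v th) by ring.
rewrite [expR (rho * lognorm s + _)]expRD.
have -> : expR q = expR (q - (rho * lognorm s + p%:R * (ln 5 + lognorm s))) *
   expR (rho * lognorm s) * expR (p%:R * (ln 5 + lognorm s)).
  by rewrite -!expRD; congr expR; ring.
by rewrite le_eqVlt; apply/orP; left; apply/eqP; move: (_ ^+ n) => ?; ring.
Qed.

End Thresholds.
End Survival.

Section SurvivingLines.
Context {R : realType} {d : measure_display} {X : measurableType d} {p : nat}.
Variables (mu : probability X R) (T : X -> X) (iota : X -> int) (Om : set X) (K : R).
Hypothesis cd : coded mu T iota Om K.
Variables (Al : int -> 'M[R]_p) (C : set 'cV[R]_p).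
Hypothesis al : adapted_letters Al C.
Local Notation P := (wprob mu T iota Om).
Local Notation wd := (wd T iota).
Local Notation wsum := (wsum mu T iota Om).
Local Notation cyl := (cyl T iota Om).
Local Notation mw := (mw Al).
Local Notation lognorm := (lognorm Al).
Hypothesis fin : (wsum [::] 1 lognorm < +oo)%E.
Variables (c : R) (N : nat) (B : 'cV[R]_p -> 'cV[R]_p -> seq int -> R).
Hypothesis c0 : 0 < c.
Hypothesis N0 : (0 < N)%N.
Hypothesis B_ge0 : forall v th s, 0 <= B v th s.
Hypothesis B_le : forall v th s, words N s -> B v th s <= c * N%:R + lognorm s.
Hypothesis B_ln : forall v th s, words N s -> C th -> 0 < ldist v th ->
  ln (ldist v th) + c * N%:R - B v th s <= ln (ldist (mw s *m v) (mw s *m th)).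
Hypothesis B_sum : forall r v th, C th -> 0 < ldist v th ->
  (wsum r N (B v th) <= (P r * (c * N%:R - 1))%:E)%E.

Lemma esum_event n (h : seq int -> R) (q : R) :
  wsum [::] n (fun s => h s * ((q < lognorm s)%R)%:R) =
  \esum_(s in words n `&` [set s | q < lognorm s]) (P s * h s)%:E.
Proof.
rewrite esum_mkcondr; apply: eq_esum => s _; case: ifPn => [|nq].
  by rewrite inE /= => ->; rewrite mulr1.
by case: ltP => hq; [move: nq; rewrite mem_set|rewrite /= !mulr0].
Qed.

(** The constants are chosen in the order [b], [rho], [b'], [delta]. On the set [G], for infinitely
    many n the total weight of n blocks is at most n rho/4, and the probability of surviving at such
    an n decays geometrically; a tail sum of these bounds is as small as desired. *)
Lemma surviving_lines_null : exists (delta : R) (G : set X),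
  [/\ 0 < delta, measurable G, (0 < mu G)%E, G `<=` Om &
    forall v th, C th -> 0 < ldist v th ->
      mu.-negligible [set y | G y /\ exists2 u, line v th u &
        forall n, alive T iota Al N delta n u y]].
Proof.
have K1 := coded_K_ge1 cd; have K0 : 0 < K by exact: lt_le_trans K1.
have n0 : 0 < N%:R :> R by rewrite ltr0n.
have cN0 : 0 < c * N%:R by rewrite mulr_gt0.
have l0 s : 0 <= lognorm s by exact: lognorm_ge0 al _.
have ln5 : 0 <= ln (5 : R) by rewrite ln_ge0 // ler1n.
have finN : (wsum [::] N lognorm < +oo)%E.
  exact: le_lt_trans (wsum_lognorm cd al fin N [::]) (ltry _).
have fin1 : (\esum_(s in words N) (P s * (1 + lognorm s))%:E < +oo)%E.
  rewrite -[ltLHS]/(wsum [::] N (fun s => 1 + lognorm s)) wsumD //.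
  by apply: lte_add_pinfty => //; apply: le_lt_trans (wsum_cst cd _ _ _) (ltry _).
have fin2 : (\esum_(s in words N) (P s * (p%:R * (ln 5 + lognorm s)))%:E < +oo)%E.
  rewrite -[ltLHS]/(wsum [::] N (fun s => p%:R * (ln 5 + lognorm s))).
  have s0 : forall s, words N s -> 0 <= ln 5 + lognorm s by move=> s _; rewrite addr_ge0.
  apply: le_lt_trans (@wsumZ _ _ _ _ _ _ _ _ _ _ _ (ler0n R p) s0) _.
  apply: lte_mul_pinfty => //; rewrite ?lee_fin ?ler0n // wsumD //.
  by apply: lte_add_pinfty => //; apply: le_lt_trans (wsum_cst cd _ _ _) (ltry _).
(* The first entry is what [b_tail] requires. The second, with [e2], bounds the mean weight of a
   block by 2 rho/(16K) = rho/(8K), that is rho/8 after conditioning. *)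
pose e1 := Num.min (4 * (c * N%:R) * K)^-1 (16 * K)^-1.
have e10 : 0 < e1 by rewrite lt_min !invr_gt0 !mulr_gt0.
have [|b [b0 hb]] := @esum_tail _ _ _ _ lognorm _ _ fin1 e10.
  by move=> s _; rewrite mulr_ge0 ?wprob_ge0 // addr_ge0.
rewrite -(esum_event N (fun s => 1 + lognorm s)) in hb.
pose b2 := c * N%:R + b.
have b20 : 0 < b2 by rewrite ltr_wpDr.
pose rho := (8 * (1 + b2) ^+ 2)^-1.
have D0 : 0 < 8 * (1 + b2) ^+ 2 by rewrite mulr_gt0 // exprn_gt0 // ltr_wpDr ?ltW.
have rho0 : 0 < rho by rewrite invr_gt0.
have rho_small : rho * (8 * (1 + b2) ^+ 2) = 1 by rewrite mulVf // gt_eqF.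
pose e2 := rho / (16 * K).
have e20 : 0 < e2 by rewrite divr_gt0 // mulr_gt0.
have [|b1 [b10 hb1]] := @esum_tail _ _ _ _ lognorm _ _ fin2 e20.
  by move=> s _; rewrite !mulr_ge0 ?wprob_ge0 ?ler0n // addr_ge0.
rewrite -(esum_event N (fun s => p%:R * (ln 5 + lognorm s))) in hb1.
pose b' := Num.max b b1.
have bb' : b <= b' by rewrite le_max lexx.
have b1b' : b1 <= b' by rewrite le_max lexx orbT.
pose delta := Num.min 8^-1 (1 + expR b')^-1.
have E0 : 0 < 1 + expR b' by rewrite ltr_pwDl // expR_ge0.
have delta0 : 0 < delta by rewrite lt_min !invr_gt0 E0 ltr0n.
have delta8 : delta <= 8^-1 by rewrite ge_min lexx.
have delta_nojump : (1 + expR b') * delta <= 1.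
  by rewrite mulrC -ler_pdivlMr // mul1r ge_min lexx orbT.
have b_tail : (wsum [::] N (fun s => ((b < lognorm s)%R)%:R)%R <= ((4 * (c * N%:R) * K)^-1)%:E)%E.
  apply: (@le_trans _ _ e1%:E); last by rewrite lee_fin ge_min lexx.
  apply: le_trans hb; apply: wsum_le => s _; apply: ler_peMl; rewrite ?ler0n //.
  by rewrite lerDl.
pose F := rho / (8 * K).
have F0 : 0 <= F by rewrite divr_ge0 ?mulr_ge0 ?ltW.
have w0 := weight_ge0 al b b' rho0.
have hF : (wsum [::] N (weight Al b b' rho) <= F%:E)%E.
  apply: (@le_trans _ _ (wsum [::] N (fun s =>
     rho * ((1 + lognorm s) * ((b < lognorm s)%R)%:R) +
     p%:R * (ln 5 + lognorm s) * ((b1 < lognorm s)%R)%:R))).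
    apply: wsum_le => s _; rewrite /weight.
    have r1 : rho * lognorm s <= rho * (1 + lognorm s) by rewrite ler_wpM2l ?(ltW rho0) // lerDr.
    have r2 : 0 <= p%:R * (ln 5 + lognorm s) by rewrite mulr_ge0 ?ler0n // addr_ge0.
    have r3 : 0 <= p%:R * (ln 5 + lognorm s) * ((b1 < lognorm s)%R)%:R by rewrite mulr_ge0 ?ler0n.
    case: ifP => h1.
      by rewrite (le_lt_trans bb' h1) (le_lt_trans b1b' h1) !mulr1 lerD2r.
    case: ltP => h2; first by rewrite mulr1 ler_wpDr.
    by rewrite !mulr0 add0r.
  have p1 s : 0 <= (1 + lognorm s) * ((b < lognorm s)%R)%:R.
    by rewrite mulr_ge0 ?ler0n // addr_ge0.
  rewrite wsumD; last 2 first.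
  - by move=> s _; rewrite mulr_ge0 ?(ltW rho0).
  - by move=> s _; rewrite !mulr_ge0 ?ler0n // addr_ge0.
  apply: (@le_trans _ _ ((rho * (16 * K)^-1)%:E + e2%:E)%E).
    apply: leeD => //.
    apply: (le_trans (@wsumZ _ _ _ _ _ _ _ _ _ _ _ (ltW rho0) _)) => //.
    rewrite EFinM; apply: lee_wpmul2l; first by rewrite lee_fin ltW.
    by apply: le_trans hb _; rewrite lee_fin ge_min lexx orbT.
  rewrite -EFinD lee_fin /e2 /F (_ : _ + _ = rho / (8 * K)) //.
  by field; rewrite gt_eqF.
pose ww := wordweight Al N b b' rho.
have ww0 n s : 0 <= ww n s by elim: n s => //= n IH s; rewrite addr_ge0.
have acc n : forall r, (wsum r (n * N) (ww n) <= (P r * (n%:R * (rho / 8)))%:E)%E.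
  elim: n => [|n IH] r.
    apply: le_trans (@wsum_cst _ _ _ _ _ _ _ _ cd r (0 * N) 0 _) _ => //.
    by rewrite mul0r.
  rewrite mulSn [ww n.+1](_ : _ = fun s => weight Al b b' rho (take N s) + ww n (drop N s)) //.
  rewrite wsumD //.
  have h1 : (wsum r (N + n * N) (fun s => weight Al b b' rho (take N s)) <= (P r * (rho / 8))%:E)%E.
    apply: (le_trans (wsum_take cd _ _ _ w0)).
    apply: (le_trans (@wsum_dist _ _ _ _ _ _ _ _ cd r N _ _)) => //.
    apply: (le_trans (lee_wpmul2l _ hF)); first by rewrite lee_fin mulr_ge0 ?wprob_ge0 // ltW.
    rewrite -EFinM lee_fin /F (_ : K * P r * _ = P r * (rho / 8)) //.
    by field; rewrite gt_eqF.
  have h2 : (wsum r (N + n * N) (fun s => ww n (drop N s)) <= (P r * (n%:R * (rho / 8)))%:E)%E.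
    rewrite wsum_peel //.
    have bn : 0 <= n%:R * (rho / 8) by rewrite mulr_ge0 ?ler0n // divr_ge0 // ltW.
    apply: le_trans (wsum_cst cd r N bn); apply: le_esum => u Wu.
    by apply: le_trans (IH (r ++ u)); apply: wsum_le => s _; rewrite drop_size_cat.
  apply: (le_trans (leeD h1 h2)).
  have -> : n.+1%:R * (rho / 8) = rho / 8 + n%:R * (rho / 8) by rewrite -[n.+1%:R]natr1; ring.
  by rewrite -EFinD lee_fin -mulrDr.
pose fs n y := fsum T iota Al N b b' rho n y.
have fsE n y : fs n y = ww n (wd (n * N) y).
  elim: n y => //= n IH y; rewrite mulSn wd_cat take_size_cat ?size_wd //.
  by rewrite drop_size_cat ?size_wd // -IH.
(* The threshold is twice the mean bound n rho/8, so Markov leaves measure at least 1/2 for every n,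
   hence also for the limsup. *)
pose E n := Om `&` [set y | ww n (wd (n * N) y) <= n%:R * (rho / 4)].
have mE n : measurable (E n).
  exact: (word_event_measurable cd (n * N) [set s | ww n s <= n%:R * (rho / 4)]).
have muE n : ((2^-1)%:E <= mu (E n))%E.
  pose E' := Om `&` [set y | n%:R * (rho / 4) < ww n (wd (n * N) y)].
  have mE' : measurable E'.
    exact: (word_event_measurable cd (n * N) [set s | n%:R * (rho / 4) < ww n s]).
  have h1 : (mu (E n) + mu E' = 1)%E.
    rewrite -(coded_Om1 cd) -measureU //.
      congr (mu _); apply/seteqP; split => x /=; first by move=> [[]|[]].
      by move=> Ox; case: (leP (ww n (wd (n * N) x)) (n%:R * (rho / 4))) => h; [left|right].
    by apply/seteqP; split => // x [[_ h1] [_ h2]]; rewrite /= in h1 h2; rewrite ltNge h1 in h2.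
  have h2 : (mu E' <= (2^-1)%:E)%E.
    have [n00|np] := posnP n.
      rewrite (_ : E' = set0) ?measure0 ?lee_fin ?invr_ge0 //.
      by apply/seteqP; split => // x [_ /=]; rewrite n00 mul0r /= ltxx.
    apply: (le_trans (measure_word_event_le cd (n * N) [set s | n%:R * (rho / 4) < ww n s])).
    have nr : 0 < n%:R * (rho / 4) by rewrite mulr_gt0 ?ltr0n // divr_gt0.
    apply: (@le_trans _ _ (wsum [::] (n * N) (fun s => (n%:R * (rho / 4))^-1 * ww n s))).
      rewrite esum_mkcondr; apply: le_esum => s _; case: ifPn => [|_].
        rewrite inE /= => h; rewrite lee_fin ler_peMr ?wprob_ge0 //.
        by rewrite mulrC ler_pdivlMr // mul1r ltW.
      by rewrite lee_fin !mulr_ge0 ?wprob_ge0 // invr_ge0 ltW.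
    have ni : 0 <= (n%:R * (rho / 4))^-1 by rewrite invr_ge0 ltW.
    apply: (le_trans (@wsumZ _ _ _ _ _ _ _ _ _ _ _ ni _)) => //.
    apply: (le_trans (lee_wpmul2l _ (acc n [::]))); first by rewrite lee_fin.
    rewrite -EFinM lee_fin (wprob_nil cd) mul1r
      (_ : (n%:R * (rho / 4))^-1 * (n%:R * (rho / 8)) = 2^-1) //.
    by field; rewrite pnatr_eq0 -lt0n np andbT gt_eqF.
  move: h1 h2; rewrite -(fineK (fin_num_measure mu _ (mE n))) -(fineK (fin_num_measure mu _ mE')).
  by rewrite -EFinD !lee_fin => -[]; lra.
exists delta, (lim_sup_set E); split => //.
- exact: lim_sup_set_measurable.
- by apply: lt_le_trans (lim_sup_set_ge (b := (2^-1)%:E) mE muE); rewrite lte_fin invr_gt0.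
- by move=> x hx; have [n _ []] := hx 0%N I.
move=> v th Cth lth0.
pose S n := Om `&` [set x | (exists2 u, line v th u & alive T iota Al N delta n u x) /\
  fs n x <= n%:R * (rho / 4)].
pose L := expR (- rho * ln (ldist v th)).
have L0 : 0 < L by exact: expR_gt0.
pose kap := expR (- (rho / 4)).
have k0 : 0 < kap by exact: expR_gt0.
have k1 : kap < 1 by rewrite /kap -expR0 ltr_expR oppr_lt0 divr_gt0.
have hS n : (mu_ext mu (S n) <= (L * kap ^+ n)%:E)%E.
  apply: (@le_trans _ _ (mu_ext mu (cyl [::] `&` [set x |
      (exists2 u, line v th u & alive T iota Al N delta n u (iter (size (Nil int)) T x)) /\
      (fsum T iota Al N b b' rho n (iter (size (Nil int)) T x) <= n%:R * (rho / 4))%R]))).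
    by apply: outer_le => x [Ox hx].
  apply: (le_trans (survival_bound cd al c0 N0 B_ge0 B_le B_ln B_sum b0 bb' rho0 rho_small
    delta8 delta_nojump b_tail n [::] (n%:R * (rho / 4)) Cth lth0)).
  rewrite (wprob_nil cd) mul1r lee_fin -/L mulrC ler_wpM2l ?(ltW L0) //.
  rewrite expRM_natl -exprMn; apply: lerXn2r; rewrite ?nnegrE ?(ltW k0) //.
    rewrite mulr_ge0 ?expR_ge0 //.
    have : rho * 1 <= rho * (8 * (1 + b2) ^+ 2).
      by rewrite ler_wpM2l ?(ltW rho0) // expr2; nra.
    by rewrite rho_small; lra.
  apply: (@le_trans _ _ (expR (rho / 4) * expR (- (rho / 2)))).
    by rewrite ler_wpM2l ?expR_ge0 // expR_ge1Dx.
  by rewrite -expRD ler_expR; lra.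
apply: outer_negligible => e e0.
pose L1 := L / (1 - kap).
have k10 : 0 < 1 - kap by rewrite subr_gt0.
have L10 : 0 < L1 by rewrite divr_gt0.
have [m hm] : exists m, L1 * kap ^+ m <= e.
  pose m := (Num.trunc (L1 / e / (rho / 4))).+1; exists m.
  have h1 : L1 / e <= m%:R * (rho / 4).
    by rewrite -ler_pdivrMr ?divr_gt0 // ltW // truncnS_gt.
  have h2 : m%:R * (rho / 4) <= expR (m%:R * (rho / 4)).
    by apply: le_trans (expR_ge1Dx _); rewrite lerDr.
  rewrite /kap -expRM_natl mulrN expRN ler_pdivrMr ?expR_gt0 //.
  by rewrite mulrC -ler_pdivrMr //; exact: le_trans h1 h2.
apply: (@le_trans _ _ (mu_ext mu (\bigcup_(n in [set: nat]) S (m + n)%N))).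
  apply: outer_le => y [hy [u Lu au]]; have [j /= mj [Oy fj]] := hy m I.
  exists (j - m)%N => //; rewrite subnKC //; split => //; split; first by exists u.
  by rewrite fsE.
apply: (le_trans (outer_bigcup mu _ _)).
apply: (@le_trans _ _ (\esum_(n in [set: nat]) ((L * kap ^+ m)%:E * (kap ^+ n)%:E))%E).
  by apply: le_esum => n _; apply: le_trans (hS _) _; rewrite -EFinM lee_fin exprD mulrA.
have Lm : 0 <= L * kap ^+ m by rewrite mulr_ge0 ?exprn_ge0 ?(ltW k0) ?(ltW L0).
apply: (le_trans (esumZ_le _ _)) => //.
  by move=> n _; rewrite lee_fin exprn_ge0 // ltW.
apply: (le_trans (lee_wpmul2l _ (esum_geometric_le (ltW k0) k1))); first by rewrite lee_fin.
by rewrite -EFinM lee_fin mulrAC.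
Qed.

End SurvivingLines.

(** * From surviving lines to integer points *)

Section WeakStable.
Context {R : realType} {d : measure_display} {X : measurableType d} {p : nat}.
Variables (mu : probability X R) (T : X -> X) (iota : X -> int) (Om : set X) (K : R).
Hypothesis cd : coded mu T iota Om K.
Variables (Al : int -> 'M[R]_p) (C : set 'cV[R]_p).
Hypothesis al : adapted_letters Al C.
Hypothesis unbounded : forall x th (B : R), Om x -> C th ->
  exists n, B < eucl (mw Al (wd T iota n x) *m th).
Hypothesis fin : (wsum mu T iota Om [::] 1 (lognorm Al) < +oo)%E.
Local Notation wd := (wd T iota).
Local Notation mw := (mw Al).
Hypothesis lines_avoid : forall v th, C th -> 0 < ldist v th ->
  mu.-negligible [set x | Om x /\ exists2 w, line v th w & subexponential T iota Al x w].

Definition near_int (e : R) (w : 'cV[R]_p) := exists2 z, intvec z & eucl (w - z) < e.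

Lemma intvec_of_near (w : 'cV[R]_p) : (forall e, 0 < e -> near_int e w) -> intvec w.
Proof.
move=> h; have q0 : 0 < 4^-1 :> R by rewrite invr_gt0.
have [z iz zw] := h _ q0.
suff -> : w = z by [].
apply/eqP; rewrite -subr_eq0 -eucl_eq0; apply/eqP/le_anti; rewrite eucl_ge0 andbT.
apply/ler_addgt0Pr => e e0; rewrite add0r.
have m0 : 0 < Num.min e 4^-1 by rewrite lt_min e0.
have [z' iz' zw'] := h _ m0; move: zw'; rewrite lt_min => /andP[zw1 zw2].
suff -> : z = z' by exact: ltW.
apply/eqP; rewrite -subr_eq0; apply: contraT => zz.
have := intvecP_eucl_ge1 (intvecB iz iz') zz.
have := euclD (w - z') (- (w - z)).
rewrite euclN opprB addrC addrA subrK; lra.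
Qed.

(** The integer vectors are chosen block by block: after subtracting [e], closeness to the lattice
    persists because later products map [e] to integer vectors. *)
Lemma alive_of_near (N : nat) (delta : R) n (u : 'cV[R]_p) y :
  eucl u < delta -> (forall k, near_int delta (mw (wd k y) *m u)) ->
  alive T iota Al N delta n u y.
Proof.
elim: n u y => [|n IH] u y ud h; first by split.
split => //; have [e ie he] := h N; exists e => //; apply: IH => // k.
have [e' ie' he'] := h (N + k)%N.
exists (e' - mw (wd k (iter N T y)) *m e).
  by apply: intvecB => //; apply: intvec_mulmx => //; case: (mw_GLZ al (wd k (iter N T y))).
by move: he'; rewrite wd_cat mw_cat_mul mulmxBr opprB addrA subrK.
Qed.

(** The recurrence time to [G] and the nearby integer vector depend on the point, so the exceptional
    sets of all translated image lines, at all times, are excluded beforehand. *)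
Lemma coded_weak_stable v th : C th ->
  mu.-negligible [set x | Om x /\ exists2 w, line v th w &
    (forall e, 0 < e -> \forall n \near \oo, near_int e (mw (wd n x) *m w)) /\ ~ intvec w].
Proof.
move=> Cth.
have [g g1 growth] := uniform_growth cd al unbounded fin lines_avoid.
have [m [N [N0 drift]]] := cost_drift cd al fin g1 growth.
have c0 : 0 < ln g by rewrite ln_gt0.
have [||||delta [G [d0 mG G0 GO nullG]]] := @surviving_lines_null _ _ _ _ _ _ _ _ _ cd _ _ al fin
  (ln g) N (cost Al g m) c0 N0.
- by move=> v' th' s; exact: (cost_ge0 al g1).
- by move=> v' th' s Ws; have := cost_le al g1 m v' th' s; rewrite Ws.
- by move=> v' th' s Ws C' l'; have := ln_ldist_cost al fin g1 m s C' l'; rewrite Ws.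
- by move=> r v' th' C' l'; exact: drift.
(* Translations are indexed by vectors over [int], which form a countable type. *)
pose J s (z : 'cV[int]_p) := mw s *m v - map_mx intr z.
pose Nl (k : seq int * 'cV[int]_p) : set X := if 0 < ldist (J k.1 k.2) (mw k.1 *m th)
  then [set y | G y /\ exists2 u, line (J k.1 k.2) (mw k.1 *m th) u &
        forall n, alive T iota Al N delta n u y] else set0.
have Nl0 k : mu.-negligible (Nl k).
  rewrite /Nl; case: ifP => h; last exact: negligible_set0.
  by apply: nullG => //; exact: mw_C al _ _ Cth.
have rec := ergodic_recurrence (coded_mT cd) (coded_inv cd) (coded_erg cd) mG G0.
have big : mu.-negligible (\bigcup_(k : nat * (seq int * 'cV[int]_p)) (iter k.1 T @^-1` Nl k.2)).
  apply: negligible_bigcup_count => k.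
  exact: negligible_iter_preimage (coded_mT cd) (coded_inv cd) _ _ (Nl0 _).
apply: negligibleS (negligibleU rec big) => x [Ox [w Lw [hw nw]]].
apply: contrapT => /not_orP[/contrapT recx nbig]; apply: nw; apply: intvec_of_near => e e0.
(* [delta] serves survival, [e] the distance from [w] to the integer point to be found. *)
have m0 : 0 < Num.min e delta by rewrite lt_min e0.
have [n0 _ hn0] := hw _ m0.
have [n nn Gn] := recx n0.
have [z iz] := hn0 n nn; rewrite lt_min => /andP[ze zd].
set s := wd n x in ze zd.
have [zi zE] : exists zi : 'cV[int]_p, z = map_mx intr zi.
  exists (\col_i Num.floor (z i 0)); apply/colP => i; rewrite !mxE.
  by have := iz i; rewrite intrEfloor => /eqP.
have [t _ wt] := Lw.
have Lu : line (J s zi) (mw s *m th) (mw s *m w - z).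
  by exists t => //; rewrite /J -zE -wt mulmxDr -scalemxAr addrAC.
have al_n k : alive T iota Al N delta k (mw s *m w - z) (iter n T x).
  apply: alive_of_near => // j.
  have [e' ie' he'] := hn0 (n + j)%N (leq_trans nn (leq_addr _ _)).
  exists (e' - mw (wd j (iter n T x)) *m z).
    by apply: intvecB => //; apply: intvec_mulmx => //; case: (mw_GLZ al (wd j (iter n T x))).
  move: he'; rewrite wd_cat mw_cat_mul mulmxBr opprB addrA subrK -/s.
  by rewrite lt_min => /andP[].
(* If the recentred line misses 0, the surviving point puts x in an excluded null set. Otherwise the
   line passes through 0, and its preimage contains an integer point [z0]. *)
have [l0|] := ltP 0 (ldist (J s zi) (mw s *m th)).
  exfalso; apply: nbig; exists (n, (s, zi)) => //=; rewrite /Nl /= l0.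
  by split => //; exists (mw s *m w - z).
move=> l0; have : ~ 0 < ldist (J s zi) (mw s *m th) by rewrite ltNge l0.
move=> /ldist_gt0P /contrapT[t' _ /= e0'].
pose z0 := v + t' *: th.
have Mz0 : mw s *m z0 = z.
  apply/eqP; rewrite -subr_eq0 -[X in _ == X]e0' /J -zE /z0 mulmxDr -scalemxAr.
  by rewrite addrAC.
have us : mw s \in unitmx := mw_unit al s.
exists z0.
  have -> : z0 = invmx (mw s) *m z by rewrite -Mz0 mulKmx.
  by apply: intvec_mulmx => //; case: (mw_GLZ al s).
apply: le_lt_trans ze; rewrite -Mz0 -mulmxBr.
have -> : w - z0 = (t - t') *: th by rewrite -wt /z0 opprD addrACA subrr add0r scalerBl.
have [->|tt] := eqVneq (t - t') 0; first by rewrite scale0r mulmx0 eucl0.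
by apply: (mw_expand al); exact: al_scale al _ _ Cth tt.
Qed.

End WeakStable.

(** * Coding of the cocycle *)

Section Integral.
Context {R : realType} {d : measure_display} {X : measurableType d}.
Variable mu : probability X R.
Local Open Scope ereal_scope.

(** Monotonicity for arbitrary nonnegative functions: the integral is a supremum over the simple
    functions below. *)
Lemma ge0_le_integralT (f g : X -> \bar R) : (forall x, 0 <= f x) ->
  (forall x, f x <= g x) -> \int[mu]_x f x <= \int[mu]_x g x.
Proof.
move=> f0 fg; have g0 x : 0 <= g x by exact: le_trans (fg x).
rewrite !ge0_integralTE //; apply: ge_ereal_sup => _ [h /= hf <-].
by apply: ereal_sup_ubound; exists h => //= x; exact: le_trans (fg x).
Qed.

(** The negative part is dominated by +oo on the null complement of [Om], so its integral vanishes
    and the bound on the integral concerns the positive part alone. *)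
Lemma integral_funepos_lty (f : X -> \bar R) (Om : set X) : measurable Om -> mu Om = 1 ->
  (forall x, Om x -> 0 <= f x) -> \int[mu]_x f x < +oo -> \int[mu]_x f^\+ x < +oo.
Proof.
move=> mO O1 f0; rewrite integralE.
have -> : \int[mu]_x f^\- x = 0; last by rewrite sube0.
have mOC : measurable (~` Om) by exact: measurableC.
have OC0 : mu (~` Om) = 0 by have := probability_setC mu mO; rewrite O1 subee.
apply/eqP; rewrite eq_le integral_ge0 // andbT.
apply: (@le_trans _ _ (\int[mu]_x ((cst +oo) \_ (~` Om)) x)).
  apply: ge0_le_integralT => // x; rewrite patchE; case: ifPn => [_|]; first exact: leey.
  rewrite notin_setE /= => /contrapT Ox.
  by rewrite funenegE ge_max leeNl oppe0 f0 /=.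
by rewrite -integral_mkcond integral_cst //= OC0 mule0.
Qed.

End Integral.

Section Cocycle.
Context {R : realType} {X : Type} {p : nat}.
Variables (T : X -> X) (A : X -> 'M[R]_p).

(** The multiplicative constant is absorbed by one more factor b^n once n > E/t, by Bernoulli; the
    n-th root is then at most b^2. *)
Lemma Ecs_of_subexponential x w :
  (forall b : R, 1 < b -> exists E, forall n, eucl (cocycle T A n x *m w) <= E * b ^+ n) ->
  Ecs T A x w.
Proof.
move=> h; rewrite /Ecs /=; apply/lee_addgt0Pr => e e0.
(* Ensures (1+t)^2 <= 1+3t <= 1+e. *)
pose t := Num.min e 1 / 3.
have t0 : 0 < t by rewrite divr_gt0 // lt_min e0 ltr01.
have [te t1] : t <= e / 3 /\ t <= 3^-1.
  by rewrite /t; split; rewrite ler_pdivrMr // ?mulfVK // ?mulVf // ge_min lexx ?orbT.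
pose b := 1 + t; have b1 : 1 < b by rewrite ltrDl.
have b0 : 0 < b by exact: lt_trans b1.
have [E hE] := h b b1.
pose n0 := (Num.trunc (E / t)).+1.
have be : b ^+ 2 <= 1 + e by rewrite expr2 /b; nra.
have bern n : 1 + n%:R * t <= b ^+ n.
  elim: n => [|n IH]; first by rewrite mul0r addr0 expr0.
  rewrite exprS -[n.+1%:R]natr1; apply: le_trans (ler_wpM2l (ltW b0) IH).
  have := mulr_ge0 (ler0n R n) (mulr_ge0 (ltW t0) (ltW t0)); rewrite /b; lra.
rewrite /limn_esup /limf_esup.
apply: (@le_trans _ _ (ereal_sup ((fun n : nat => ((eucl (cocycle T A n x *m w)) `^ (n%:R^-1))%:E)
   @` [set n | (n0 <= n)%N]))).
  by apply: ereal_inf_lbound; exists [set n | (n0 <= n)%N] => //; exists n0.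
apply: ge_ereal_sup => _ [n /= nn <-]; rewrite -EFinD lee_fin.
apply: le_trans be.
have np : (0 < n)%N by exact: leq_trans nn.
have nR : 0 < n%:R :> R by rewrite ltr0n.
have hn : eucl (cocycle T A n x *m w) <= (b ^+ 2) ^+ n.
  apply: le_trans (hE n) _; rewrite -exprM mulnC exprM expr2 ler_wpM2r ?exprn_ge0 ?(ltW b0) //.
  apply: le_trans (bern n).
  have : E / t < n%:R by apply: lt_le_trans (truncnS_gt _) _; rewrite ler_nat.
  rewrite ltr_pdivrMr //; lra.
have -> : b ^+ 2 = ((b ^+ 2) ^+ n) `^ (n%:R^-1).
  rewrite -[(b ^+ 2) ^+ n]powR_mulrn ?exprn_ge0 ?(ltW b0) //.
  by rewrite -powRrM divff ?gt_eqF // powRr1 // exprn_ge0 // ltW.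
by apply: ge0_ler_powR; rewrite ?nnegrE ?invr_ge0 ?eucl_ge0 ?exprn_ge0 ?(ltW b0) ?ler0n.
Qed.

Lemma near_int_of_distZ (w : 'cV[R]_p) (e : R) : distZ w < e -> near_int e w.
Proof.
move=> h; apply: contrapT => hn.
suff : e <= distZ w by rewrite leNgt h.
apply: lb_le_inf; first by exists (eucl (w - 0)), 0 => // i; rewrite mxE rpred0.
by move=> _ [z iz <-]; rewrite leNgt; apply/negP => ze; apply: hn; exists z.
Qed.

End Cocycle.

Section Coding.
Context {R : realType} {d : measure_display} {X : measurableType d} {p : nat}.
Variables (mu : probability X R) (T : X -> X) (A : X -> 'M[R]_p)
  (D : int -> set X) (Al : int -> 'M[R]_p) (C : set 'cV[R]_p).
Hypothesis ucA : uniform_cocycle mu T A.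
Hypothesis icA : integral_cocycle mu A.
Hypothesis lcA : locally_constant mu T A D Al.
Hypothesis adC : adapted mu T A Al C.

(** The default 0 is used only off the cells, where no point of the coded set lies. *)
Definition letter (x : X) : int := xget 0 [set l | D l x].

Definition good_point (x : X) : Prop :=
  [/\ exists l, D l x, forall l l', D l x -> D l' x -> l = l',
      forall l, D l x -> A x = Al l, GLZ (A x) &
      forall w, C w -> eucl w <= eucl (A x *m w) /\
        (fun n : nat => eucl (cocycle T A n x *m w)) @ \oo --> +oo].

Lemma good_point_ae : mu.-negligible [set x | ~ good_point x].
Proof.
have [[_ [_ [disj [cov _]]]] lc] := lcA.
have [_ _ ad] := adC.
have mD l : measurable (D l) by have [[_ [h _]] _] := lcA; case: (h l).
pose pairs := \bigcup_(k : int * int) (if k.1 != k.2 then D k.1 `&` D k.2 else set0).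
have n1 : mu.-negligible pairs.
  apply: negligible_bigcup_count => k; case: ifP => [/disj h|_]; last exact: negligible_set0.
  by apply/negligibleP => //; exact: measurableI.
have n2 : mu.-negligible (~` \bigcup_l D l).
  apply/negligibleP => //; apply: measurableC.
  exact: countable_bigcupT_measurable.
apply: negligibleS (negligibleU (negligibleU n1 n2) (negligibleU (negligibleU icA lc) ad)).
move=> x nx; apply: contrapT => /not_orP[/not_orP[h1 h2] /not_orP[/not_orP[h3 h4] h5]].
apply: nx; split.
- by move/contrapT: h2 => [l _ Dl]; exists l.
- move=> l l' Dl Dl'; apply: contrapT => /eqP ll; apply: h1.
  by exists (l, l') => //=; rewrite ll.
- exact: contrapT h4.
- exact: contrapT h3.
- exact: contrapT h5.
Qed.

Lemma good_letter x l : good_point x -> (letter x = l <-> D l x).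
Proof.
move=> [[l0 Dl0] un _ _ _].
have Dx : D (letter x) x by exact: (@xgetPex _ 0 [set l | D l x] (ex_intro _ _ Dl0)).
by split=> [<-|Dl] //; exact: un.
Qed.

(** Removing all preimages of the exceptional null set leaves a forward invariant set of full
    measure. There itinerary cylinders agree with those of the partition, and the upper distortion
    bound, applied to a cylinder as target, gives the inequality for concatenated words. *)
Lemma coding : exists (Om : set X) (K : R),
  coded mu T letter Om K /\ forall x, Om x -> forall n, good_point (iter n T x).
Proof.
have [mT inv erg _] := ucA.
have [[_ [mD [_ [_ [_ [_ [K [K0 dist]]]]]]]] _] := lcA.
have [N [mN N0 hN]] := good_point_ae.
pose Om := \bigcap_n (iter n T @^-1` (~` N)).
have mOm : measurable Om.
  by apply: bigcap_measurable => // n _; apply: measurable_iter_preimage => //; exact: measurableC.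
have Ogood x : Om x -> forall n, good_point (iter n T x).
  by move=> Ox n; apply: contrapT => h; apply: (Ox n I); exact: hN.
have OmC0 : mu (~` Om) = 0%E.
  apply/negligibleP; first exact: measurableC.
  rewrite /Om setC_bigcap; apply: negligible_bigcup_count => n.
  rewrite preimage_setC setCK.
  by apply: negligible_iter_preimage => //; apply/negligibleP.
have Om1 : mu Om = 1%E.
  by have := probability_setC mu (measurableC mOm); rewrite setCK OmC0 sube0.
have mcyl s : measurable (cylinder D T s).
  have -> : cylinder D T s = \bigcap_k
      (if (k < size s)%N then iter k T @^-1` D (nth 0 s k) else setT).
    apply/seteqP; split => x h k; first by move=> _; case: ifP => // ks; exact: h.
    by move=> ks; have := h k I; rewrite ks.
  apply: bigcap_measurable => // k _; case: ifP => // _.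
  by apply: measurable_iter_preimage => //; case: (mD (nth 0 s k)).
have cylE s : cyl T letter Om s = Om `&` cylinder D T s.
  apply/seteqP; split => x [Ox hx]; split => //.
    move=> k ks /=; apply/good_letter; first exact: Ogood.
    by rewrite -hx nth_wd.
  rewrite /=; apply: (@eq_from_nth _ 0); rewrite size_wd // => k ks.
  have := hx k ks => /good_letter -/(_ (Ogood _ Ox k)) <-.
  by rewrite nth_wd.
have muc s : mu (cyl T letter Om s) = mu (cylinder D T s).
  rewrite cylE; apply: le_anti; apply/andP; split.
    by apply: le_measure; rewrite ?inE //; exact: measurableI.
  apply: (@le_trans _ _ (mu ((Om `&` cylinder D T s) `|` ~` Om))).
    apply: le_measure; rewrite ?inE //.
      by apply: measurableU; [exact: measurableI|exact: measurableC].
    by move=> x cx; case: (pselect (Om x)); [left|right].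
  apply: (le_trans (@measureU2 _ _ _ mu _ _ (measurableI _ _ mOm (mcyl s)) (measurableC mOm))).
  rewrite -[leRHS]adde0; apply: leeD => //; by rewrite -OmC0.
exists Om, K; split => //; split => //.
- by move=> x Ox n _; have := Ox n.+1 I; rewrite /= -iterS iterSr.
- move=> l; rewrite (_ : _ `&` _ = Om `&` D l); first by apply: measurableI => //; case: (mD l).
  apply/seteqP; split => x [Ox h]; split => //; apply/good_letter => //; exact: (Ogood x Ox 0%N).
- move=> s t; rewrite /wprob !muc.
  have cat : cylinder D T (s ++ t) = cylinder D T s `&` iter (size s) T @^-1` cylinder D T t.
    apply/seteqP; split => x; rewrite /cylinder /= size_cat.
      move=> h; split => k ks.
        by have := h k (leq_trans ks (leq_addr _ _)); rewrite nth_cat ks.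
      have := h (size s + k)%N; rewrite ltn_add2l => /(_ ks).
      by rewrite nth_cat ltnNge leq_addr /= addKn addnC iterD.
    move=> [h1 h2] k ks; rewrite nth_cat; case: ltnP => ksz; first exact: h1.
    have kk : (k - size s < size t)%N by rewrite ltn_subLR.
    by have := h2 _ kk; rewrite -iterD subnK.
  have [_] := dist s _ (mcyl t); rewrite /= -cat.
  have fs u : mu (cylinder D T u) = (fine (mu (cylinder D T u)))%:E.
    by rewrite fineK // fin_num_measure.
  rewrite (fs s) (fs t) (fs (s ++ t)) -!EFinM lee_fin => /le_trans; apply.
  by rewrite mulrAC.
Qed.

End Coding.

Section Letters.
Context {R : realType} {d : measure_display} {X : measurableType d} {p : nat}.
Variables (mu : probability X R) (T : X -> X) (A : X -> 'M[R]_p)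
  (D : int -> set X) (Al : int -> 'M[R]_p) (C : set 'cV[R]_p).
Hypothesis ucA : uniform_cocycle mu T A.
Hypothesis lcA : locally_constant mu T A D Al.
Hypothesis adC : adapted mu T A Al C.
Variables (Om : set X) (K : R).
Hypothesis cd : coded mu T (letter D) Om K.
Hypothesis Ogood : forall x, Om x -> forall n, good_point T A D Al C (iter n T x).
Local Notation iota := (letter D).

Lemma good_letter_mx x : good_point T A D Al C x -> A x = Al (iota x).
Proof. by move=> gx; have [_ _ h _ _] := gx; apply: h; apply/(good_letter _ gx). Qed.

Lemma cocycle_mw x n : Om x -> cocycle T A n x = mw Al (wd T iota n x).
Proof.
move=> Ox; elim: n => [//|n IH] /=.
rewrite -[mw _ (wd T iota n (T x)) *m _]/(mw Al (wd T iota n.+1 x)) -addn1 wd_cat mw_cat.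
by rewrite IH /= mul1mx (good_letter_mx (Ogood Ox n)).
Qed.

(** A cell has positive measure, hence meets the full measure set [Om]. *)
Lemma letter_point l : exists x, [/\ Om x, iota x = l & A x = Al l].
Proof.
have [[_ [hD _]] _] := lcA; have [mD D0] := hD l.
have [x [Dx Ox]] : exists x, D l x /\ Om x.
  apply: contrapT => h; move: D0.
  suff -> : mu (D l) = 0%E by rewrite ltxx.
  have mO := coded_mOm cd.
  have OC : mu (~` Om) = 0%E by have := probability_setC mu mO; rewrite (coded_Om1 cd) subee.
  apply/eqP; rewrite eq_le measure_ge0 andbT -OC.
  apply: le_measure; rewrite ?inE //; first exact: measurableC.
  by move=> x Dx Ox; apply: h; exists x.
have gx := Ogood Ox 0%N.
have il : iota x = l by apply/(good_letter _ gx).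
by exists x; rewrite (good_letter_mx gx) il.
Qed.

Lemma letters_adapted : (exists w, C w) -> adapted_letters Al C.
Proof.
move=> neC; have [[C1 C2 C3] aC _] := adC.
split => //.
- by move=> l; have [x [Ox _ <-]] := letter_point l; case: (Ogood Ox 0%N).
- move=> l w Cw; have [x [Ox _ <-]] := letter_point l.
  by have [_ _ _ _ /(_ w Cw)[]] := Ogood Ox 0%N.
Qed.

Lemma orbit_unbounded x th (B : R) : Om x -> C th ->
  exists n, B < eucl (mw Al (wd T iota n x) *m th).
Proof.
move=> Ox Cth; have [_ _ _ _ /(_ th Cth)[_ /cvgryPgt/(_ B)[n _ hn]]] := Ogood Ox 0%N.
by exists n; rewrite -cocycle_mw //; exact: hn n (leqnn n).
Qed.

(** Each finite partial sum is the integral of a finite sum of multiples of cylinder indicators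
    lying below the positive part of ln [norm0 (A x)]. *)
Lemma lognorm_summable : adapted_letters Al C ->
  (wsum mu T iota Om [::] 1 (lognorm Al) < +oo)%E.
Proof.
move=> al; have [_ _ _ fi] := ucA.
pose f x : \bar R := (ln (norm0 (A x)))%:E.
have fO x : Om x -> f x = (lognorm Al (wd T iota 1 x))%:E.
  by move=> Ox; rewrite /f (good_letter_mx (Ogood Ox 0%N)) /lognorm big_seq1.
have fpos : (\int[mu]_x (f^\+)%E x < +oo)%E.
  apply: (integral_funepos_lty (coded_mOm cd) (coded_Om1 cd)) => // x Ox.
  by rewrite fO // lee_fin (lognorm_ge0 al).
apply: le_lt_trans fpos; apply: ge_ereal_sup => _ [F [fF FW] <-].
pose h s x : \bar R := (lognorm Al s * \1_(cyl T iota Om s) x)%:E.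
have h0 s x : (0 <= h s x)%E by rewrite lee_fin mulr_ge0 ?(lognorm_ge0 al).
have mh s : measurable_fun setT (h s).
  apply/measurable_EFinP; apply: measurable_funM => //.
  by apply: measurable_indic; exact: cyl_measurable cd _.
have -> : (\sum_(s \in F) (wprob mu T iota Om ([::] ++ s) * lognorm Al s)%:E)%E =
    (\int[mu]_x (\sum_(s \in F) h s x))%E.
  rewrite ge0_integral_fsum //; apply: eq_fsbigr => s _.
  rewrite /h (@integralZl_indic _ _ _ mu setT measurableT (fun=> cyl T iota Om s)) //.
  - rewrite integral_indic ?setIT; [|exact: measurableT|exact: cyl_measurable cd _].
    by rewrite mulrC EFinM; congr (_ * _)%E; exact: esym (mu_cyl cd s).
  - by rewrite ltNge (lognorm_ge0 al).
  - exact: cyl_measurable cd _.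
apply: ge0_le_integralT => x; first by apply: fsume_ge0 => s _.
have hz s : ~ cyl T iota Om s x -> h s x = 0%E.
  by move=> nc; rewrite /h indicE memNset // mulr0.
have pos0 : (0 <= f^\+ x)%E by [].
have [Ox|nOx] := pselect (Om x); last first.
  by rewrite fsbig1 // => s _; apply: hz => -[].
have cs s : F s -> cyl T iota Om s x -> s = wd T iota 1 x.
  by move=> /FW Ws [_ /=]; rewrite Ws.
have [Fs|nFs] := pselect (F (wd T iota 1 x)); last first.
  by rewrite fsbig1 // => s Fs; apply: hz => /(cs _ Fs) e; apply: nFs; rewrite -e.
rewrite (fsbigD1 (wd T iota 1 x)) //= fsbig1; last first.
  by move=> s [Fs' /= ns]; apply: hz => /(cs _ Fs').
rewrite adde0 /h indicE mem_set ?mulr1; last by split => //=.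
by rewrite -(fO x Ox) funeposE le_max lexx.
Qed.

End Letters.

Theorem theorem3p1 (R : realType) (d : measure_display) (Delta : measurableType d)
  (mu : probability Delta R) (p : nat)
  (T : Delta -> Delta) (A : Delta -> 'M[R]_p)
  (D : int -> set Delta) (Al : int -> 'M[R]_p) (C : set 'cV[R]_p) :
  uniform_cocycle mu T A ->
  integral_cocycle mu A ->
  locally_constant mu T A D Al ->
  adapted mu T A Al C ->
  (* every line J in J(Theta) misses E^cs(x) for a.e. x *)
  (forall v th : 'cV[R]_p, C th -> ~ line v th 0 ->
     {ae mu, forall x, line v th `&` Ecs T A x = set0}) ->
  (* then every line L parallel to an element of Theta satisfies
     L \cap W^s(x) \subset Z^p for a.e. x *)
  forall v th : 'cV[R]_p, C th ->
    {ae mu, forall x, line v th `&` Ws T A x `<=` [set z | intvec z]}.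
Proof.
move=> ucA icA lcA adC avoid v th Cth.
have [Om [K [cd Ogood]]] := coding ucA icA lcA adC.
have al : adapted_letters Al C by apply: (letters_adapted lcA adC cd Ogood); exists th.
have fin := lognorm_summable ucA cd Ogood al.
have unb := orbit_unbounded Ogood.
have lines : forall v th, C th -> 0 < ldist v th -> mu.-negligible
    [set x | Om x /\ exists2 w, line v th w & subexponential T (letter D) Al x w].
  move=> v' th' C' /ldist_gt0P l'; apply: negligibleS (avoid v' th' C' l').
  move=> x [Ox [w Lw sw]] /= e0.
  suff : (line v' th' `&` Ecs T A x) w by rewrite e0.
  split => //; apply: Ecs_of_subexponential => b b1; have [E hE] := sw b b1.
  by exists E => n; rewrite (cocycle_mw Ogood) //; exact: hE.
have OC : mu.-negligible (~` Om).
  have mO := coded_mOm cd; apply/negligibleP; first exact: measurableC.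
  by have := probability_setC mu mO; rewrite (coded_Om1 cd) subee.
apply: negligibleS (negligibleU OC (coded_weak_stable cd al unb fin lines v Cth)).
move=> x /= nx; have [Ox|] := pselect (Om x); last by left.
right; split => //; apply: contrapT => hx; apply: nx => w [Lw Ww].
apply: contrapT => nw; apply: hx; exists w => //; split => // e e0.
have := Ww; rewrite /Ws /= => /cvgrPdist_lt /(_ e e0); apply: filterS => n.
rewrite sub0r normrN (cocycle_mw Ogood) // => /(le_lt_trans (ler_norm _)).
exact: near_int_of_distZ.
Qed.
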